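(* For every $n\in\{4,5\}$ and every integer $k\ge 1$, $GR_k(C_{2n+1}) = n\cdot 2^k+1$. Equivalently: every Gallai $k$-coloring of the edges of the complete graph $K_{n\cdot 2^k+1}$ contains a monochromatic cycle of length $2n+1$, and there is a Gallai $k$-coloring of $K_{n\cdot 2^k}$ with no monochromatic cycle of length $2n+1$. In particular, $GR_k(C_9)=4\cdot 2^k+1$ and $GR_k(C_{11})=5\cdot 2^k+1$ for all $k\ge1$.
   Context: All graphs are finite and simple. $K_m$ denotes the complete graph on $m$ vertices and $C_m$ the cycle on $m$ vertices. A Gallai coloring is a coloring of the edges of a complete graph with no rainbow triangle (a triangle whose three edges receive three distinct colors). A Gallai $k$-coloring is a Gallai coloring using (at most) $k$ colors. For an integer $k\ge1$ and a graph $H$, the Gallai-Ramsey number $GR_k(H)$ is the least positive integer $N$ such that every Gallai $k$-coloring of $K_N$ contains a monochromatic copy of $H$. *)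

(* Defs.v *)
From mathcomp Require Import all_boot.

Set Implicit Arguments.
Unset Strict Implicit.
Unset Printing Implicit Defensive.

Record sgraph := SGraph {
  vertex :> finType;
  adj : rel vertex;
  adj_sym : symmetric adj;
  adj_irrefl : irreflexive adj
}.

(* The cycle C_m on the vertices 0, ..., m-1; this is the usual cycle when
   m >= 3. *)
Definition cycle_adj (m : nat) : rel 'I_m :=
  fun i j => (i != j) && ((j == i.+1 %% m :> nat) || (i == j.+1 %% m :> nat)).

Lemma cycle_adj_sym (m : nat) : symmetric (@cycle_adj m).
Proof. by move=> i j; rewrite /cycle_adj eq_sym orbC. Qed.

Lemma cycle_adj_irrefl (m : nat) : irreflexive (@cycle_adj m).
Proof. by move=> i; rewrite /cycle_adj eqxx. Qed.

Definition cycle_graph (m : nat) : sgraph :=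
  SGraph (@cycle_adj_sym m) (@cycle_adj_irrefl m).

(* An edge coloring of K_N with at most k colors is a symmetric function
   c : 'I_N -> 'I_N -> 'I_k; the values c x x carry no information, and no
   definition below depends on them. *)
Definition edge_coloring (k N : nat) (c : 'I_N -> 'I_N -> 'I_k) : Prop :=
  forall x y, c x y = c y x.

Definition rainbow_triangle (k N : nat) (c : 'I_N -> 'I_N -> 'I_k)
    (x y z : 'I_N) : Prop :=
  [/\ x <> y, y <> z & x <> z] /\
  [/\ c x y <> c y z, c y z <> c x z & c x y <> c x z].

Definition gallai_coloring (k N : nat) (c : 'I_N -> 'I_N -> 'I_k) : Prop :=
  edge_coloring c /\ ~ (exists x y z, rainbow_triangle c x y z).

(* Copies are subgraphs, not necessarily induced. *)
Definition monochromatic_copy (H : sgraph) (k N : nat)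
    (c : 'I_N -> 'I_N -> 'I_k) : Prop :=
  exists (a : 'I_k) (f : H -> 'I_N),
    injective f /\ forall x y : H, adj x y -> c (f x) (f y) = a.

Definition gallai_forces (k : nat) (H : sgraph) (N : nat) : Prop :=
  forall c : 'I_N -> 'I_N -> 'I_k, gallai_coloring c -> monochromatic_copy H c.

(* GR_k(H) = N. *)
Definition is_gallai_ramsey (k : nat) (H : sgraph) (N : nat) : Prop :=
  [/\ 0 < N, gallai_forces k H N
    & forall M : nat, 0 < M -> gallai_forces k H M -> N <= M].

(* Main.v *)
Require Import Defs.
From mathcomp Require Import all_boot.
From mathcomp Require Import zify.

(** The upper bound is proved for configurations: a core [A] colored with a set [K] of colors,
    together with sets [X i], i in [K], of at most [n] vertices all of whose edges to [A] have
    color i; the edges inside the [X i] are irrelevant. One shows |A| + sum |X i| <= n 2^|K|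
    by induction on |K| and then on |A|. Two facts drive the argument: if n vertices are joined
    in color i to a set of more than n vertices, then color i does not occur in that set; and a
    graph on 2n+1 vertices with at most n-1 non-neighbours at each vertex is Hamiltonian.
    Take a Gallai partition of [A] with colors r and b between the parts. Two parts of more than
    n vertices split [A] into pieces that avoid r, b or both. If a single part is that large, its
    neighbourhoods in r and b are either attached to it as new sets [X r], [X b], which shrinks the
    core, or they again exclude colors. If all parts have at most n vertices, a largest part with
    at least three vertices bounds its own neighbourhoods through packings of paths with three
    vertices; and parts of at most two vertices lead to a blow-up of a 2-colored complete graph,
    for which monochromatic cycles are made to grow until one of length 2n+2 appears. Such a
    cycle without a monochromatic C_(2n+1) forces its two parity classes to be cliques in
    the other color. *)

Set Implicit Arguments.
Unset Strict Implicit.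
Unset Printing Implicit Defensive.

(** * Gaps in vertex orders and Dirac's theorem *)

(** Attached sets are unavoidable: a part with small neighbourhoods may still use every color, so
    induction on the colors says nothing about it, and the few vertices around it must be counted
    along with it. This fixes the two size thresholds. A violation with two colors has more than 4n
    vertices. With three colors it has at least 8n + 1 vertices, of which the third attached set
    holds at most n - 1, so at least 7n + 2 lie in [A], [X r] and [X b]; further colors leave more
    room. The restriction to n = 4, 5 enters numerically. From n >= 4 comes that two parts of at
    most two vertices fit into the non-neighbours allowed by Dirac's condition. From n <= 5 comes 3n
    + 6 > 4n, which makes one doubled parity class large enough, and the packings of three-vertex
    paths have few enough breaks. The chord arguments are explicit cycles on 10 and 12 vertices. *)

Section Gaps.

Variables (T : eqType) (e : rel T).

Fixpoint gaps (x : T) (s : seq T) : nat :=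
  if s is y :: s' then ~~ e x y + gaps y s' else 0.

Lemma gaps_cat x s1 s2 : gaps x (s1 ++ s2) = gaps x s1 + gaps (last x s1) s2.
Proof. by elim: s1 x => //= y s1 IH x; rewrite IH addnA. Qed.

Lemma gaps_rcons x s y : gaps x (rcons s y) = gaps x s + ~~ e (last x s) y.
Proof. by rewrite -cats1 gaps_cat /= addn0. Qed.

Lemma gaps_eq0 x s : (gaps x s == 0) = path e x s.
Proof. by elim: s x => //= y s IH x; rewrite addn_eq0 IH; case: (e x y). Qed.

Lemma gaps_size x s : gaps x s <= size s.
Proof. by elim: s x => //= y s IH x; have := IH y; case: (e x y) => /=; lia. Qed.

Lemma gaps_take x s k : gaps x (take k s) <= gaps x s.
Proof. by rewrite -{2}(cat_take_drop k s) gaps_cat leq_addr. Qed.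

Lemma gaps_pos x s : 0 < gaps x s ->
  exists s1 y s2, s = s1 ++ y :: s2 /\ ~~ e (last x s1) y.
Proof.
elim: s x => //= y s IH x; case exy: (e x y) => /= h; last first.
  by exists [::], y, s; rewrite /= exy.
by have [s1 [z [s2 [-> ?]]]] := IH y h; exists (y :: s1), z, s2.
Qed.

Definition cyclic_gaps (s : seq T) : nat :=
  if s is x :: s' then gaps x (rcons s' x) else 0.

Lemma cyclic_gaps_eq0 s : (cyclic_gaps s == 0) = cycle e s.
Proof. by case: s => //= x s; rewrite gaps_eq0. Qed.

Lemma cyclic_gaps_catC s1 s2 : cyclic_gaps (s1 ++ s2) = cyclic_gaps (s2 ++ s1).
Proof.
case: s1 s2 => [|x s1] [|y s2]; rewrite ?cats0 //=.
by rewrite !rcons_cat /= !gaps_cat /= !gaps_rcons; lia.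
Qed.

Hypothesis e_sym : symmetric e.

Lemma rev_lastI (x : T) s : rev (x :: s) = last x s :: rev (belast x s).
Proof. by rewrite lastI rev_rcons. Qed.

Lemma last_rev_belast (x : T) s : last (last x s) (rev (belast x s)) = x.
Proof. by rewrite -(last_cons x) -rev_lastI rev_cons last_rcons. Qed.

Lemma gaps_rev x s : gaps (last x s) (rev (belast x s)) = gaps x s.
Proof.
elim: s x => //= y s IH x.
by rewrite rev_cons gaps_rcons IH last_rev_belast addnC e_sym.
Qed.

(** Pigeonhole on the consecutive pairs of [y :: s]: a pair gets one vote from [a] at its first
    vertex and one from [b] at its second, and there are more votes than pairs. *)
Lemma crossover (a b : pred T) y s :
  size s < count a (belast y s) + count b s ->
  exists t w s2, [/\ s = t ++ w :: s2, a (last y t) & b w].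
Proof.
elim: s y => //= z s IH y h.
have [/andP[ay bz]|nab] := boolP (a y && b z); first by exists [::], z, s.
have /IH[t [w [s2 [-> ? ?]]]] : size s < count a (belast z s) + count b s.
  by move: h nab; case: (a y); case: (b z) => //=; clear; lia.
by exists (z :: t), w, s2.
Qed.

Hypothesis e_irr : irreflexive e.

(* A cyclic order with fewest gaps has none: a gap between the last vertex and the
   first can be closed by reversing an initial segment. *)
Lemma dirac n s : size s = n.*2.+1 ->
    (forall x, x \in s -> count (fun y => ~~ e x y) s <= n) ->
  exists2 z, perm_eq z s & cycle e z.
Proof.
have [k] := ubnP (cyclic_gaps s); elim: k s => // k IH s.
rewrite ltnS => le_k sz deg.
have [/eqP|gt0] := posnP (cyclic_gaps s).
  by rewrite cyclic_gaps_eq0; exists s.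
have [y [s' [pys gap_eq gap]]] : exists y s', [/\ perm_eq (y :: s') s,
    cyclic_gaps (y :: s') = cyclic_gaps s & ~~ e (last y s') y].
  case: (s) gt0 => //= x s0 gt0.
  have [s1 [y [s2 [def_s Ngap]]]] := gaps_pos gt0.
  case: (lastP s2) def_s => [|s3 z].
    by rewrite cats1 => /rcons_inj[-> yx]; exists x, s1; split; rewrite // {2}yx.
  rewrite -rcons_cons -rcons_cat => /rcons_inj[def_s0 def_x].
  exists y, (s3 ++ x :: s1); split.
  - by rewrite def_s0; apply/permEl; exact: (perm_catC (y :: s3) (x :: s1)).
  - by rewrite [LHS](cyclic_gaps_catC (y :: s3) (x :: s1)) def_s0.
  - by rewrite last_cat.
have szs' : size s' = n.*2.
  by have := perm_size pys; rewrite /= sz => -[].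
have deg' x : x \in y :: s' -> n < count (e x) (y :: s').
  rewrite (perm_mem pys) => xs; have := deg x xs.
  rewrite -(permP pys); have := count_predC (e x) (y :: s').
  have -> : count (predC (e x)) (y :: s') = count (fun z => ~~ e x z) (y :: s') by [].
  by rewrite [size _]/= szs'; lia.
(* A vertex is its own non-neighbour, so the bound [n] leaves at least n + 1 neighbours; the two
   ends together have 2n + 2, against 2n consecutive pairs. *)
have [|t [w [s2 [def_s av bw]]]] := @crossover (e (last y s')) (e y) y s'.
  have h1 := deg' _ (mem_last y s'); have h2 := deg' y (mem_head _ _).
  move: h2; rewrite [count _ (_ :: _)]/= e_irr.
  move: h1; rewrite lastI -cats1 count_cat [count _ [:: _]]/= e_irr szs'.
  by lia.
have z_perm : perm_eq (rev (y :: t) ++ w :: s2) (y :: s').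
  by rewrite def_s -cat_cons perm_cat2r perm_rev.
have [||x xs|z pz cz] := IH (rev (y :: t) ++ w :: s2).
- apply: leq_trans le_k; rewrite -gap_eq def_s rev_lastI.
  move: gap av; rewrite def_s last_cat /= => gap av.
  rewrite !rcons_cat !gaps_cat gaps_rev last_rev_belast /= !gaps_rcons.
  by rewrite bw av gap; clear; lia.
- by rewrite (perm_size z_perm) /= szs'.
- rewrite (permP z_perm) (permP pys); apply: deg.
  by rewrite -(perm_mem pys) -(perm_mem z_perm).
- exists z => //; exact: perm_trans pz (perm_trans z_perm pys).
Qed.

End Gaps.

(** * Linking paths and rerouting cycles *)

(* [lia] does not identify the carrier of a finite type with the carrier of its
   equality type. *)
Ltac flia := first [ lia |
  unfold Finite.Exports.fintype_Finite__to__eqtype_Equality in *;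
  cbn [Equality.sort] in *; lia ].

Section Links.

Variables (T : eqType) (e : rel T) (S : pred T) (lam : nat).

(** A lower bound [lam] on the number of common neighbours in [S], phrased for greedy choice: [G]
    lists the link vertices already spent. *)
Definition linkable (A : pred T) := forall u w G, A u -> A w -> u != w ->
  size G < lam -> exists v, [/\ S v, v \notin G, e u v & e v w].

(** Every gap must receive a link vertex, and a genuine edge may be subdivided by one as well; hence
    any [q] between the number of gaps and the number of steps can be reached. [F] collects the
    links used so far. *)
Lemma link_path os x q F : linkable (mem (x :: os)) -> uniq (x :: os) ->
    gaps e x os <= q <= size os -> size F + q <= lam ->
  exists z ls, [/\ path e x z, last x z = last x os, perm_eq z (os ++ ls),
    size ls = q & [/\ uniq ls, all S ls & forall v, v \in ls -> v \notin F]].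
Proof.
elim: os x q F => [|y os IH] x q F lnk.
  by rewrite /= leqn0 => _ /eqP-> _; exists [::], [::]; split.
move=> /andP[xos uos] /andP[gap_q q_sz] sz_q.
have lnk' : linkable (mem (y :: os)).
  by move=> u w G yu yw; apply: lnk; rewrite /= in_cons; apply/orP; right.
have xy : x != y by apply: contraNneq xos => ->; rewrite mem_head.
have [exy_q|link_q] := boolP (e x y && (q <= size os)).
  have [exy q_os] := andP exy_q; move: gap_q; rewrite /= exy add0n => gap_q.
  have [||z [ls [pz lz perm_z szl uls]]] := IH y q F lnk' uos; rewrite ?gap_q //.
  by exists (y :: z), ls; split; rewrite //= ?exy ?pz // perm_cons.
have q_gt0 : 0 < q.
  by move: link_q gap_q q_sz => /=; case: (e x y); clear; lia.
have y_in : y \in x :: y :: os by rewrite !inE eqxx orbT.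
have szF : size F < lam by move: q_gt0 sz_q; clear; lia.
have [v [Sv vF exv evy]] := lnk x y F (mem_head _ _) y_in xy szF.
have [||z [ls [pz lz perm_z szl [uls Sls lsF]]]] := IH y q.-1 (v :: F) lnk' uos.
- by move: gap_q q_sz link_q (gaps_size e y os) => /=; case: (e x y) => /=; clear; lia.
- by move: q_gt0 sz_q; rewrite /=; clear; lia.
exists (v :: y :: z), (v :: ls); split; rewrite /= ?exv ?evy ?pz //; last 2 first.
- by rewrite szl prednK.
- split; first by rewrite uls andbT; apply/negP => /lsF; rewrite mem_head.
  + by rewrite Sls andbT.
  + by move=> w; rewrite inE => /predU1P[-> //|/lsF]; rewrite inE negb_or => /andP[].
have : perm_eq (v :: y :: z) (v :: y :: os ++ ls) by rewrite !perm_cons.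
move/perm_trans; apply; exact/permEl/(perm_catCA [:: v] (y :: os) ls).
Qed.

(** One link vertex is reserved for closing the path. This makes the lower bound on [q] strict and
    raises the upper one by one. *)
Lemma link_cycle x os q : linkable (mem (x :: os)) -> uniq (x :: os) ->
    all (predC S) (x :: os) -> 0 < size os ->
    gaps e x os < q <= (size os).+1 -> q <= lam ->
  exists z, [/\ uniq z, cycle e z, size z = (size os).+1 + q &
    forall v, v \in z -> (v \in x :: os) || S v].
Proof.
case: q => // q lnk uos /allP Sos sz gq q_lam.
have x_last : last x os != x.
  by case: os sz uos {lnk Sos gq} => //= y os _ /andP[xos _]; apply: contraNneq xos => <-; rewrite mem_last.
have [|z [ls [pz lz perm_z szl [uls Sls _]]]] := link_path (F := [::]) lnk uos gq.
  exact: ltnW.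
have szls : size ls < lam by rewrite szl.
have [v [Sv vls ev1 ev2]] := lnk _ x ls (mem_last x os) (mem_head _ _) x_last szls.
exists (v :: x :: z); split.
- have perm_xz : perm_eq (x :: z) (x :: os ++ ls) by rewrite perm_cons.
  rewrite cons_uniq (perm_mem perm_xz) (perm_uniq perm_xz) -cat_cons.
  rewrite mem_cat negb_or vls cat_uniq uos uls !andbT /=.
  rewrite -(negbK (v \in _)) (contraL (Sos v)) ?negbK //=.
  apply/hasPn => w wls; have Sw := allP Sls w wls.
  by apply: contraL Sw; exact: Sos.
- by rewrite /= rcons_path pz lz ev1 ev2.
- by rewrite /= (perm_size perm_z) size_cat szl; clear; lia.
- move=> w; rewrite in_cons => /predU1P[->|]; first by rewrite Sv orbT.
  rewrite !in_cons (perm_mem perm_z) mem_cat => /or3P[->|->|/(allP Sls)->] //;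
  by rewrite !orbT.
Qed.

End Links.

Lemma linkable_sub (T : eqType) (e : rel T) S lam (A B : pred T) :
  subpred A B -> linkable e S lam B -> linkable e S lam A.
Proof. by move=> AB lnk u w G /AB Bu /AB; apply: lnk. Qed.

Lemma linkable_complete (T : finType) (e : rel T) (S : {set T}) (A : pred T) :
    symmetric e -> (forall s a, s \in S -> A a -> e s a) ->
  linkable e (mem S) #|S| A.
Proof.
move=> e_sym eSA u w G Au Aw _ szG.
have /subsetPn[v vS vG] : ~~ (S \subset G).
  by apply: contraL szG => /subset_leq_card; rewrite -leqNgt => /leq_trans; apply; exact: card_size.
by exists v; split=> //; [rewrite e_sym|]; apply: eSA.
Qed.

Lemma count_le_card (T : finType) (p : pred T) s (D : {set T}) : uniq s ->
  (forall x, x \in s -> p x -> x \in D) -> count p s <= #|D|.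
Proof.
move=> us h; rewrite -size_filter -(card_uniqP (filter_uniq p us)).
by apply: subset_leq_card; apply/subsetP => x; rewrite mem_filter => /andP[/[swap]]; exact: h.
Qed.

Lemma sub_seq_card (T : finType) (A : {set T}) k : k <= #|A| ->
  exists s, [/\ uniq s, size s = k & {subset s <= A}].
Proof. by move/card_geqP. Qed.

(** A gap can only arise where vertices of [S] were cut out, and it is charged to one of them. Here
    [w] is the true predecessor of [t] and [y] the last retained vertex; they differ only if [w]
    lies in [S]. *)
Lemma gaps_filter (T : eqType) (e e0 : rel T) (S z : pred T) t y w :
    (forall x y, z x -> z y -> ~~ S x -> ~~ S y -> e x y -> e0 x y) ->
    z y -> all z t -> ~~ S y -> path e w t -> S w || (w == y) ->
  gaps e0 y (filter (predC S) t) <= S w + count S t.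
Proof.
move=> eO; elim: t y w => //= a t IH y w zy /andP[za zt] NSy /andP[ewa pt] wy.
have [Sa|NSa] := boolP (S a) => /=.
  by have := IH y a zy zt NSy pt; rewrite Sa => /(_ isT); clear; lia.
have := IH a a za zt NSa pt; rewrite eqxx orbT (negbTE NSa) => /(_ isT).
case: (boolP (S w)) wy => /= [_|_ /eqP wy]; first by case: (e0 y a) => /=; clear; lia.
by rewrite eO -?wy //= ?wy //; clear; lia.
Qed.

(* Two vertices of [S] adjacent on the cycle are separated by moving one vertex
   of the complement between them, which is possible as long as [S] is a minority. *)
Lemma unfill_cycle (T : finType) (e e0 : rel T) (S : {set T}) z :
    symmetric e0 -> uniq z -> cycle e z ->
    (forall x y, x \in z -> y \in z -> x \notin S -> y \notin S -> e x y -> e0 x y) ->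
    (forall x y, x \in z -> y \in z -> x \in S -> y \notin S -> e0 x y) ->
    2 * count (mem S) z < size z ->
  exists z', [/\ uniq z', cycle e0 z', size z' = size z & {subset z' <= z}].
Proof.
move=> e0_sym uz cz eO eS minor.
have [/hasP[s0 s0z s0S]|noS] := boolP (has (mem S) z); last first.
  exists z; split=> //; apply: (@sub_in_cycle _ [in z] e) cz; last exact/allP.
  by move=> x y xz yz; apply: eO => //; apply: (hasPn noS).
(* Starting the cycle at a vertex of [S] saves one charge: the retained vertices have fewer gaps
   than [z] has vertices in [S], so one of these remains for closing the new cycle. *)
have [i z1 def_z] := rot_to s0z.
have z1z : {subset z1 <= z} by move=> x xz1; rewrite -(mem_rot i) def_z in_cons xz1 orbT.
have pz1 : path e s0 z1.
  by move: cz; rewrite -(rot_cycle i) def_z /= rcons_path => /andP[].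
have cnt : count (mem S) z = (count (mem S) z1).+1.
  by rewrite -(permP (permEl (perm_rot i z))) def_z /= [s0 \in S]s0S.
have szz : size z = (size z1).+1 by rewrite -(size_rot i) def_z.
have uz1 : uniq z1 by move: uz; rewrite -(rot_uniq i) def_z => /andP[].
have szO : size (filter (predC (mem S)) z1) + count (mem S) z1 = size z1.
  by rewrite size_filter addnC count_predC.
have Ogap x os : filter (predC (mem S)) z1 = x :: os -> gaps e0 x os <= count (mem S) z1.
  elim: z1 s0 pz1 z1z {s0z s0S def_z cnt szz uz1 szO} => //= a t IH s0 /andP[_ pt] az.
  have tz : {subset t <= z} by move=> v vt; apply: az; rewrite in_cons vt orbT.
  have az' : a \in z by apply: az; rewrite mem_head.
  have [Sa|NSa] /= := boolP (a \in S).
    by move=> /(IH a pt tz) /leq_trans; apply; exact: leq_addl.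
  case=> <- <-; have := @gaps_filter _ e e0 (mem S) (mem z) t a a eO az' _ NSa pt.
  by rewrite /= eqxx orbT (negbTE NSa); apply=> //; apply/allP.
case def_os: (filter _ _) => [|x os] in szO Ogap; first by move: szO minor cnt szz; rewrite [size [::]]/= add0n; clear; flia.
have osP v : v \in x :: os -> (v \in z) && (v \notin S).
  by rewrite -def_os mem_filter => /andP[/= -> /z1z ->].
pose S' := [set v in z | v \in S].
have cS' : #|S'| = count (mem S) z.
  rewrite -size_filter -(card_uniqP (filter_uniq _ uz)); apply: eq_card => v.
  by rewrite inE mem_filter andbC.
have [||||||v [uv cv szv vz]] := @link_cycle _ e0 (mem S') #|S'| x os #|S'|.
- by apply: linkable_complete => // s a; rewrite inE => /andP[sz sS] /osP/andP[az aS]; exact: eS.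
- by rewrite -def_os filter_uniq.
- apply/allP => v /osP/andP[_ vS]; by rewrite /= inE negb_and vS orbT.
- by move: szO minor cnt szz; rewrite [size (_ :: _)]/=; clear; flia.
- by have := Ogap x os erefl; move: szO minor szz; rewrite [size (_ :: _)]/= cS' cnt; clear; flia.
- by [].
exists v; split=> //; first by move: szO cnt szz; rewrite szv [size (_ :: _)]/= cS'; clear; flia.
by move=> w /vz /orP[/osP/andP[] //|]; rewrite /= inE => /andP[].
Qed.

Lemma dirac_set (T : finType) (e : rel T) (A : {set T}) n :
    symmetric e -> irreflexive e -> n.*2.+1 <= #|A| ->
    (forall x, x \in A -> #|[set y in A | ~~ e x y]| <= n) ->
  exists z, [/\ uniq z, size z = n.*2.+1, {subset z <= A} & cycle e z].
Proof.
move=> e_sym e_irr /sub_seq_card[s [us szs sA]] deg.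
have [x xs|z pzs cz] := dirac e_sym e_irr szs.
  apply: leq_trans (deg x (sA x xs)); apply: count_le_card => // y ys exy.
  by rewrite inE sA.
exists z; split=> //; first by rewrite (perm_uniq pzs).
  by rewrite (perm_size pzs).
by move=> x; rewrite (perm_mem pzs) => /sA.
Qed.

Lemma pad_seq (T : finType) (A : {set T}) s m :
    uniq s -> {subset s <= A} -> size s <= m <= #|A| ->
  exists t, [/\ uniq (s ++ t), {subset s ++ t <= A} & size t = m - size s].
Proof.
move=> us sA /andP[sm mA].
have [|t [ut szt tA]] := @sub_seq_card T (A :\: [set x in s]) (m - size s).
  have -> : #|A :\: [set x in s]| = #|A| - size s.
    rewrite cardsD (_ : A :&: _ = [set x in s]); last first.
      by apply/setP => x; rewrite !inE andb_idl // => /sA.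
    by rewrite cardsE (card_uniqP us).
  by rewrite leq_sub2r.
exists t; split=> //.
  by rewrite cat_uniq us ut andbT; apply/hasPn => x /tA; rewrite !inE => /andP[].
by move=> x; rewrite mem_cat => /orP[/sA //|/tA]; rewrite inE => /andP[].
Qed.

(** * Inserting one or two outside vertices into a cycle *)

Section Surgery.

Variables (T : eqType) (e : rel T).
Hypothesis e_sym : symmetric e.

Lemma next_split (s1 : seq T) w y s2 : uniq (s1 ++ w :: y :: s2) ->
  next (s1 ++ w :: y :: s2) w = y.
Proof. by move=> us; rewrite -(next_rot (size s1)) // rot_size_cat /= eqxx. Qed.

Lemma cycle_open (z : seq T) v : uniq z -> cycle e z -> v \in z -> 1 < size z ->
  exists s, [/\ perm_eq (next z v :: rcons s v) z, path e (next z v) (rcons s v)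
    & next (next z v :: rcons s v) =1 next z].
Proof.
move=> uz cz vz sz; have [i s def_z] := rot_to vz.
case: s => [|w s] in def_z *.
  by move: sz; rewrite -(size_rot i) def_z.
have nv : next z v = w by rewrite -(next_rot i) // def_z /= eqxx.
have rotw : rot 1 (rot i z) = w :: rcons s v by rewrite def_z rot1_cons.
exists s; rewrite nv -rotw; split.
- by rewrite perm_rot perm_rot.
- by move: cz; rewrite -(rot_cycle i) def_z /= => /andP[].
- by move=> x; rewrite !next_rot ?rot_uniq.
Qed.

Lemma cycle_insert (z : seq T) v u : uniq z -> cycle e z -> v \in z ->
    u \notin z -> 1 < size z -> e u v -> e u (next z v) ->
  exists z', [/\ uniq z', cycle e z', size z' = (size z).+1 & z' =i u :: z].
Proof.
move=> uz cz vz uz' sz euv euw; have [s [pz path_z _]] := cycle_open uz cz vz sz.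
exists (u :: next z v :: rcons s v); split.
- by rewrite cons_uniq (perm_mem pz) (perm_uniq pz) uz'.
- by rewrite /= euw rcons_path path_z last_rcons e_sym.
- by rewrite /= -(perm_size pz).
- by move=> x; rewrite in_cons (perm_mem pz) in_cons.
Qed.

Lemma cycle_insert_edge (z : seq T) v u u' : uniq z -> cycle e z -> v \in z ->
    u \notin z -> u' \notin z -> u != u' -> 1 < size z ->
    e u v -> e u u' -> e u' (next z v) ->
  exists z', [/\ uniq z', cycle e z', size z' = (size z).+2 & z' =i [:: u, u' & z]].
Proof.
move=> uz cz vz uz' u'z uu' sz euv euu' euw.
have [s [pz path_z _]] := cycle_open uz cz vz sz.
exists [:: u, u', next z v & rcons s v]; split.
- rewrite 2!cons_uniq in_cons negb_or uu' !(perm_mem pz) (perm_uniq pz).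
  by rewrite uz' u'z.
- by rewrite /= euu' euw rcons_path path_z last_rcons e_sym.
- by rewrite /= -(perm_size pz).
- by move=> x; rewrite !in_cons -in_cons (perm_mem pz).
Qed.

(** With the cycle written as v+ ... w w+ ... v, the new one is u', v+ ... w, u, followed by the
    reversed segment v ... w+ and back to u'; the edges after [v] and [w] are dropped. *)
Lemma cycle_insert2 (z : seq T) v w u u' : uniq z -> cycle e z ->
    v \in z -> w \in z -> v != w -> u \notin z -> u' \notin z -> u != u' ->
    e u v -> e u w -> e u' (next z v) -> e u' (next z w) ->
  exists z', [/\ uniq z', cycle e z', size z' = (size z).+2 & z' =i [:: u, u' & z]].
Proof.
move=> uz cz vz wz vw uz' u'z uu' euv euw eu'v eu'w.
have sz : 1 < size z.
  by case: z vz wz vw {uz cz uz' u'z eu'v eu'w} => [|? []] //= /[!inE] /eqP-> /eqP->; rewrite eqxx.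
have [s [pz path_z nz]] := cycle_open uz cz vz sz.
set h := next z v in pz path_z nz eu'v.
have: w \in h :: rcons s v by rewrite (perm_mem pz).
have uL : uniq (h :: rcons s v) by rewrite (perm_uniq pz).
case/splitPr def_L : {1 2}_ / => [s1 s2].
case: s2 def_L => [|y s2] def_L.
  move: vw; have := congr1 (last v) def_L.
  by rewrite last_cat /= last_rcons => ->; rewrite eqxx.
have nw : next z w = y by rewrite -nz def_L next_split // -def_L.
have lastv : last y s2 = v.
  by have := congr1 (last v) def_L; rewrite last_cat /= last_rcons.
have hd1 s3 : path e u' (rcons s1 w ++ s3) = path e w s3.
  rewrite cat_path last_rcons; have -> // : path e u' (rcons s1 w).
  move: path_z def_L; case: (s1) => [|a s1'] path_z [].
    by move=> hw _ /=; rewrite -hw eu'v.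
  move=> <- def_s; move: path_z; rewrite def_s /= eu'v /= rcons_path cat_path /=.
  by case/and3P=> -> ->.
have py : path e y s2.
  move: path_z def_L; case: (s1) => [|a s1'] path_z [].
    by move=> _ def_s; move: path_z; rewrite def_s /= => /andP[].
  by move=> _ def_s; move: path_z; rewrite def_s cat_path /= => /and4P[].
exists (u' :: rcons s1 w ++ u :: rev (y :: s2)).
have perm_new : perm_eq (u' :: rcons s1 w ++ u :: rev (y :: s2)) [:: u, u' & z].
  have : perm_eq (rcons s1 w ++ rev (y :: s2)) z.
    by rewrite -(permPr pz) def_L cat_rcons perm_cat2l perm_cons perm_rev.
  rewrite -(perm_cons u') -(perm_cons u) => /(perm_trans _); apply.
  rewrite -(cat1s u (u' :: _)) -(cat1s u (rev _)) -!cat_cons.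
  by apply/permEl; exact: (perm_catCA (u' :: rcons s1 w) [:: u] (rev (y :: s2))).
split.
- by rewrite (perm_uniq perm_new) !cons_uniq in_cons negb_or uu' uz' u'z.
- rewrite [cycle _ _]/= rcons_cat hd1 rev_lastI lastv rcons_cons /=.
  rewrite e_sym euw euv rcons_path -{1}lastv rev_path.
  rewrite (eq_path (e' := e)) ?py; last by move=> a b; rewrite /= e_sym.
  by rewrite -lastv last_rev_belast e_sym -nw eu'w.
- by rewrite (perm_size perm_new).
- exact: perm_mem perm_new.
Qed.

End Surgery.

Section Cliques.

Variables (T : eqType) (e : rel T).

Lemma clique_path x s : uniq (x :: s) ->
  {in x :: s &, forall y z, y != z -> e y z} -> path e x s.
Proof.
elim: s x => //= y s IH x /andP[xs us] cl.
have xy : x != y by apply: contraNneq xs => ->; rewrite mem_head.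
rewrite cl ?inE ?eqxx ?orbT //=; apply: IH => // a b ay bs.
by apply: cl; rewrite in_cons ?ay ?bs orbT.
Qed.

Lemma clique_cycle s : uniq s -> 1 < size s ->
  {in s &, forall y z, y != z -> e y z} -> cycle e s.
Proof.
case: s => // x s us sz cl /=; rewrite rcons_path clique_path //=.
case/lastP: s us sz cl => // s y us _ cl; rewrite last_rcons cl //.
- by rewrite in_cons mem_rcons mem_head orbT.
- exact: mem_head.
- by apply: contraTneq us => ->; rewrite /= mem_rcons mem_head.
Qed.

End Cliques.

Lemma nth_rot (T : Type) (x0 : T) s i j : i < size s -> j < size s ->
  nth x0 (rot i s) j = nth x0 s ((i + j) %% size s).
Proof.
move=> ltis ltjs; rewrite /rot nth_cat size_drop nth_drop.
case: ltnP => h; first by rewrite modn_small //; lia.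
rewrite nth_take; last by lia.
congr nth; have -> : i + j = (j - (size s - i)) + size s by lia.
by rewrite modnDr modn_small //; lia.
Qed.

Lemma cycle_nth (T : Type) (x0 : T) (e : rel T) s i : cycle e s -> i < size s ->
  e (nth x0 s i) (nth x0 s (i.+1 %% size s)).
Proof.
move=> cs ltis; have : cycle e (rot i s) by rewrite rot_cycle.
have s0 : 0 < size s by apply: leq_ltn_trans ltis.
have e0 : nth x0 (rot i s) 0 = nth x0 s i by rewrite nth_rot // addn0 modn_small.
have [s1|s1] := leqP (size s) 1.
  have sz1 : size s = 1 by apply/eqP; rewrite eqn_leq s1.
  have i0 : i = 0 by move: ltis; rewrite sz1; case: i {cs e0}.
  by rewrite sz1 modn1 i0 rot0; case: s sz1 {cs ltis s0 e0 s1} => [|x []] //= _ /andP[].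
have e1 : nth x0 (rot i s) 1 = nth x0 s (i.+1 %% size s) by rewrite nth_rot // addn1.
rewrite -e0 -e1; have := size_rot i s.
by case: (rot i s) => [|y0 [|y1 t]] /= sz; [move: s0; rewrite -sz | move: s1; rewrite -sz | case/andP].
Qed.

(** * Growing monochromatic cycles *)

(** The fibres of [f] are the parts of a blow-up; vertices of one part are adjacent in neither of
    the two colors. *)
Definition bicolor (V : finType) (T : eqType) (f : V -> T) (g : rel V) (b : bool) : rel V :=
  fun x y => (f x != f y) && (g x y == b).

Lemma bicolor_sym (V : finType) (T : eqType) (f : V -> T) (g : rel V) b :
  symmetric g -> symmetric (bicolor f g b).
Proof. by move=> gs x y; rewrite /bicolor eq_sym gs. Qed.

Lemma bicolor_irr (V : finType) (T : eqType) (f : V -> T) (g : rel V) b :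
  irreflexive (bicolor f g b).
Proof. by move=> x; rewrite /bicolor eqxx. Qed.

Lemma card_fiber_seq (V : finType) (T : eqType) (f : V -> T) (A : {set V}) t (s : seq T) :
    (forall i, i \in s -> #|[set x in A | f x == i]| <= t) ->
  #|[set x in A | f x \in s]| <= t * size s.
Proof.
elim: s => [|i s IH] h.
  by rewrite (_ : [set x in A | _] = set0) ?cards0 //; apply/setP => x; rewrite !inE andbF.
have -> : [set x in A | f x \in i :: s] = [set x in A | f x == i] :|: [set x in A | f x \in s].
  by apply/setP => x; rewrite !inE andb_orr.
rewrite (leq_trans (leq_card_setU _ _)) // mulnS leq_add ?h ?mem_head // IH //.
by move=> j js; rewrite h // in_cons js orbT.
Qed.

Ltac uniq_tac :=
  rewrite /= ?inE ?negb_or; repeat (apply/andP; split); try done; by rewrite eq_sym.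

Ltac sub_tac := apply/allP; rewrite /=; repeat (apply/andP; split); done.

Section Core.

Variables (V : finType) (T : eqType) (f : V -> T) (g : rel V) (n t : nat).
Variables (A R : {set V}).
Local Notation E := (bicolor f g).

Hypothesis g_sym : symmetric g.
Hypothesis g_mod : forall x y z, x \in A -> y \in A -> z \in A ->
  f x = f y -> f x != f z -> g x z = g y z.
Hypothesis part_le : forall x, x \in A -> #|[set y in A | f y == f x]| <= t.
Hypothesis sRA : {subset R <= A}.
Hypothesis f_inj : {in R &, injective f}.
Hypothesis R_cover : forall x, x \in A -> exists2 r, r \in R & f r = f x.
Hypothesis n45 : n = 4 \/ n = 5.
Hypothesis sizes : [/\ t = 1, R = A & 4 * n < #|A|] \/
  [/\ t = 2, 7 * n + 2 <= #|A| & #|R| <= 4 * n].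
Hypothesis no_cycle : forall b z, uniq z -> size z = n.*2.+1 -> {subset z <= A} ->
  ~~ cycle (E b) z.

Let E_sym b : symmetric (E b) := bicolor_sym f b g_sym.
Let E_irr b : irreflexive (E b) := bicolor_irr f g b.

Lemma R_colored x y b : x \in R -> y \in R -> x != y -> ~~ E b x y -> E (~~ b) x y.
Proof.
move=> xR yR xy; rewrite /bicolor (inj_in_eq f_inj) // xy /=.
by case: (g x y); case: b.
Qed.

Lemma A_le_fibers : #|A| <= t * #|R|.
Proof.
have -> : A = [set x in A | f x \in map f (enum R)].
  apply/setP => x; rewrite inE; case xA: (x \in A) => //=.
  have [r rR <-] := R_cover xA; apply/esym; by rewrite map_f // mem_enum.
have := @card_fiber_seq _ _ f A t (map f (enum R)).
rewrite size_map -cardE; apply => i /mapP[r]; rewrite mem_enum => /sRA rA ->.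
exact: part_le.
Qed.

Lemma R_ge15 : 15 <= #|R|.
Proof.
have := A_le_fibers; case: sizes => [[-> _]|[-> ]]; case: n45 => -> *; flia.
Qed.

Definition near_cycle l := exists b z,
  [/\ uniq z, {subset z <= R}, cycle (E b) z & size z = l \/ size z = l.+1].

(** The argument behind R(3,3) = 6: among three neighbours of [x] in one color, either an edge of
    that color closes a triangle or the three form one in the other color. *)
Lemma near_cycle3 : near_cycle 3.
Proof.
have := R_ge15; case: (set_0Vmem R) => [->|[x xR] R15]; first by rewrite cards0.
have [b bP] : exists b, 3 <= #|[set y in R | E b x y]|.
  have : #|R :\ x| <= #|[set y in R | E true x y]| + #|[set y in R | E false x y]|.
    apply: leq_trans (leq_card_setU _ _); apply: subset_leq_card.
    apply/subsetP => y; rewrite !inE => /andP[yx yR]; rewrite yR /=.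
    case: (boolP (E true x y)) => //= /R_colored; rewrite eq_sym; exact.
  have := cardsD1 x R; rewrite xR => cR le.
  case: (leqP 3 #|[set y in R | E true x y]|) => h; [exists true | exists false]; flia.
have [s [us szs sS]] := sub_seq_card bP.
have sP y : y \in s -> y \in R /\ E b x y by move/sS; rewrite inE => /andP[].
have xs : x \notin s by apply/negP => /sP[_]; rewrite E_irr.
have key c z : uniq z -> {subset z <= x :: s} -> size z = 3 -> cycle (E c) z -> near_cycle 3.
  move=> uz zs sz cz; exists c, z; split; [by []| |by []|by left].
  by move=> y /zs; rewrite in_cons => /predU1P[->|/sP[]].
case: s us szs sP xs key {sS} => [|y1 [|y2 [|y3 [|]]]] //= us _ sP xs key.
have h1 : y1 \in [:: y1; y2; y3] by rewrite !inE eqxx.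
have h2 : y2 \in [:: y1; y2; y3] by rewrite !inE eqxx orbT.
have h3 : y3 \in [:: y1; y2; y3] by rewrite !inE eqxx !orbT.
have tri y z : y \in [:: y1; y2; y3] -> z \in [:: y1; y2; y3] -> y != z ->
    near_cycle 3 \/ E (~~ b) y z.
  move=> ys zs yz; have [[yR xy] [zR xz]] := (sP y ys, sP z zs).
  have [eyz|/R_colored eyz] := boolP (E b y z); last by right; apply: eyz.
  left; apply: (key b [:: x; y; z]); rewrite //= ?xy ?eyz ?(E_sym _ z) ?xz //.
    rewrite !inE yz !andbT; apply/norP; split.
      by apply: contraNneq xs => ->.
    by apply: contraNneq xs => ->.
  by move=> w; rewrite !inE => /or3P[/eqP->|/eqP->|/eqP->]; rewrite ?eqxx ?orbT //;
    [move: ys|move: zs]; rewrite !inE => ->; rewrite orbT.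
move: (us); rewrite /= !inE negb_or !andbT => /andP[/andP[y12 y13] y23].
have [//|e12] := tri _ _ h1 h2 y12; have [//|e23] := tri _ _ h2 h3 y23.
have [//|e13] := tri _ _ h1 h3 y13.
apply: (key (~~ b) [:: y1; y2; y3]) => //=; last by rewrite e12 e23 E_sym e13.
by move=> w ws; rewrite in_cons ws orbT.
Qed.

(* Below, the color b of the cycle Z is called red and the other color blue. *)
Section Growth.

Variables (l : nat) (b : bool) (Z : seq V).
Hypothesis l_bounds : 3 <= l <= n.*2.
Hypothesis uZ : uniq Z.
Hypothesis sZR : {subset Z <= R}.
Hypothesis cZ : cycle (E b) Z.
Hypothesis szZ : size Z = l.
Hypothesis no_near : ~ near_cycle l.+1.

Let U := R :\: [set x in Z].

Lemma UP u : u \in U -> u \in R /\ u \notin Z.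
Proof. by rewrite !inE => /andP[]. Qed.

Lemma no_near' c z : uniq z -> {subset z <= R} -> cycle (E c) z ->
  size z = l.+1 \/ size z = l.+2 -> False.
Proof. by move=> uz zR cz sz; apply: no_near; exists c, z; split. Qed.

Let N u := [set v in Z | E b u v].
Let sh := next Z.

Let sh_inj : injective sh.
Proof. by apply: can_inj (prev_next uZ). Qed.

Let shZ v : (sh v \in Z) = (v \in Z).
Proof. exact: mem_next. Qed.

Lemma N_indep u v : u \in U -> v \in N u -> sh v \notin N u.
Proof.
move=> /UP[uR uNZ]; rewrite !inE => /andP[vZ euv]; apply/negP => /andP[_ euw].
have [|z [uz cz sz memz]] := cycle_insert (E_sym b) uZ cZ vZ uNZ _ euv euw.
  by rewrite szZ; case/andP: l_bounds => /ltnW.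
apply: (no_near' uz _ cz); last by left; rewrite sz szZ.
by move=> x; rewrite memz in_cons => /predU1P[-> //|/sZR].
Qed.

Lemma N_edge u w v : u \in U -> w \in U -> E b u w -> v \in N u -> sh v \notin N w.
Proof.
move=> /UP[uR uNZ] /UP[wR wNZ] euw; rewrite !inE => /andP[vZ euv].
apply/negP => /andP[_ ewv].
have uw : u != w by apply: contraTneq euw => ->; rewrite E_irr.
have [|z [uz cz sz memz]] := cycle_insert_edge (E_sym b) uZ cZ vZ uNZ wNZ uw _ euv euw ewv.
  by rewrite szZ; case/andP: l_bounds => /ltnW.
apply: (no_near' uz _ cz); last by right; rewrite sz szZ.
by move=> x; rewrite memz !in_cons => /or3P[/eqP->|/eqP->|/sZR].
Qed.

(** Two elements of the intersection are exactly the data of [cycle_insert2], which would produce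
    length l + 2. *)
Lemma N_cross u w : u \in U -> w \in U -> u != w -> #|(sh @: N u) :&: N w| <= 1.
Proof.
move=> /UP[uR uNZ] /UP[wR wNZ] uw; rewrite leqNgt; apply/negP => /card_gt1P[y1 [y2 [h1 h2 y12]]].
move: h1; rewrite inE => /andP[/imsetP[v1]].
rewrite !inE => /andP[v1Z e1] def1 /andP[_ e1'].
move: h2; rewrite inE => /andP[/imsetP[v2]].
rewrite !inE => /andP[v2Z e2] def2 /andP[_ e2'].
have v12 : v1 != v2 by apply: contraNneq y12 => v12; rewrite def1 def2 v12.
rewrite def1 in e1'; rewrite def2 in e2'.
have [z [uz cz sz memz]] := cycle_insert2 (E_sym b) uZ cZ v1Z v2Z v12 uNZ wNZ uw e1 e2 e1' e2'.
apply: (no_near' uz _ cz); last by right; rewrite sz szZ.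
by move=> x; rewrite memz !in_cons => /or3P[/eqP->|/eqP->|/sZR].
Qed.

Let cZset : #|[set x in Z]| = l.
Proof. by rewrite cardsE (card_uniqP uZ). Qed.

(** The set [M] and its shift both lie on [Z] and overlap in at most [k] vertices, so 2|M| <= l + k.
    The vertices of [Z] outside [M] are common blue neighbours, hence at least (l - k)/2 in
    number. *)
Lemma link_of_pair u w k (G : seq V) : u \in U -> w \in U ->
    #|(N u :|: N w) :&: (sh @: (N u :|: N w))| <= k ->
    2 * size G + k < l ->
  exists v, [/\ v \in Z, v \notin G, E (~~ b) u v & E (~~ b) v w].
Proof.
set M := N u :|: N w => uU wU small szG.
have MZ : M \subset [set x in Z].
  by apply/subsetP => v; rewrite !inE -andb_orr => /andP[].
have shMZ : sh @: M \subset [set x in Z].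
  by apply/subsetP => v /imsetP[v' /(subsetP MZ)]; rewrite !inE => v'Z ->; rewrite shZ.
have MU : #|M :|: sh @: M| <= l.
  by rewrite -cZset; apply: subset_leq_card; rewrite subUset MZ shMZ.
have := cardsUI M (sh @: M); rewrite card_imset // => cM.
have : ~~ ([set x in Z] :\: M \subset G).
  apply/negP => /subset_leq_card; have := cardsD [set x in Z] M.
  rewrite cZset (setIidPr MZ) => -> le; have := leq_trans le (card_size G).
  flia.
case/subsetPn => v; rewrite in_setD /M !inE => /andP[nM vZ] vG; exists v.
move: nM; rewrite vZ /= negb_or => /andP[nu nw].
have [[uR uZ'] [wR wZ']] := (UP uU, UP wU).
have blue x : x \in R -> x \notin Z -> ~~ E b x v -> E (~~ b) x v.
  by move=> xR xZ; apply: R_colored; rewrite // ?sZR //; apply: contraNneq xZ => ->.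
by split; rewrite ?blue // E_sym blue.
Qed.

Let lam := l.-1./2.

(** By [N_indep] only the two mixed intersections contribute to the overlap, each at most one
    vertex, which gives k = 2. *)
Lemma U_linkable : linkable (E (~~ b)) (mem Z) lam (mem U).
Proof.
move=> u w G uU wU uw szG; apply: (@link_of_pair u w 2) => //.
  apply: leq_trans (_ : #|(sh @: N u) :&: N w :|: (sh @: N w) :&: N u| <= 2).
    apply: subset_leq_card; apply/subsetP => y /setIP[yM /imsetP[v vM def_y]].
    have Nin x : x \in U -> v \in N x -> y \in N x -> False.
      by move=> xU vx; rewrite def_y => yx; have := N_indep xU vx; rewrite yx.
    case/setUP: vM => vN; case/setUP: yM => yN; try by [case: (Nin _ uU vN yN) | case: (Nin _ wU vN yN)].
      by rewrite !(in_setU, in_setI) yN def_y (imset_f sh vN).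
    by rewrite !(in_setU, in_setI) yN def_y (imset_f sh vN) !orbT.
  rewrite (leq_trans (leq_card_setU _ _)) // -[2]/(1 + 1) leq_add //; apply: N_cross => //.
  by rewrite eq_sym.
by move: szG; rewrite /lam; flia.
Qed.

Lemma no_forest x os q : uniq (x :: os) -> {subset x :: os <= U} ->
    0 < size os -> gaps (E (~~ b)) x os < q <= (size os).+1 -> q <= lam ->
  (size os).+1 + q = l.+1 -> False.
Proof.
move=> uos osU os0 gq q_lam szq.
have lnk : linkable (E (~~ b)) (mem Z) lam (mem (x :: os)).
  by apply: linkable_sub U_linkable => y /osU.
have [|z [uz cz sz zP]] := link_cycle lnk uos _ os0 gq q_lam.
  by apply/allP => y /osU /UP[].
apply: (no_near' uz _ cz); last by left; rewrite sz.
by move=> y /zP/orP[/osU/UP[]|/sZR].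
Qed.

Let card_U : #|U| = #|R| - l.
Proof.
rewrite cardsD (setIidPr _) ?cZset //.
by apply/subsetP => x; rewrite inE => /sZR.
Qed.

Let U_large : l./2 + 2 <= #|U|.
Proof.
have := A_le_fibers; rewrite card_U.
by case: sizes => [[-> _]|[-> + _]]; case: n45 l_bounds => -> /andP[]; flia.
Qed.

(** In either parity, [l./2 + 2] vertices of [U] and [lam] links add up to l + 1. One link closes
    the cycle, so fewer than [lam] of the [l./2 + 1] steps may be gaps: two blue edges suffice for
    odd [l], three for even [l]. *)
Lemma no_seed x s : uniq (x :: s) -> {subset x :: s <= U} ->
    0 < size s <= l./2 + 1 -> gaps (E (~~ b)) x s + (l./2 + 1 - size s) < lam -> False.
Proof.
move=> us sU szs gap.
have [|p [up pU szp]] := @pad_seq _ U (x :: s) (l./2 + 2) us sU.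
  by rewrite U_large andbT /=; flia.
apply: (@no_forest x (s ++ p) lam) => //.
- by rewrite size_cat; flia.
- rewrite gaps_cat size_cat; have := gaps_size (E (~~ b)) (last x s) p.
  by move: gap szp; rewrite /lam [size (_ :: _)]/=; flia.
- by move: szp; rewrite size_cat /lam [size (_ :: _)]/=; flia.
Qed.

Definition fewBlue (cs : seq V) := forall u, u \in U -> u \notin cs ->
  #|[set v in U | (v \notin cs) && E (~~ b) u v]| <= 1.

(** Once the parts over [Z] and [cs] are removed, a vertex misses in red only its own part and at
    most one blue part. That is at most 2t <= 4 <= n vertices, so Dirac's condition yields a
    forbidden red cycle. *)
Lemma red_dirac cs : {subset cs <= R} -> fewBlue cs ->
  n.*2.+1 + t * (l + size cs) <= #|A| -> False.
Proof.
move=> csR few large.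
have rep x : x \in A -> exists2 r, r \in R & f r = f x := @R_cover x.
pose W := [set x in A | f x \notin map f (Z ++ cs)].
have WU x r : x \in W -> r \in R -> f r = f x -> r \in U /\ r \notin cs.
  rewrite !inE map_cat mem_cat negb_or => /and3P[_ xZ xcs] rR fr; rewrite rR andbT.
  by split; [apply: contra xZ|apply: contra xcs]; rewrite -fr => /(map_f f).
have cW : n.*2.+1 <= #|W|.
  have := cardsID [set x in A | f x \in map f (Z ++ cs)] A.
  have -> : A :\: [set x in A | f x \in map f (Z ++ cs)] = W.
    by apply/setP => x; rewrite !inE; case: (x \in A); rewrite ?andbF ?andbT.
  have : #|A :&: [set x in A | f x \in map f (Z ++ cs)]| <= t * (l + size cs).
    rewrite (setIidPr _); last by apply/subsetP => x; rewrite inE => /andP[].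
    have := @card_fiber_seq _ _ f A t (map f (Z ++ cs)).
    rewrite size_map size_cat szZ; apply => i /mapP[r]; rewrite mem_cat => rZ ->.
    by apply: part_le; apply: sRA; case/orP: rZ => [/sZR|/csR].
  by flia.
have [x xW|z [uz sz zW cz]] := dirac_set (E_sym b) (E_irr b) cW.
  have xA : x \in A by move: xW; rewrite inE => /andP[].
  have [r rR fr] := rep x xA; have [rU rcs] := WU x r xW rR fr.
  pose B := [set v in U | (v \notin cs) && E (~~ b) r v].
  have sub : [set y in W | ~~ E b x y] \subset
      [set y in A | f y == f x] :|: [set y in A | f y \in map f (enum B)].
    apply/subsetP => y; rewrite [y \in _]inE => /andP[yW nxy].
    have yA : y \in A by move: yW; rewrite inE => /andP[].
    rewrite in_setU !inE yA /=; have [//|fyx /=] := eqVneq (f y) (f x).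
    have [r' r'R fr'] := rep y yA; have [r'U r'cs] := WU y r' yW r'R fr'.
    rewrite -fr'; apply: map_f; rewrite mem_enum inE r'U r'cs /=.
    have rr' : r != r' by apply: contraNneq fyx => rr'; rewrite -fr -fr' rr'.
    apply: R_colored => //; apply: contra nxy; rewrite /bicolor fr fr' => /andP[-> /=].
    move=> /eqP <-; apply/eqP.
    have [rA r'A] := (sRA rR, sRA r'R).
    have -> : g r r' = g x r' by apply: g_mod; rewrite ?fr // fr' eq_sym.
    by rewrite ![g x _]g_sym; apply: g_mod; rewrite // fr'.
  have cB := few r rU rcs; rewrite -/B in cB.
  apply: leq_trans (subset_leq_card sub) _; apply: leq_trans (leq_card_setU _ _) _.
  have h1 := part_le xA.
  have h2 : #|[set y in A | f y \in map f (enum B)]| <= t * #|B|.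
    have := @card_fiber_seq _ _ f A t (map f (enum B)).
    rewrite size_map -cardE; apply => i /mapP[v]; rewrite mem_enum inE => /andP[/UP[vR _] _ ->].
    by apply: part_le; apply: sRA.
  apply: leq_trans (leq_add h1 h2) _.
  have t2 : t <= 2 by case: sizes => [[->]|[->]].
  have n4 : 4 <= n by case: n45 => ->.
  by apply: leq_trans n4; apply: (@leq_trans (2 + 2 * 1)) => //; rewrite leq_add ?leq_mul.
have zA : {subset z <= A} by move=> y /zW; rewrite inE => /andP[].
by have := no_cycle b uz sz zA; rewrite cz.
Qed.

(** A blue path with two edges in [U] would be a seed, so the blue edges in [U] form a matching. *)
Lemma growth_odd : odd l -> False.
Proof.
move=> odd_l; apply: (@red_dirac [::]) => //; last first.
  by move: odd_l l_bounds; case: sizes => [[-> _]|[-> + _]]; case: n45 => ->; rewrite [size [::]]/= addn0; clear; lia.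
move=> u uU _; rewrite leqNgt; apply/negP => /card_gt1P[x [y [xD yD xy]]].
move: xD yD; rewrite in_set => /and3P[xU _ ux]; rewrite in_set => /and3P[yU _ uy].
have xu : x != u by apply: contraTneq ux => ->; rewrite E_irr.
have yu : y != u by apply: contraTneq uy => ->; rewrite E_irr.
apply: (@no_seed x [:: u; y]).
- by uniq_tac.
- by sub_tac.
- by move: odd_l l_bounds => /=; clear; lia.
- by rewrite /= E_sym ux uy /= /lam; move: odd_l l_bounds; clear; lia.
Qed.

Let noP4 x y z w : ~~ odd l -> x \in U -> y \in U -> z \in U -> w \in U ->
  uniq [:: x; y; z; w] -> E (~~ b) x y -> E (~~ b) y z -> E (~~ b) z w -> False.
Proof.
move=> even_l xU yU zU wU u4 exy eyz ezw; apply: (no_seed u4).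
- by sub_tac.
- by move: even_l l_bounds => /=; clear; lia.
- by rewrite /= exy eyz ezw /= /lam; move: even_l l_bounds; clear; lia.
Qed.

Let noP3P2 x y z w v : ~~ odd l -> 5 < l -> x \in U -> y \in U -> z \in U -> w \in U ->
  v \in U -> uniq [:: x; y; z; w; v] -> E (~~ b) x y -> E (~~ b) y z -> E (~~ b) w v -> False.
Proof.
move=> even_l l5 xU yU zU wU vU u5 exy eyz ewv; apply: (no_seed u5).
- by sub_tac.
- by move: even_l l5 => /=; clear; lia.
- by rewrite /= exy eyz ewv /= /lam; case: (E _ z w) => /=; move: even_l l5; clear; lia.
Qed.

(** For even [l], no three blue edges in [U] form a path or a two-edge path with a disjoint edge. If
    [u] had blue neighbours [x], [y] besides [c], then the path x u y and the edge c p would be such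
    a forest; any coincidence of vertices gives a three-edge path instead. *)
Lemma center_few c : ~~ odd l -> 5 < l -> c \in U ->
  1 < #|[set v in U | E (~~ b) c v]| -> fewBlue [:: c].
Proof.
move=> even_l l5 cU /card_gt1P[p [q [pD qD pq]]] u uU; rewrite mem_seq1 => uc.
rewrite leqNgt; apply/negP => /card_gt1P[x [y [xD yD xy]]].
move: pD qD; rewrite in_set => /andP[pU cp]; rewrite in_set => /andP[qU cq].
move: xD yD; rewrite in_set mem_seq1 => /and3P[xU xc ux].
rewrite in_set mem_seq1 => /and3P[yU yc uy].
have neq_of v w : E (~~ b) v w -> v != w by move=> evw; apply: contraTneq evw => ->; rewrite E_irr.
have [cNp cNq uNx uNy] := And4 (neq_of _ _ cp) (neq_of _ _ cq) (neq_of _ _ ux) (neq_of _ _ uy).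
have P4 a1 a2 a3 a4 := @noP4 a1 a2 a3 a4 even_l.
have far w : w \in U -> E (~~ b) c w -> w != x /\ w != y.
  move=> wU cw; split; apply/eqP => def_w; rewrite def_w in cw.
    apply: (P4 c x u y) => //; last by rewrite E_sym.
    by have ? := neq_of _ _ cw; uniq_tac.
  apply: (P4 c y u x) => //; last by rewrite E_sym.
  by have ? := neq_of _ _ cw; uniq_tac.
have [[px py] [qx qy]] := (far p pU cp, far q qU cq).
have step w w' : w \in U -> w' \in U -> E (~~ b) c w -> E (~~ b) c w' -> w != w' ->
    w' != x -> w != u.
  move=> wU w'U cw cw' ww' w'x; apply/eqP => wu; rewrite wu in cw ww'.
  apply: (P4 w' c u x) => //; last by rewrite E_sym.
  by have ? := neq_of _ _ cw'; uniq_tac.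
have pu : p != u by apply: (step p q).
apply: (@noP3P2 x u y c p) => //; last by rewrite E_sym.
by uniq_tac.
Qed.

(** A blue edge avoiding [c] either extends through [c] to a three-edge path or is disjoint from a
    two-edge path with centre [c]; three blue neighbours leave enough choice for both. *)
Lemma center_clique c : ~~ odd l -> 5 < l -> c \in U ->
    2 < #|[set v in U | E (~~ b) c v]| ->
  forall u w, u \in U -> w \in U -> u != c -> w != c -> ~~ E (~~ b) u w.
Proof.
move=> even_l l5 cU D3 u w uU wU uc wc; apply/negP => uw.
have neq_of x y : E (~~ b) x y -> x != y by move=> exy; apply: contraTneq exy => ->; rewrite E_irr.
have uNw := neq_of _ _ uw.
have P4 a1 a2 a3 a4 := @noP4 a1 a2 a3 a4 even_l.
have away v v' p : v \in U -> v' \in U -> v != c -> v' != c -> E (~~ b) v v' ->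
    p \in U -> p != v -> p != v' -> E (~~ b) c p -> E (~~ b) c v -> False.
  move=> vU v'U vc v'c vv' pU pv pv' cp cv.
  have [? [? ?]] := (neq_of _ _ cp, (neq_of _ _ cv, neq_of _ _ vv')).
  by apply: (P4 p c v v') => //; [uniq_tac | rewrite E_sym].
have two : 1 < #|[set v in U | E (~~ b) c v] :\ u|.
  by have := cardsD1 u [set v in U | E (~~ b) c v]; case: (_ \in _) D3; clear; lia.
have [p pD] : exists p, p \in ([set v in U | E (~~ b) c v] :\ u) :\ w.
  apply/set0Pn; rewrite -card_gt0.
  by have := cardsD1 w ([set v in U | E (~~ b) c v] :\ u); case: (_ \in _) two; clear; lia.
move: pD; rewrite !in_setD1 in_set => /and4P[pw pu pU cp].
have cNu : ~~ E (~~ b) c u by apply/negP => /(away u w p uU wU uc wc uw pU pu pw cp).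
have cNw : ~~ E (~~ b) c w.
  by apply/negP; rewrite E_sym in uw => /(away w u p wU uU wc uc uw pU pw pu cp).
have [q qD] : exists q, q \in [set v in U | E (~~ b) c v] :\ p.
  by apply/set0Pn; rewrite -card_gt0; have := cardsD1 p [set v in U | E (~~ b) c v]; case: (_ \in _) D3; clear; lia.
move: qD; rewrite in_setD1 in_set => /and3P[qp qU cq].
have qu : q != u by apply: contraTneq cq => ->.
have qw : q != w by apply: contraTneq cq => ->.
have [? ?] := (neq_of _ _ cp, neq_of _ _ cq).
by apply: (@noP3P2 p c q u w) => //; [uniq_tac | rewrite E_sym].
Qed.

Let blue_deg c := #|[set v in U | E (~~ b) c v]|.

Lemma U_dirac : n.*2.+1 <= #|U| -> (forall u, u \in U -> blue_deg u < n) -> False.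
Proof.
move=> largeU deg.
have [u uU|z [uz sz zU cz]] := dirac_set (E_sym b) (E_irr b) largeU.
  apply: leq_trans (deg u uU); rewrite -add1n -(cards1 u).
  apply: leq_trans (leq_card_setU _ _); apply: subset_leq_card.
  apply/subsetP => y; rewrite in_set => /andP[yU nuy].
  rewrite in_setU in_set1 in_set yU /=; have [//|yu /=] := eqVneq y u.
  have [[uR _] [yR _]] := (UP uU, UP yU).
  by apply: R_colored nuy => //; rewrite eq_sym.
have zA : {subset z <= A} by move=> y /zU /UP[/sRA].
by have := no_cycle b uz sz zA; rewrite cz.
Qed.

(* In the extremal case the red clique [U :\ c] has the size of [Z]; red adjacent
   vertices of it have one more common blue neighbour on [Z] than guaranteed in general. *)
Lemma growth_extremal c : l = n.*2 -> ~~ odd l -> 5 < l -> c \in U ->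
  n.*2.+1 <= #|U| -> n <= blue_deg c -> False.
Proof.
move=> ln even_l l5 cU largeU degc.
have n4 : 4 <= n by case: n45 => ->.
have noblue := @center_clique c even_l l5 cU (leq_trans (ltnW n4) degc).
pose K := U :\ c.
have KP u : u \in K -> u \in U /\ u != c by rewrite in_setD1 => /andP[].
have lnk : linkable (E (~~ b)) (mem Z) n (mem K).
  move=> u w G /KP[uU uc] /KP[wU wc] uw szG; apply: (@link_of_pair u w 0) => //; last first.
    by rewrite ln -muln2 mulnC addn0 ltn_pmul2r.
  have red x y : x \in U -> x != c -> y \in U -> y != c -> x != y -> E b x y.
    move=> xU xc yU yc xy; have := noblue x y xU yU xc yc.
    by move/R_colored; rewrite negbK; apply; [case: (UP xU)|case: (UP yU)|].
  rewrite leqn0 cards_eq0; apply/eqP/setP => y; rewrite in_set0 in_setI.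
  apply/negP => /andP[yM /imsetP[v vM def_y]]; rewrite def_y in yM.
  have uwE := red u w uU uc wU wc uw; have wuE := uwE; rewrite E_sym in wuE.
  case/setUP: vM => vN; case/setUP: yM; apply/negP.
  - exact: N_indep vN.
  - exact: N_edge uwE vN.
  - exact: N_edge wuE vN.
  - exact: N_indep vN.
have /card_gt1P[p [q [pD qD pq]]] : 1 < blue_deg c by apply: leq_trans degc; apply: leq_trans n4.
move: pD qD; rewrite in_set => /andP[pU cp]; rewrite in_set => /andP[qU cq].
have inK v : v \in U -> E (~~ b) c v -> v \in K.
  by move=> vU cv; rewrite in_setD1 vU andbT; apply: contraTneq cv => ->; rewrite E_irr.
have [pK qK] := (inK p pU cp, inK q qU cq).
have cK : n.*2 <= #|K| by move: largeU; rewrite (cardsD1 c U) cU.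
have [|||r [ur rK szr]] := @pad_seq _ K [:: q; p] n.+1.
- by rewrite /= inE eq_sym pq.
- by sub_tac.
- by move: cK n4; rewrite /=; clear; lia.
have perm_r : perm_eq (p :: rcons r q) ([:: q; p] ++ r).
  by rewrite -rcons_cons perm_rcons.
have uos : uniq (p :: rcons r q) by rewrite (perm_uniq perm_r).
have osK : {subset p :: rcons r q <= K} by move=> v; rewrite (perm_mem perm_r) => /rK.
have szos : size (rcons r q) = n by rewrite size_rcons szr /=; move: n4; clear; lia.
have lnk' : linkable (E (~~ b)) (mem Z) n (mem (p :: rcons r q)).
  by apply: linkable_sub lnk => v /osK.
have [||z [ls [pz lz perm_z szl [uls Zls _]]]] := @link_path _ _ _ _ (rcons r q) p n [::] lnk' uos.
- by apply/andP; split; [rewrite -szos; apply: gaps_size | rewrite szos].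
- by [].
have perm_all : perm_eq (c :: p :: z) (c :: (p :: rcons r q) ++ ls).
  by rewrite !perm_cons.
have ocP v : v \in c :: p :: rcons r q -> v \in U.
  by rewrite in_cons => /predU1P[->//|/osK/KP[]].
apply: (@no_near' (~~ b) (c :: p :: z)).
- rewrite (perm_uniq perm_all) -cat_cons cat_uniq uls andbT cons_uniq uos andbT.
  apply/andP; split; first by apply/negP => /osK/KP[_]; rewrite eqxx.
  by apply/hasPn => v vls; apply/negP => /ocP/UP[_]; rewrite [v \in Z](allP Zls v vls).
- move=> v; rewrite (perm_mem perm_all) -cat_cons mem_cat => /orP[/ocP/UP[]//|vls].
  exact/sZR/(allP Zls v vls).
- by rewrite /= cp rcons_path pz lz last_rcons E_sym cq.
- right; rewrite (perm_size perm_all) -cat_cons size_cat szl /= szos ln.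
  by clear; lia.
Qed.

Lemma growth_even : ~~ odd l -> 5 < l -> False.
Proof.
move=> even_l l5.
have [n4 t2] : 4 <= n /\ t <= 2 by split; [case: n45 => -> | case: sizes => [[->]|[->]]].
have l2n : l <= n.*2 by case/andP: l_bounds.
have [noc|] := boolP [forall c in U, blue_deg c <= 1].
  apply: (@red_dirac [::]) => //.
    move=> u uU _; apply: leq_trans (forall_inP noc u uU); apply: subset_leq_card.
    by apply/subsetP => v; rewrite !in_set => /and3P[-> _ ->].
  move: l2n n4; rewrite /= addn0; case: sizes => [[-> _]|[-> + _]]; clear; lia.
rewrite negb_forall_in => /exists_inP[c cU]; rewrite -ltnNge => c2.
have few := center_few even_l l5 cU c2.
(* Discarding [Z] and the centre needs 2n + 1 + t(l + 1) vertices. Only for t = 1 and l = 2n can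
   this exceed the size of [A], and then by a single vertex. *)
have [extr|next] := boolP ((t == 1) && (l == n.*2)); last first.
  apply: (@red_dirac [:: c]) => //; first by move=> v; rewrite mem_seq1 => /eqP->; case: (UP cU).
  move: l2n n4 next even_l; rewrite /=; case: sizes => [[-> _]|[-> + _]]; clear; lia.
have [/eqP t1 /eqP ln] := andP extr.
have largeU : n.*2.+1 <= #|U|.
  by rewrite card_U ln; case: sizes t1 => [[_ -> +] _|[->]//]; clear; lia.
have [degc|degc] := leqP n (blue_deg c); first exact: (growth_extremal ln even_l l5 cU).
apply: U_dirac => // u uU; have [->//|uc] := eqVneq u c.
apply: leq_ltn_trans (_ : 2 < n); last exact: ltnW.
have u_few : #|[set v in U | (v \notin [:: c]) && E (~~ b) u v]| <= 1.
  by apply: few; rewrite ?mem_seq1.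
rewrite -[2]/(1 + 1) -{1}(cards1 c) (leq_trans _ (leq_add (leqnn _) u_few)) //.
apply: leq_trans (leq_card_setU _ _); apply: subset_leq_card.
apply/subsetP => y; rewrite in_set => /andP[yU uy]; rewrite in_setU in_set1 in_set yU mem_seq1 uy andbT.
by case: (y == c).
Qed.

(** A blue edge u u' inside [W] and a third vertex w' close the blue pentagon u u' v w' w. So [W] is
    a red clique, and five of its vertices would carry a red pentagon. *)
Lemma class_small (W : {set V}) v w : l = 4 -> W \subset U -> v \in Z -> w \in Z ->
  v != w -> (forall u, u \in W -> E (~~ b) u v /\ E (~~ b) u w) -> #|W| <= 4.
Proof.
move=> l4 /subsetP WU vZ wZ vw Wblue; rewrite leqNgt; apply/negP => W5.
have WR x : x \in W -> x \in R by move/WU/UP=> [].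
have outZ u x : u \in W -> x \in Z -> u != x.
  by move=> /WU/UP[_ uNZ] xZ; apply: contraNneq uNZ => ->.
have red u u' : u \in W -> u' \in W -> u != u' -> E b u u'.
  move=> uW u'W uu'; apply/negPn/negP => blue.
  have {}blue : E (~~ b) u u' by apply: R_colored blue => //; apply: WR.
  have [w' w'P] : exists w', w' \in (W :\ u) :\ u'.
    apply/set0Pn; rewrite -card_gt0; have := cardsD1 u W; have := cardsD1 u' (W :\ u).
    by rewrite !in_setD1 uW u'W eq_sym uu'; move: W5; clear; lia.
  move: w'P; rewrite !in_setD1 => /and3P[w'u' w'u w'W].
  have [[uv uw] [[u'v u'w] [w'v w'w]]] := (Wblue u uW, (Wblue u' u'W, Wblue w' w'W)).
  apply: (@no_near' (~~ b) [:: u; u'; v; w'; w]).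
  - have [? ? ?] := And3 (outZ u v uW vZ) (outZ u' v u'W vZ) (outZ w' v w'W vZ).
    have [? ? ?] := And3 (outZ u w uW wZ) (outZ u' w u'W wZ) (outZ w' w w'W wZ).
    by uniq_tac.
  - by have [? ? ? ? ?] := And5 (WR u uW) (WR u' u'W) (WR w' w'W) (sZR vZ) (sZR wZ); sub_tac.
  - by rewrite /= blue u'v (E_sym _ v) w'v w'w (E_sym _ w) uw.
  - by left; rewrite l4.
have [s [us szs sW]] := sub_seq_card W5.
apply: (@no_near' b s) => //.
- by move=> x /sW/WR.
- by apply: clique_cycle; rewrite ?szs // => x y /sW xW /sW; apply: red.
- by left; rewrite szs l4.
Qed.

(** Seeds of five vertices do not fit here. Independence on a 4-cycle confines [N u] to one opposite
    pair, so [u] is blue to the other pair; two classes of at most four vertices leave only 12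
    vertices in [R]. *)
Lemma growth4 : l = 4 -> False.
Proof.
move=> l4; have R15 := R_ge15.
have [v0 [v1 [v2 [v3 defZ]]]] : exists v0 v1 v2 v3, Z = [:: v0; v1; v2; v3].
  by case: Z szZ => [|v0 [|v1 [|v2 [|v3 []]]]]; rewrite l4 // => _; exists v0, v1, v2, v3.
have nxt : [/\ sh v0 = v1, sh v1 = v2, sh v2 = v3 & sh v3 = v0].
  have rotE i x : sh x = next (rot i Z) x by rewrite /sh next_rot.
  by split; [rewrite (rotE 0)|rewrite (rotE 1)|rewrite (rotE 2)|rewrite (rotE 3)];
     rewrite defZ /= eqxx.
have memZ : [/\ v0 \in Z, v1 \in Z, v2 \in Z & v3 \in Z].
  by split; rewrite defZ !inE eqxx ?orbT.
case: nxt memZ => n0 n1 n2 n3 [m0 m1 m2 m3].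
have [v02 v13] : v0 != v2 /\ v1 != v3.
  by move: uZ; rewrite defZ /= !inE !negb_or => /andP[/and3P[_ -> _] /andP[/andP[_ ->] _]].
pose B v w := [set u in U | E (~~ b) u v && E (~~ b) u w].
have cB v w : v \in Z -> w \in Z -> v != w -> #|B v w| <= 4.
  move=> vZ wZ vw; apply: (class_small l4 _ vZ wZ vw).
    by apply/subsetP => u; rewrite in_set => /andP[].
  by move=> u; rewrite in_set => /and3P[].
have UB : U \subset B v0 v2 :|: B v1 v3.
  apply/subsetP => u uU; rewrite in_setU ![u \in B _ _]in_set uU /=.
  have blue v : v \in Z -> v \notin N u -> E (~~ b) u v.
    move=> vZ; rewrite in_set vZ /=; have [uR uNZ] := UP uU; apply: R_colored => //.
      exact: sZR.
    by apply: contraNneq uNZ => ->.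
  have ind := N_indep uU.
  have [h0|h0] := boolP (v0 \in N u).
    have h1 := ind _ h0; rewrite n0 in h1.
    have h3 : v3 \notin N u by apply: contraL h0 => /ind; rewrite n3.
    by rewrite (blue v1) // (blue v3) // orbT.
  have [h2|h2] := boolP (v2 \in N u); last by rewrite (blue v0) // (blue v2).
  have h3 := ind _ h2; rewrite n2 in h3.
  have h1 : v1 \notin N u by apply: contraL h2 => /ind; rewrite n1.
  by rewrite (blue v1) // (blue v3) // orbT.
have := leq_trans (subset_leq_card UB) (leq_card_setU _ _).
by have := cB _ _ m0 m2 v02; have := cB _ _ m1 m3 v13; move: R15; rewrite card_U l4; clear; lia.
Qed.

End Growth.

(** The double negation avoids deciding [near_cycle]; it is harmless because the result is only used
    to reach a contradiction. *)
Lemma growth l : 3 <= l <= n.*2 -> near_cycle l -> ~ ~ near_cycle l.+1.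
Proof.
move=> lb [b [Z [uZ sZR cZ szZ]]] no_near.
case: szZ => szZ; last by apply: no_near; exists b, Z; split; last left.
have [odd_l|even_l] := boolP (odd l); first exact: (growth_odd lb uZ sZR cZ szZ no_near).
have [l4|l4] := eqVneq l 4; first exact: (growth4 lb uZ sZR cZ szZ no_near).
apply: (growth_even lb uZ sZR cZ szZ no_near even_l).
by case: l lb even_l l4 {szZ no_near} => [|[|[|[|[|[]]]]]].
Qed.

Lemma near_cycle_max : ~ ~ near_cycle n.*2.+1.
Proof.
have near j : 3 + j <= n.*2.+1 -> ~ ~ near_cycle (3 + j).
  elim: j => [_|j IH h] no_near; first by apply: no_near; exact: near_cycle3.
  have h' : 3 + j <= n.*2.+1 by move: h; clear; lia.
  apply: (IH h') => /growth; apply; last by rewrite -addnS.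
  by move: h; clear; lia.
have [j nj] : exists j, 3 + j = n.*2.+1.
  by exists (n.*2.+1 - 3); case: n45 => ->.
by rewrite -nj; apply: near; rewrite nj.
Qed.

End Core.

(** * Monochromatic cycles with 2n+2 vertices *)

Section Final.

Variables (V : finType) (T : eqType) (f : V -> T) (g : rel V) (n : nat).
Variables (A R : {set V}).
Local Notation E := (bicolor f g).

Hypothesis g_sym : symmetric g.
Hypothesis g_mod : forall x y z, x \in A -> y \in A -> z \in A ->
  f x = f y -> f x != f z -> g x z = g y z.
Hypothesis sRA : {subset R <= A}.
Hypothesis f_inj : {in R &, injective f}.
Hypothesis n45 : n = 4 \/ n = 5.
Hypothesis no_cycle : forall b z, uniq z -> size z = n.*2.+1 -> {subset z <= A} ->
  ~~ cycle (E b) z.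

Let E_sym b : symmetric (E b) := bicolor_sym f b g_sym.
Let E_irr b : irreflexive (E b) := bicolor_irr f g b.

Local Notation m := n.*2.+2.

Ltac edges e := first
  [ done | assumption | by apply: (e) | rewrite E_sym; assumption
  | by rewrite E_sym; apply: (e) | apply/andP; split; edges e ].

Section Chords.

Variables (b : bool) (x0 : V) (Z : seq V).
Hypothesis uZ : uniq Z.
Hypothesis sZR : {subset Z <= R}.
Hypothesis cZ : cycle (E b) Z.
Hypothesis szZ : size Z = m.

Let v i := nth x0 Z i.


Lemma no_cycle_idx c s : uniq s -> size s = n.*2.+1 -> all (gtn m) s ->
  ~~ cycle (fun i j => E c (v i) (v j)) s.
Proof.
move=> us szs /allP sm.
have -> : cycle (fun i j => E c (v i) (v j)) s = cycle (E c) (map v s).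
  by case: s {us szs sm} => //= x s; rewrite -map_rcons path_map.
apply: no_cycle; rewrite ?size_map //.
  rewrite map_inj_in_uniq // => i j /sm im /sm jm /eqP.
  by rewrite /v nth_uniq ?szZ // => /eqP.
by move=> y /mapP[i /sm im ->]; apply/sRA/sZR/mem_nth; rewrite szZ.
Qed.

Lemma v_edge i : i < m -> E b (v i) (v (i.+1 %% m)).
Proof. by move=> im; rewrite /v -szZ; apply: cycle_nth; rewrite ?szZ. Qed.

Lemma v_blue i j : i < m -> j < m -> i != j -> ~~ E b (v i) (v j) -> E (~~ b) (v i) (v j).
Proof.
move=> im jm ij; rewrite /bicolor (inj_in_eq f_inj) ?sZR ?mem_nth ?szZ //.
by rewrite nth_uniq ?szZ // ij /=; case: (g _ _); case: b.
Qed.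

Lemma chord2_0 : E (~~ b) (v 0) (v 2).
Proof.
have e i : i.+1 < m -> E b (v i) (v i.+1).
  by move=> im; have := @v_edge i (ltnW im); rewrite modn_small.
have e' : E b (v n.*2.+1) (v 0) by have := @v_edge n.*2.+1 (leqnn _); rewrite modnn.
have nc := @no_cycle_idx b.
have blue := @v_blue; case: n45 => n_eq; rewrite n_eq in e e' nc blue.
all: apply: (blue) => //; apply/negP => e02.
  apply: (negP (nc [:: 0; 2; 3; 4; 5; 6; 7; 8; 9] _ _ _)) => //=.
  by edges e.
apply: (negP (nc [:: 0; 2; 3; 4; 5; 6; 7; 8; 9; 10; 11] _ _ _)) => //=.
by edges e.
Qed.

End Chords.

Lemma rot_hyps b Z i : uniq Z -> {subset Z <= R} -> cycle (E b) Z -> size Z = m ->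
  [/\ uniq (rot i Z), {subset rot i Z <= R}, cycle (E b) (rot i Z) & size (rot i Z) = m].
Proof.
move=> uZ sZR cZ szZ; split; rewrite ?rot_uniq ?rot_cycle ?size_rot //.
by move=> x; rewrite mem_rot; exact: sZR.
Qed.

Section Chords2.

Variables (b : bool) (x0 : V) (Z : seq V).
Hypothesis uZ : uniq Z.
Hypothesis sZR : {subset Z <= R}.
Hypothesis cZ : cycle (E b) Z.
Hypothesis szZ : size Z = m.

Let v i := nth x0 Z i.

Lemma chord2 i : i < m -> E (~~ b) (v i) (v ((i + 2) %% m)).
Proof.
move=> im; have [u' s' c' z'] := rot_hyps i uZ sZR cZ szZ.
have : E (~~ b) (nth x0 (rot i Z) 0) (nth x0 (rot i Z) 2) := chord2_0 x0 u' s' c' z'.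
have m2 : 2 < m by case: n45 => ->.
by rewrite !nth_rot ?szZ // addn0 modn_small.
Qed.

(* A red chord joining vertices of equal parity rules out two further red chords; these
   connect the two blue cycles of chords of length 2 to a blue cycle that omits one vertex. *)
Lemma long_chord0 j : j \in [:: 4; 6] -> j <= n.+1 -> E (~~ b) (v 0) (v j).
Proof.
have e i : i.+1 < m -> E b (v i) (v i.+1).
  by move=> im; have := @v_edge b x0 Z cZ szZ i (ltnW im); rewrite modn_small.
have e' : E b (v n.*2.+1) (v 0).
  by have := @v_edge b x0 Z cZ szZ n.*2.+1 (leqnn _); rewrite modnn.
have d i : i.+2 < m -> E (~~ b) (v i) (v i.+2).
  by move=> im; have := @chord2 i (ltnW (ltnW im)); rewrite addn2 modn_small.
have d0 : E (~~ b) (v n.*2) (v 0).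
  by have := @chord2 n.*2 (leqnSn _); rewrite addn2 modnn.
have d1 : E (~~ b) (v n.*2.+1) (v 1).
  have := @chord2 n.*2.+1 (leqnn _); have -> : n.*2.+1 + 2 = 1 + m by lia.
  by rewrite modnDr modn_small.
have nc := @no_cycle_idx x0 Z uZ sZR szZ.
have blue := @v_blue b x0 Z uZ sZR szZ; rewrite -/v in nc blue.
rewrite !inE; case: n45 => n_eq; rewrite n_eq in e e' d d0 d1 nc blue; rewrite ?n_eq; case/orP => /eqP-> // _.
all: apply: (blue) => //; apply/negP => e0.
- have b16 : E (~~ b) (v 1) (v 6).
    apply: (blue) => //; apply/negP => e16.
    apply: (negP (nc b [:: 0; 4; 3; 2; 1; 6; 7; 8; 9] _ _ _)) => //=.
    by edges e.
  have b92 : E (~~ b) (v 9) (v 2).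
    apply: (blue) => //; apply/negP => e92.
    apply: (negP (nc b [:: 0; 4; 5; 6; 7; 8; 9; 2; 1] _ _ _)) => //=.
    by edges e.
  apply: (negP (nc (~~ b) [:: 1; 3; 5; 7; 9; 2; 0; 8; 6] _ _ _)) => //=.
  by edges d.
- have b16 : E (~~ b) (v 1) (v 6).
    apply: (blue) => //; apply/negP => e16.
    apply: (negP (nc b [:: 0; 4; 3; 2; 1; 6; 7; 8; 9; 10; 11] _ _ _)) => //=.
    by edges e.
  have b112 : E (~~ b) (v 11) (v 2).
    apply: (blue) => //; apply/negP => e112.
    apply: (negP (nc b [:: 0; 4; 5; 6; 7; 8; 9; 10; 11; 2; 1] _ _ _)) => //=.
    by edges e.
  apply: (negP (nc (~~ b) [:: 1; 3; 5; 7; 9; 11; 2; 0; 10; 8; 6] _ _ _)) => //=.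
  by edges d.
- have b18 : E (~~ b) (v 1) (v 8).
    apply: (blue) => //; apply/negP => e18.
    apply: (negP (nc b [:: 0; 6; 5; 4; 3; 2; 1; 8; 9; 10; 11] _ _ _)) => //=.
    by edges e.
  have b114 : E (~~ b) (v 11) (v 4).
    apply: (blue) => //; apply/negP => e114.
    apply: (negP (nc b [:: 0; 6; 7; 8; 9; 10; 11; 4; 3; 2; 1] _ _ _)) => //=.
    by edges e.
  apply: (negP (nc (~~ b) [:: 1; 3; 5; 7; 9; 11; 4; 2; 0; 10; 8] _ _ _)) => //=.
  by edges d.
Qed.

End Chords2.

(** * The two parity classes of a cycle with 2n + 2 vertices *)

Section Parity.

Variables (b : bool) (x0 : V) (Z : seq V).
Hypothesis uZ : uniq Z.
Hypothesis sZR : {subset Z <= R}.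
Hypothesis cZ : cycle (E b) Z.
Hypothesis szZ : size Z = m.

Let v i := nth x0 Z i.

Lemma same_parity i j : i < m -> j < m -> i != j -> odd i = odd j -> E (~~ b) (v i) (v j).
Proof.
have chord k d : k < m -> d \in [:: 2; 4; 6] -> d <= n.+1 -> E (~~ b) (v k) (v ((k + d) %% m)).
  move=> km; rewrite in_cons => /predU1P[->|d46] dn; first exact: (chord2 x0 uZ sZR cZ szZ).
  have [u' s' c' z'] := rot_hyps k uZ sZR cZ szZ.
  have m0 : 0 < m by [].
  have dm : d < m by move: dn; clear; lia.
  have : E (~~ b) (nth x0 (rot k Z) 0) (nth x0 (rot k Z) d).
    exact: (@long_chord0 b x0 _ u' s' c' z' d d46 dn).
  by rewrite !nth_rot ?szZ // addn0 modn_small.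
wlog lt_ij : i j / i < j.
  move=> wl im jm ij odd_ij; have := ij; rewrite neq_ltn => /orP[lt_ij|lt_ji].
    exact: wl.
  by rewrite E_sym; apply: wl => //; rewrite eq_sym.
move=> im jm _ odd_ij.
(* A chord spanning more than n + 1 steps is measured the other way round; the length 2n + 2 is
   even, so its span remains even. *)
have [small|large] := leqP (j - i) n.+1.
  have -> : j = (i + (j - i)) %% m by rewrite subnKC ?modn_small // ltnW.
  apply: chord => //; rewrite !inE; case: n45 small => ?; move: lt_ij jm odd_ij; lia.
rewrite E_sym; have -> : i = (j + (m - (j - i))) %% m.
  have -> : j + (m - (j - i)) = i + m by lia.
  by rewrite modnDr modn_small.
apply: chord => //; last by lia.
by rewrite !inE; case: n45 large => ?; move: lt_ij jm odd_ij; lia.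
Qed.

Let P (p : bool) : seq V := map v [seq i <- iota 0 m | odd i == p].

Let PP p x : reflect (exists i, [/\ i < m, odd i = p & x = v i]) (x \in P p).
Proof.
apply: (iffP mapP) => [[i]|[i [im odd_i ->]]]; last first.
  by exists i; rewrite // mem_filter odd_i eqxx mem_iota.
by rewrite mem_filter mem_iota => /andP[/eqP odd_i /andP[_ im]] ->; exists i.
Qed.

Let v_inj i j : i < m -> j < m -> v i = v j -> i = j.
Proof. by move=> im jm /eqP; rewrite /v nth_uniq ?szZ // => /eqP. Qed.

Let v_in i : i < m -> v i \in Z.
Proof. by move=> im; rewrite mem_nth ?szZ. Qed.

Let P_uniq p : uniq (P p).
Proof.
rewrite map_inj_in_uniq ?filter_uniq ?iota_uniq // => i j.
by rewrite !mem_filter !mem_iota => /and3P[_ _ im] /and3P[_ _ jm]; apply: v_inj.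
Qed.

Let P_size p : size (P p) = n.+1.
Proof. by rewrite size_map; case: n45 => ->; case: p. Qed.

Let P_sub p : {subset P p <= Z}.
Proof. by move=> x /PP[i [im _ ->]]; apply: v_in. Qed.

Let P_cover x : x \in Z -> exists p, x \in P p.
Proof.
move=> xZ; exists (odd (index x Z)); apply/PP; exists (index x Z).
by rewrite -szZ index_mem xZ /v nth_index.
Qed.

Let P_disj p x : x \in P p -> x \notin P (~~ p).
Proof.
case/PP=> i [im odd_i ->]; apply/PP => -[j [jm odd_j /v_inj ij]].
by have := odd_j; rewrite -ij // odd_i; case: p {odd_i odd_j}.
Qed.

Let P_blue p x y : x \in P p -> y \in P p -> x != y -> E (~~ b) x y.
Proof.
move=> /PP[i [im odd_i ->]] /PP[j [jm odd_j ->]] vij.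
apply: same_parity; rewrite ?odd_i ?odd_j //.
by apply: contraNneq vij => ->.
Qed.

Let P_next p x : x \in P p -> exists y y',
  [/\ y != y', y \in P (~~ p), y' \in P (~~ p), E b x y & E b x y'].
Proof.
case/PP=> i [im odd_i ->].
have m2 : 2 < m by case: n45 => ->.
have e j := @v_edge b x0 Z cZ szZ j.
have edge j k : j.+1 = k -> k < m -> E b (v j) (v k).
  by move=> <- km; have := e j (ltnW km); rewrite modn_small.
have edge0 : E b (v n.*2.+1) (v 0) by have := e n.*2.+1 (leqnn _); rewrite modnn.
have vneq j k : j < m -> k < m -> j != k -> v j != v k.
  by move=> jm km; apply: contraNneq => /v_inj->.
have inP j : j < m -> odd j = ~~ p -> v j \in P (~~ p) by move=> jm oj; apply/PP; exists j.
case: i im odd_i => [|i] im odd_i.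
  exists (v 1), (v n.*2.+1); split.
  - by apply: vneq => //; case: n45 => ->.
  - by apply: inP; rewrite // -odd_i.
  - by apply: inP; rewrite //= odd_double -odd_i.
  - exact: edge.
  - by rewrite E_sym.
have odd_i' : odd i = ~~ p by rewrite -odd_i /= negbK.
have [i_last|i_small] := eqVneq i n.*2.
  subst i; exists (v 0), (v n.*2); split.
  - by apply: vneq => //; case: n45 => ->.
  - by apply: inP; rewrite // -odd_i' odd_double.
  - exact: inP.
  - exact: edge0.
  - by rewrite E_sym; apply: edge.
have i2m : i.+2 < m by move: im i_small; clear; lia.
exists (v i.+2), (v i); split.
- by apply: vneq => //; [apply: ltnW (ltnW _) | rewrite -addn2 eq_sym -[X in X == _]addn0 eqn_add2l].
- by apply: inP; rewrite //= negbK.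
- by apply: inP => //; apply: ltnW (ltnW _).
- exact: edge.
- by rewrite E_sym; apply: edge.
Qed.

(** The parts over [R] outside [Z] hold at most 2(4n - 2n - 2) vertices, so those over [Z] hold at
    least 3n + 6 > 4n, and one parity class carries at least 2n + 1. Inside it a vertex misses in
    blue only its own part. *)
Lemma finish_doubled : (forall x, x \in A -> exists2 r, r \in R & f r = f x) ->
    (forall x, x \in A -> #|[set y in A | f y == f x]| <= 2) ->
  7 * n + 2 <= #|A| -> #|R| <= 4 * n -> False.
Proof.
move=> R_cover part2 largeA smallR.
pose X p := [set x in A | f x \in map f (P p)].
have AX : A \subset X true :|: X false :|: [set x in A | f x \in map f (enum (R :\: [set x in Z]))].
  apply/subsetP => x xA; rewrite in_setU in_setU /X !in_set xA /=.
  have [r rR <-] := R_cover x xA.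
  have [rZ|rZ] := boolP (r \in Z).
    by have [[] rP] := P_cover rZ; rewrite (map_f f rP) ?orbT.
  by rewrite [X in _ || X]map_f ?orbT // mem_enum in_setD in_set rZ.
have cO : #|[set x in A | f x \in map f (enum (R :\: [set x in Z]))]| <= 2 * (#|R| - m).
  have -> : #|R| - m = size (map f (enum (R :\: [set x in Z]))).
    rewrite size_map -cardE cardsD (setIidPr _) ?cardsE ?(card_uniqP uZ) ?szZ //.
    by apply/subsetP => x; rewrite in_set => /sZR.
  apply: card_fiber_seq => i /mapP[r]; rewrite mem_enum => /setDP[rR _] ->.
  exact/part2/sRA.
have [p Xp] : exists p, n.*2.+1 <= #|X p|.
  have := leq_trans (subset_leq_card AX) (leq_card_setU _ _).
  move/leq_trans => /(_ _ (leq_add (leq_card_setU _ _) cO)).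
  case: (leqP n.*2.+1 #|X true|); first by exists true.
  move=> small; case: (leqP n.*2.+1 #|X false|); first by exists false.
  by move: small largeA smallR; case: n45 => ->; clear; lia.
have [x xX|z [uz sz zX cz]] := dirac_set (E_sym (~~ b)) (E_irr (~~ b)) Xp.
  have xA : x \in A by move: xX; rewrite in_set => /andP[].
  apply: (@leq_trans 2); last by case: n45 => ->.
  apply: leq_trans (part2 x xA); apply: subset_leq_card; apply/subsetP => y.
  rewrite in_set => /andP[yX nxy].
  move: xX yX; rewrite !in_set => /andP[_ /mapP[r rP fr]] /andP[yA /mapP[r' r'P fr']].
  rewrite yA /=; apply: contraNT nxy => fyx.
  have [rA r'A] : r \in A /\ r' \in A by split; apply/sRA/sZR; [exact: P_sub rP|exact: P_sub r'P].
  have rr' : r != r' by apply: contraNneq fyx => rr'; rewrite fr fr' rr'.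
  have /andP[_ /eqP g_rr'] := P_blue rP r'P rr'.
  rewrite /bicolor eq_sym fyx /= -g_rr'; apply/eqP.
  have -> : g x y = g r y by apply: g_mod; rewrite // eq_sym.
  by rewrite ![g r _]g_sym; apply: g_mod; rewrite // -?fr' // -fr.
have zA : {subset z <= A} by move=> y /zX; rewrite in_set => /andP[].
by have := no_cycle (~~ b) uz sz zA; rewrite cz.
Qed.

Let P_neq p x y : x \in P p -> y \in P (~~ p) -> x != y.
Proof. by move=> /P_disj xP yP; apply: contraNneq xP => ->. Qed.

Let ends_list p x y k : x \in P p -> y \in P p -> x != y -> k < n ->
  exists r, [/\ uniq (x :: rcons r y), {subset x :: rcons r y <= P p} & size r = k].
Proof.
move=> xP yP xy kn; pose Q := [set z in P p].
have cQ : #|Q| = n.+1 by rewrite cardsE (card_uniqP (P_uniq p)) P_size.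
have [|||r [ur rQ szr]] := @pad_seq _ Q [:: y; x] k.+2.
- by rewrite /= mem_seq1 eq_sym xy.
- by apply/allP; rewrite /= !in_set xP yP.
- by rewrite cQ /=; move: kn; clear; lia.
have perm_r : perm_eq (x :: rcons r y) ([:: y; x] ++ r) by rewrite -rcons_cons perm_rcons.
exists r; split; rewrite ?(perm_uniq perm_r) ?szr ?subn2 //.
by move=> z; rewrite (perm_mem perm_r) => /rQ; rewrite in_set.
Qed.

(** The cycle runs through all n + 1 vertices of one class from [x] to [x'], crosses over, and
    returns through [n] vertices of the other class from [y'] to [y]. *)
Let blue_disjoint x y x' y' : x \in P true -> x' \in P true -> y \in P false -> y' \in P false ->
  E (~~ b) x y -> E (~~ b) x' y' -> x != x' -> y != y' -> False.
Proof.
move=> xP x'P yP y'P exy ex'y' xx' yy'.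
have n2 : [/\ n.-1 < n, n.-2 < n & n.-1 + n.-2 + 4 = n.*2.+1] by case: n45 => ->.
case: n2 => n1 n2 n3.
have [r [ur rP szr]] := ends_list xP x'P xx' n1.
have y'y : y' != y by rewrite eq_sym.
have [q [uq qP szq]] := ends_list y'P yP y'y n2.
have blue_path p z s : uniq (z :: s) -> {subset z :: s <= P p} -> path (E (~~ b)) z s.
  by move=> us sP; apply: clique_path => // w w' /sP wP /sP w'P; apply: P_blue wP w'P.
have uz : uniq ((x :: rcons r x') ++ (y' :: rcons q y)).
  rewrite cat_uniq ur uq andbT; apply/hasPn => w /qP wP; apply/negP => /rP /P_disj.
  by rewrite wP.
have sz : size ((x :: rcons r x') ++ (y' :: rcons q y)) = n.*2.+1.
  by rewrite size_cat /= !size_rcons szr szq -n3; clear; lia.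
have zA : {subset (x :: rcons r x') ++ (y' :: rcons q y) <= A}.
  by move=> w; rewrite mem_cat => /orP[/rP|/qP] /P_sub/sZR/sRA.
have := no_cycle (~~ b) uz sz zA; apply/negP; rewrite negbK /= rcons_cat cat_path /=.
have -> := blue_path _ _ _ ur rP.
rewrite last_rcons ex'y' rcons_path; have -> := blue_path _ _ _ uq qP.
by rewrite last_rcons E_sym exy.
Qed.

(** Pairwise intersecting edges of a bipartite graph form a star. If there are none, [x0] serves as
    a dummy centre. *)
Let blue_star : exists c, forall x y, x \in P true -> y \in P false ->
  E (~~ b) x y -> x = c \/ y = c.
Proof.
have [/exists_inP[x xP /exists_inP[y yP exy]]|none] :=
    boolP [exists x in P true, exists y in P false, E (~~ b) x y]; last first.
  exists x0 => x y xP yP exy; case/exists_inP: none; exists x => //.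
  by apply/exists_inP; exists y.
have [all_x|] := boolP [forall x' in P true, forall y' in P false, E (~~ b) x' y' ==> (x' == x)].
  exists x => x' y' x'P y'P e'; left; apply/eqP.
  by have /forall_inP/(_ _ y'P)/implyP := forall_inP all_x x' x'P; apply.
rewrite negb_forall_in => /exists_inP[x1 x1P]; rewrite negb_forall_in => /exists_inP[y1 y1P].
rewrite negb_imply => /andP[e1 x1x].
have y1y : y1 = y.
  by apply/eqP; apply/negPn/negP => y1y; apply: (blue_disjoint x1P xP y1P yP e1 exy x1x y1y).
exists y => x2 y2 x2P y2P e2; right; apply/eqP/negPn/negP => y2y.
have [x2x|x2x] := eqVneq x2 x; last exact: (blue_disjoint x2P xP y2P yP e2 exy x2x y2y).
by apply: (blue_disjoint x2P x1P y2P y1P e2 e1); rewrite ?y1y // x2x eq_sym.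
Qed.

(** Apart from [c], the vertices of [P p] are red to the whole other class. So n - 1 of them
    alternate with n - 2 vertices of that class, and together with [u], [e], [y0], [o] they form a
    red cycle of length 2n + 1. As [e] may be the centre, [y0] is one of its two neighbours on
    [Z]. *)
Let no_red_attachment c p u e o : (forall x y, x \in P p -> y \in P (~~ p) ->
    E (~~ b) x y -> x = c \/ y = c) -> c \notin P (~~ p) ->
  u \in A -> u \notin Z -> e \in P p -> o \in P (~~ p) -> E b u e -> E b u o -> False.
Proof.
move=> star cP uA uNZ eP oP ue uo.
have n4 : 3 < n by case: n45 => ->.
have red x y : x \in P p -> y \in P (~~ p) -> x != c -> E b x y.
  move=> xP yP xc; apply/negPn/negP => nxy.
  have bxy : E (~~ b) x y.
    have [[i [im _ def_x]] [j [jm _ def_y]]] := (PP _ _ xP, PP _ _ yP).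
    rewrite def_x def_y in nxy *; apply: (v_blue uZ sZR szZ) => //.
    by apply: contraNneq (P_neq xP yP) => ij; rewrite def_x def_y ij.
  by case: (star x y xP yP bxy) => [xc'|yc]; [rewrite xc' eqxx in xc | rewrite -yc yP in cP].
have [y0 [y0P y0o ey0]] : exists y0, [/\ y0 \in P (~~ p), y0 != o & E b e y0].
  have [y [y' [yy' yP y'P ey ey']]] := P_next eP.
  have [yo|yo] := eqVneq y o; last by exists y.
  by exists y'; split; rewrite // -yo eq_sym.
pose Q := [set x in P p | (x != e) && (x != c)].
pose S := [set y in P (~~ p) | (y != o) && (y != y0)].
have card_P q : #|[set x in P q]| = n.+1 by rewrite cardsE (card_uniqP (P_uniq q)) P_size.
have cQ : n.-1 <= #|Q|.
  have : #|[set x in P p]| <= #|Q| + (1 + 1).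
    rewrite -{1}(cards1 e) -(cards1 c).
    apply: leq_trans (leq_add (leqnn _) (leq_card_setU _ _)).
    apply: leq_trans (leq_card_setU _ _); apply: subset_leq_card; apply/subsetP => x.
    rewrite !(in_setU, in_set1) !in_set => ->.
    by case: (x == e); case: (x == c).
  by rewrite card_P; clear; lia.
have cS : n.-1 <= #|S|.
  have : #|[set x in P (~~ p)]| <= #|S| + (1 + 1).
    rewrite -{1}(cards1 o) -(cards1 y0).
    apply: leq_trans (leq_add (leqnn _) (leq_card_setU _ _)).
    apply: leq_trans (leq_card_setU _ _); apply: subset_leq_card; apply/subsetP => x.
    rewrite !(in_setU, in_set1) !in_set => ->.
    by case: (x == o); case: (x == y0).
  by rewrite card_P; clear; lia.
have [os [uos szos osQ]] := sub_seq_card cQ.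
case: os uos szos osQ => [|x os] uos szos osQ; first by move: szos n4; case: n45 => ->.
have osP z : z \in x :: os -> [/\ z \in P p, z != e & z != c].
  by move/osQ; rewrite in_set => /and3P[].
have lnk : linkable (E b) (mem S) #|S| (mem (x :: os)).
  apply: linkable_complete; first exact: E_sym.
  move=> s a; rewrite in_set => /and3P[sP _ _] /osP[aP _ ac].
  by rewrite E_sym; apply: red.
have [||z [ls [pz lz perm_z szl [uls Sls _]]]] := @link_path _ _ _ _ os x (size os) [::] lnk uos.
- by rewrite gaps_size leqnn.
- by apply: leq_trans cS; rewrite -szos; apply: leqnSn.
have lsP y : y \in ls -> [/\ y \in P (~~ p), y != o & y != y0].
  by move/(allP Sls) => /=; rewrite in_set => /and3P[].
have perm_all : perm_eq ([:: u, e, y0, x & rcons z o]) ([:: u; e; y0; o] ++ (x :: os) ++ ls).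
  rewrite /= !perm_cons -rcons_cons perm_rcons perm_cons perm_cons.
  exact: perm_z.
have mem_all w : w \in [:: u, e, y0, x & rcons z o] ->
    [\/ w = u, w \in P p | w \in P (~~ p)].
  rewrite (perm_mem perm_all) mem_cat => /orP[|].
    rewrite !in_cons in_nil orbF => /or4P[]/eqP->; try by constructor 3.
      by constructor 1.
    by constructor 2.
  by rewrite mem_cat => /orP[/osP[]|/lsP[]]; [constructor 2|constructor 3].
have outside q w : w \in P q -> w != u by move=> /P_sub wZ; apply: contraNneq uNZ => <-.
have uz : uniq [:: u, e, y0, x & rcons z o].
  rewrite (perm_uniq perm_all) cat_uniq; apply/and3P; split.
  - have [ey0' eo] := (P_neq eP y0P, P_neq eP oP).
    have [? [? ?]] := (outside _ _ eP, (outside _ _ y0P, outside _ _ oP)).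
    by uniq_tac.
  - apply/hasPn => w; rewrite mem_cat => /orP[/osP[wP we wc]|/lsP[wP wo wy]].
      have [? [? ?]] := (outside _ _ wP, (P_neq wP y0P, P_neq wP oP)).
      by uniq_tac.
    have [? ?] := (outside _ _ wP, P_neq eP wP).
    by uniq_tac.
  - rewrite cat_uniq uos uls andbT; apply/hasPn => w /lsP[wP _ _]; apply/negP => /osP[/P_disj].
    by rewrite wP.
have sz : size [:: u, e, y0, x & rcons z o] = n.*2.+1.
  rewrite /= size_rcons (perm_size perm_z) size_cat szl.
  by move: szos n4; rewrite /=; clear; lia.
have zA : {subset [:: u, e, y0, x & rcons z o] <= A}.
  by move=> w /mem_all[->|/P_sub/sZR/sRA|/P_sub/sZR/sRA].
have [xP xe xc] := osP x (mem_head _ _).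
have := no_cycle b uz sz zA; apply/negP; rewrite negbK /= ue ey0 (E_sym _ y0) red //=.
rewrite !rcons_path pz last_rcons lz (E_sym _ o) uo andbT /=.
by have [? _ ?] := osP _ (mem_last x os); apply: red.
Qed.

(** A vertex off [Z] is blue to all of one parity class. There are at least 2n - 1 such vertices, so
    [n] of them share a class; added to its n + 1 vertices they satisfy Dirac's condition in blue,
    however these [n] are joined among themselves. *)
Lemma finish_complete : R = A -> 4 * n < #|A| -> False.
Proof.
move=> RA largeA; have [c star] := blue_star.
have no_attach p u e o : u \in A -> u \notin Z -> e \in P p -> o \in P (~~ p) ->
    E b u e -> E b u o -> False.
  have wlogP q e' o' : c \notin P (~~ q) -> u \in A -> u \notin Z -> e' \in P q ->
      o' \in P (~~ q) -> E b u e' -> E b u o' -> False.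
    move=> cq; apply: (no_red_attachment _ cq) => x y; case: (q) => xP yP exy.
      exact: star.
    by rewrite E_sym in exy; case: (star y x yP xP exy); [right|left].
  move=> uA uNZ eP oP ue uo.
  have [cP|cP] := boolP (c \in P (~~ p)); last exact: (wlogP p e o).
  have cP' : c \notin P (~~ ~~ p) by apply: P_disj.
  by apply: (wlogP (~~ p) o e) => //; rewrite negbK.
pose W p := [set u in A | (u \notin Z) && [forall e in P p, E (~~ b) u e]].
have WU : A \subset [set x in Z] :|: (W true :|: W false).
  apply/subsetP => u uA; rewrite !in_setU ![u \in W _]in_set in_set uA.
  have [//|uNZ /=] := boolP (u \in Z).
  have blue p e : e \in P p -> ~~ E b u e -> E (~~ b) u e.
    move=> /P_sub eZ; have [uR eR] : u \in R /\ e \in R by rewrite {1}RA uA sZR.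
    rewrite /bicolor (inj_in_eq f_inj) //.
    have -> : u != e by apply: contraNneq uNZ => ->.
    by case: (g u e); case: b.
  apply/orP; have [|] := boolP [forall e in P true, E (~~ b) u e]; first by left.
  rewrite negb_forall_in => /exists_inP[e eP ne]; right; apply/forall_inP => o oP.
  apply: (blue _ _ oP); apply/negP => uo; apply: (no_attach true u e o) => //.
  by apply/negPn/negP => /(blue _ _ eP); rewrite (negbTE ne).
have [p Wp] : exists p, n <= #|W p|.
  have := leq_trans (subset_leq_card WU) (leq_card_setU _ _).
  move/leq_trans => /(_ _ (leq_add (leqnn _) (leq_card_setU _ _))).
  rewrite cardsE (card_uniqP uZ) szZ => le.
  case: (leqP n #|W true|); first by exists true.
  move=> small; exists false; move: small largeA le; case: n45 => ->; clear; lia.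
have [s [us szs sW]] := sub_seq_card Wp.
pose D := [set x in P p] :|: [set x in s].
have sP x : x \in s -> [/\ x \in A, x \notin Z & forall e, e \in P p -> E (~~ b) x e].
  by move=> /sW; rewrite in_set => /and3P[? ? /forall_inP].
have cD : n.*2.+1 <= #|D|.
  rewrite cardsU (_ : _ :&: _ = set0).
    by rewrite cards0 subn0 !cardsE !(card_uniqP _) // P_size szs; clear; lia.
  apply/setP => x; rewrite !in_set; apply/negP => /andP[/P_sub xZ /sP[_]].
  by rewrite xZ.
have [x xD|z [uz sz zD cz]] := dirac_set (E_sym (~~ b)) (E_irr (~~ b)) cD.
  move: xD; rewrite in_setU ![x \in finset _]in_set => /orP[xP|xs].
    apply: (@leq_trans 1); last by case: n45 => ->.
    rewrite -(cards1 x); apply: subset_leq_card; apply/subsetP => y.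
    rewrite in_set in_set1 => /andP[yD]; apply: contraNT => yx.
    move: yD; rewrite in_setU !in_set => /orP[yP|/sP[_ _ ye]]; last by rewrite E_sym ye.
    by apply: P_blue xP yP _; rewrite eq_sym.
  rewrite -szs -(card_uniqP us); apply: subset_leq_card; apply/subsetP => y.
  rewrite in_set in_setU !in_set => /andP[/orP[yP|//]].
  by case: (sP x xs) => _ _ ->.
have zA : {subset z <= A}.
  by move=> y /zD; rewrite in_setU !in_set => /orP[/P_sub/sZR/sRA|/sP[]].
by have := no_cycle (~~ b) uz sz zA; rewrite cz.
Qed.

End Parity.

End Final.

(** * Two-colored blow-ups contain a monochromatic cycle of length 2n + 1 *)

Section Blowup.

Variables (V : finType) (T : eqType) (f : V -> T) (g : rel V) (n : nat).
Local Notation E := (bicolor f g).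

Hypothesis g_sym : symmetric g.
Hypothesis n45 : n = 4 \/ n = 5.

Let no_blowup t (A R : {set V}) :
    (forall x y z, x \in A -> y \in A -> z \in A ->
      f x = f y -> f x != f z -> g x z = g y z) ->
    (forall x, x \in A -> #|[set y in A | f y == f x]| <= t) ->
    {subset R <= A} -> {in R &, injective f} ->
    (forall x, x \in A -> exists2 r, r \in R & f r = f x) ->
    [/\ t = 1, R = A & 4 * n < #|A|] \/ [/\ t = 2, 7 * n + 2 <= #|A| & #|R| <= 4 * n] ->
    (forall b z, uniq z -> size z = n.*2.+1 -> {subset z <= A} -> ~~ cycle (E b) z) ->
  False.
Proof.
move=> g_mod parts sRA f_inj R_cover sizes no_cycle.
apply: (near_cycle_max g_sym g_mod parts sRA f_inj R_cover n45 sizes no_cycle).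
move=> [b [Z [uZ sZR cZ szZ]]].
have sZA : {subset Z <= A} by move=> x /sZR/sRA.
case: szZ => szZ; first by have := no_cycle b Z uZ szZ sZA; rewrite cZ.
have [x0 _] : exists x0, x0 \in Z by case: Z szZ {uZ sZR cZ sZA} => // x0 s; exists x0; rewrite mem_head.
case: sizes => [[_ RA largeA]|[t2 largeA smallR]].
  exact: (finish_complete g_sym sRA f_inj n45 no_cycle x0 uZ sZR cZ szZ RA largeA).
rewrite t2 in parts.
exact: (finish_doubled g_sym g_mod sRA f_inj n45 no_cycle x0 uZ sZR cZ szZ R_cover parts largeA smallR).
Qed.

Lemma two_colored_blowup (A : {set V}) :
    (forall x y z, x \in A -> y \in A -> z \in A ->
      f x = f y -> f x != f z -> g x z = g y z) ->
    {in A &, injective f} /\ 4 * n < #|A| \/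
      (forall x, x \in A -> #|[set y in A | f y == f x]| <= 2) /\ 7 * n + 2 <= #|A| ->
  exists b z, [/\ uniq z, size z = n.*2.+1, {subset z <= A} & cycle (E b) z].
Proof.
move=> g_mod sizes.
have [/existsP[b /existsP[z /and3P[uz /allP zA cz]]]|none] :=
    boolP [exists b, exists z : n.*2.+1.-tuple V, [&& uniq z, all [in A] z & cycle (E b) z]].
  by exists b, z; rewrite size_tuple.
have no_cycle b z : uniq z -> size z = n.*2.+1 -> {subset z <= A} -> ~~ cycle (E b) z.
  move=> uz /eqP szz /allP szA; apply: contra none => cz; apply/existsP; exists b.
  by apply/existsP; exists (Tuple szz); rewrite /= uz szA.
have part1 (B : {set V}) : {in B &, injective f} ->
    forall x, x \in B -> #|[set y in B | f y == f x]| <= 1.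
  move=> f_inj x xB; rewrite -(cards1 x); apply: subset_leq_card; apply/subsetP => y.
  by rewrite in_set in_set1 => /andP[yB /eqP/f_inj->].
have complete (B : {set V}) : {subset B <= A} -> {in B &, injective f} -> 4 * n < #|B| -> False.
  move=> sBA f_inj largeB; apply: (@no_blowup 1 B B) => //.
  - by move=> x y z /sBA xA /sBA yA /sBA; apply: g_mod.
  - exact: part1.
  - by move=> x xB; exists x.
  - by left.
  - by move=> b z uz szz zB; apply: no_cycle => // x /zB/sBA.
exfalso; case: sizes => [[f_inj largeA]|[parts largeA]]; first exact: (complete A).
pose rep x := odflt x [pick y in A | f y == f x].
have repP x : x \in A -> rep x \in A /\ f (rep x) = f x.
  rewrite /rep => x_in; case: pickP => [y /andP[yA /eqP fy] //|no_y].
  by have := no_y x; rewrite x_in eqxx.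
have rep_eq x y : x \in A -> f x = f y -> rep x = rep y.
  rewrite /rep => x_in <-; case: pickP => [//|no_y].
  by have := no_y x; rewrite x_in eqxx.
pose R := rep @: A.
have sRA : {subset R <= A} by move=> _ /imsetP[x /repP[] ? _ ->].
have f_inj : {in R &, injective f}.
  move=> _ _ /imsetP[x xA ->] /imsetP[y yA ->].
  by rewrite (repP x xA).2 (repP y yA).2; apply: rep_eq.
(* With more than 4n parts, one representative of each already gives a complete two-colored graph
   beyond the first threshold. *)
have [largeR|smallR] := ltnP (4 * n) #|R|; first exact: (complete R).
apply: (@no_blowup 2 A R) => //; last by right.
by move=> x xA; exists (rep x); [apply: imset_f | case: (repP x xA)].
Qed.

End Blowup.

(** * Gallai partitions *)

Lemma connect_closed (T : finType) (e : rel T) (P : pred T) x y :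
  (forall u w, P u -> e u w -> P w) -> P x -> connect e x y -> P y.
Proof.
move=> closedP Px /connectP[p pth ->] {y}.
elim: p x Px pth => //= z p IH x Px /andP[exz]; apply: IH; exact: closedP exz.
Qed.

Section Gallai.

Variables (V C : finType) (c : V -> V -> C).
Hypothesis c_sym : forall x y, c x y = c y x.
Hypothesis c_gallai : forall x y z, x != y -> y != z -> x != z ->
  [|| c x y == c y z, c y z == c x z | c x y == c x z].

Definition color_in (i : C) (A : {set V}) : rel V :=
  fun x y => [&& x \in A, y \in A, x != y & c x y == i].

Definition disconnects i (A : {set V}) :=
  [exists x in A, exists y in A, ~~ connect (color_in i A) x y].

Lemma color_in_sym i A : symmetric (color_in i A).
Proof. by move=> x y; rewrite /color_in eq_sym c_sym andbCA. Qed.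

Lemma color_in_csym i A : connect_sym (color_in i A).
Proof. exact/sym_connect_sym/color_in_sym. Qed.

Lemma connect_color_in i (A : {set V}) x y : x \in A -> connect (color_in i A) x y -> y \in A.
Proof. by move=> xA; apply: (connect_closed (P := [in A])) => // u w _ /and3P[]. Qed.

(** Along an edge u w of color [i] the edges from [u] and [w] to [z] avoid [i], since [z] lies in
    another component; the triangle u w z then forces them to agree. *)
Lemma component_color i (A : {set V}) x y z : x \in A -> z \in A ->
    connect (color_in i A) x y -> ~~ connect (color_in i A) x z ->
  c x z = c y z.
Proof.
move=> xA zA xy nxz.
suffices : connect (color_in i A) x y && (c y z == c x z) by case/andP=> _ /eqP.
apply: (connect_closed (P := fun w => connect (color_in i A) x w && (c w z == c x z)) _ _ xy);
  last by rewrite connect0 eqxx.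
move=> u w /andP[xu /eqP cuz] uw; have [uA wA uNw /eqP cuw] := and4P uw.
have xw : connect (color_in i A) x w := connect_trans xu (connect1 uw).
rewrite xw /= -cuz.
have Nz v : v \in A -> connect (color_in i A) x v -> (v != z) && (c v z != i).
  move=> vA xv; have vz : v != z by apply: contraNneq nxz => <-.
  rewrite vz; apply: contra nxz => cvz; apply: (connect_trans xv); apply: connect1.
  by rewrite /color_in vA zA vz.
have /andP[uz cu] := Nz u uA xu; have /andP[wz cw] := Nz w wA xw.
have := c_gallai uNw wz uz; rewrite cuw ![i == _]eq_sym (negbTE cu) (negbTE cw) orbF.
by [].
Qed.

Lemma third_color x y z i j : x != y -> y != z -> x != z -> i != j ->
  c x y = i -> c x z = j -> c y z != j -> c y z = i.
Proof.
move=> xy yz xz ij cxy cxz cyz; have := c_gallai xy yz xz.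
by rewrite cxy cxz (negbTE ij) (negbTE cyz) !orbF => /eqP.
Qed.

(** Because [i] connects [A], each [i]-component of [A :\ v] sends an [i]-edge to [v]. Take [x], [y]
    joined to [v] in colors [j], [k]: triangles through [v] give [x] color [j] and [y] color [k]
    towards such vertices of other components. Colors between components depend on the component
    only, so [j] and [k] would coincide. *)
Let disc_step (A : {set V}) v i j k : v \in A -> uniq [:: i; j; k] ->
  disconnects i (A :\ v) -> ~~ disconnects i A -> ~~ disconnects j A ->
  ~~ disconnects k A -> False.
Proof.
move=> vA ijk /exists_inP[a aA' /exists_inP[d dA' nad]] conn_i conn_j conn_k.
set A' := A :\ v in aA' dA' nad; set e := color_in i A' in nad.
have [ij ik jk] : [/\ i != j, i != k & j != k].
  by move: ijk; rewrite /= !inE negb_or => /and3P[/andP[]].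
have conn l : ~~ disconnects l A -> forall x y, x \in A -> y \in A -> connect (color_in l A) x y.
  by rewrite negb_exists_in => /forall_inP h x y /h; rewrite negb_exists_in => /forall_inP h' /h'/negPn.
have A'A x : x \in A' -> x \in A /\ x != v by rewrite in_setD1 => /andP[].
have A'P x : x \in A -> x != v -> x \in A' by move=> xA xv; rewrite in_setD1 xv.
have reach x : x \in A' -> exists y, [/\ y \in A', connect e x y & c v y = i].
  move=> xA'; have [xA xv] := A'A x xA'.
  have [/exists_inP[y yA' /andP[xy /eqP cvy]]|none] :=
    boolP [exists y in A', connect e x y && (c v y == i)]; first by exists y.
  have : v \in A'.
    have : (v \in A') && connect e x v.
      apply: (connect_closed (P := fun w => (w \in A') && connect e x w) _ _ (conn i conn_i x v xA vA)).
        move=> u w /andP[uA' xu] /and4P[uA wA uw cuw].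
        have wv : w != v.
          apply: contraNneq none => wv; apply/exists_inP; exists u; rewrite // xu.
          by rewrite -wv c_sym cuw.
        rewrite A'P //; apply: (connect_trans xu); apply: connect1.
        by rewrite /e /color_in uA' A'P ?uw.
      by rewrite xA' connect0.
    by case/andP.
  by rewrite in_setD1 eqxx.
have color_at_v l : ~~ disconnects l A -> exists2 x, x \in A' & c v x = l.
  move=> conn_l; have [/exists_inP[y yA' /eqP cvy]|none] := boolP [exists y in A', c v y == l].
    by exists y.
  have [aA av] := A'A a aA'; case/negP: av.
  apply: (connect_closed (P := fun w => w == v) _ (eqxx v) (conn l conn_l v a vA aA)) => u w /eqP-> /and4P[_ wA vw cvw].
  by case/exists_inP: none; exists w; rewrite // A'P // eq_sym.
have [x xA' cvx] := color_at_v j conn_j; have [y yA' cvy] := color_at_v k conn_k.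
have far l w z : l != i -> w \in A' -> z \in A' -> c v w = l -> c v z = i ->
    ~~ connect e w z -> c w z = l.
  move=> li wA' zA' cvw cvz nwz; have [[wA wv] [zA zv]] := (A'A w wA', A'A z zA').
  have wz : w != z by apply: contraNneq nwz => ->; apply: connect0.
  apply: (third_color _ wz _ li cvw cvz); [by rewrite eq_sym | by rewrite eq_sym |].
  by apply: contra nwz => cwz; apply: connect1; rewrite /e /color_in wA' zA' wz.
have [ji ki] : j != i /\ k != i by rewrite ![_ == i]eq_sym.
have [xy|nxy] := boolP (connect e x y).
  have [w wA' nxw] : exists2 w, w \in A' & ~~ connect e x w.
    have [xa|] := boolP (connect e x a); last by exists a.
    exists d => //; apply: contra nad => xd.
    by apply: connect_trans xd; rewrite color_in_csym.
  have [z [zA' wz cvz]] := reach w wA'.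
  have nxz : ~~ connect e x z.
    by apply: contra nxw => xz; apply: (connect_trans xz); rewrite color_in_csym.
  have nyz : ~~ connect e y z by apply: contra nxz; apply: connect_trans.
  have := component_color xA' zA' xy nxz.
  by rewrite (far j x z) // (far k y z) // => jk'; rewrite jk' eqxx in jk.
have [x' [x'A' xx' cvx']] := reach x xA'; have [y' [y'A' yy' cvy']] := reach y yA'.
have nyx : ~~ connect e y x by rewrite color_in_csym.
have nxy' : ~~ connect e x y'.
  by apply: contra nxy => xy'; apply: (connect_trans xy'); rewrite color_in_csym.
have nyx' : ~~ connect e y x'.
  by apply: contra nyx => yx'; apply: (connect_trans yx'); rewrite color_in_csym.
have := component_color xA' yA' xx' nxy; have := component_color yA' xA' yy' nyx.
rewrite [c y' x]c_sym (far j x y') // [c x' y]c_sym (far k y x') // c_sym => -> jk'.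
by rewrite jk' eqxx in jk.
Qed.

Lemma some_disconnects (A : {set V}) i j k : 1 < #|A| -> uniq [:: i; j; k] ->
  [|| disconnects i A, disconnects j A | disconnects k A].
Proof.
have [s] := ubnP #|A|; elim: s A => // s IH A; rewrite ltnS => leAs A2 ijk.
apply/negPn; rewrite !negb_or; apply/negP => /and3P[conn_i conn_j conn_k].
have [v vA] : exists v, v \in A by apply/set0Pn; rewrite -card_gt0 ltnW.
have cA : #|A| = #|A :\ v|.+1 by rewrite (cardsD1 v A) vA.
have perm3 (a b d : C) : uniq [:: a; b; d] -> uniq [:: b; a; d] /\ uniq [:: d; a; b].
  rewrite /= !inE !negb_or !andbT => /andP[/andP[ab ad] bd].
  by rewrite ad bd [b == a]eq_sym ab [d == a]eq_sym ad [d == b]eq_sym bd.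
have [A'2|A'1] := ltnP 1 #|A :\ v|.
  have [jik kij] := perm3 _ _ _ ijk.
  have /or3P[] : [|| disconnects i (A :\ v), disconnects j (A :\ v) | disconnects k (A :\ v)].
    by apply: IH; rewrite // -cA.
  - by move=> di; apply: (disc_step vA ijk di).
  - by move=> dj; apply: (disc_step vA jik dj).
  - by move=> dk; apply: (disc_step vA kij dk).
have /eqP/cards1P[w A'w] : #|A :\ v| = 1 by move: A2; rewrite cA; move: A'1; clear; lia.
have wP x : x \in A -> x != v -> x = w by move=> xA xv; apply/set1P; rewrite -A'w in_setD1 xv.
have [wA wv] : w \in A /\ w != v.
  by have : w \in A :\ v; [rewrite A'w set11 | rewrite in_setD1 => /andP[]].
have cvw l : ~~ disconnects l A -> c v w = l.
  rewrite negb_exists_in => /forall_inP/(_ v vA); rewrite negb_exists_in => /forall_inP/(_ w wA).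
  move/negPn => vw; apply/eqP/negPn/negP => ncvw; case/negP: wv.
  apply: (connect_closed (P := fun w => w == v) _ (eqxx v) vw) => u x /eqP-> /and4P[_ xA vx cvx].
  by case/negP: ncvw; rewrite -(wP x) // eq_sym.
by move: ijk; rewrite -(cvw i) // -(cvw j) //= !inE eqxx.
Qed.

(** Among three colors one, [i], fails to connect [A]. Contracting its components to their roots
    leaves a set on which [i] does not occur, so induction on the colors applies; with two colors
    left the singletons are the parts. *)
Lemma gallai_partition (A : {set V}) (K : {set C}) : 1 < #|A| -> 1 < #|K| ->
    (forall x y, x \in A -> y \in A -> x != y -> c x y \in K) ->
  exists r b (f : V -> V),
    [/\ r \in K, b \in K, r != b, exists x y, [/\ x \in A, y \in A & f x != f y] &
     (forall x y, x \in A -> y \in A -> f x != f y -> c x y = r \/ c x y = b) /\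
     (forall x y z, x \in A -> y \in A -> z \in A -> f x = f y -> f x != f z -> c x z = c y z)].
Proof.
have [s] := ubnP #|K|; elim: s A K => // s IH A K; rewrite ltnS => leKs A2 K2 cK.
have [K3|K3] := ltnP 2 #|K|; last first.
  have K2' : #|K| == 2 by rewrite eqn_leq K3.
  have /cards2P[r [b [rb defK]]] := K2'.
  have /card_gt1P[x [y [xA yA xy]]] := A2.
  exists r, b, id; rewrite defK !inE !eqxx orbT; split=> //; first by exists x, y.
  split=> [u w uA wA uw|u w z _ _ _ -> //].
  by have := cK u w uA wA uw; rewrite defK => /set2P.
have [l [ul szl lK]] := sub_seq_card K3.
case: l ul szl lK => [|i1 [|i2 [|i3 []]]] // ul _ lK.
have [i iK /exists_inP[a aA /exists_inP[d dA nad]]] : exists2 i, i \in K & disconnects i A.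
  have /or3P[h|h|h] := some_disconnects A2 ul; [exists i1|exists i2|exists i3] => //;
  by apply: lK; rewrite !inE eqxx ?orbT.
set e := color_in i A in nad; pose h := root e.
have h_eq := rootP (color_in_csym i A : connect_sym e).
have hA x : x \in A -> h x \in A by move=> xA; apply: (connect_color_in xA); apply: connect_root.
have c_h x y : x \in A -> y \in A -> h x != h y -> c x y = c (h x) (h y).
  move=> xA yA hxy; have nxy : ~~ connect e x y by apply: contra hxy => /h_eq/eqP.
  have -> := component_color xA yA (connect_root e x) nxy; rewrite !(c_sym (h x)).
  apply: (@component_color i A) => //; [exact: hA | exact: connect_root|].
  by rewrite color_in_csym; apply: contra nxy; apply: connect_trans; apply: connect_root.
have [|||x y hxA hyA hxy|r [b [f [rK bK rb [x [y [xA1 yA1 fxy]]] [frb fmod]]]]] := IH (h @: A) (K :\ i).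
- by apply: leq_trans leKs; rewrite [in X in _ < X](cardsD1 i K) iK.
- apply/card_gt1P; exists (h a), (h d); rewrite !imset_f //; split=> //.
  by apply: contra nad => /eqP/h_eq.
- by move: K3; rewrite (cardsD1 i K) iK; clear; lia.
- case/imsetP: hxA hyA hxy => x' x'A -> /imsetP[y' y'A ->] hxy.
  rewrite in_setD1 cK ?hA // andbT; apply: contra nad => /eqP cxy.
  have : connect e (h x') (h y') by apply: connect1; rewrite /e /color_in !hA ?hxy ?cxy /=.
  by move/h_eq; rewrite /h !(root_root (color_in_csym i A : connect_sym e)) => /eqP; rewrite (negbTE hxy).
case/imsetP: xA1 fxy => x' x'A -> fxy; case/imsetP: yA1 fxy => y' y'A -> fxy.
exists r, b, (f \o h); split=> //; try by [case/setD1P: rK | case/setD1P: bK].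
  by exists x', y'.
split=> [u w uA wA fuw|u w z uA wA zA fuw fuz].
  have huw : h u != h w by apply: contraNneq fuw => /= ->.
  by rewrite c_h //; apply: frb; rewrite ?imset_f.
have huz : h u != h z by apply: contraNneq fuz => /= ->.
have hwz : h w != h z by apply: contraNneq fuz => /= hwz; move: fuw => /= ->; rewrite hwz.
by rewrite c_h // (c_h w) //; apply: fmod; rewrite ?imset_f.
Qed.

End Gallai.

(** * Configurations *)

(** Greedy packing of disjoint three-vertex paths, each listed with its centre in the middle so that
    gaps occur only between paths. When the packing stops early, what is left has maximum degree
    one. *)
Lemma cherry_pack (T : finType) (e : rel T) j (S : {set T}) : irreflexive e -> symmetric e ->
  (exists x os, [/\ uniq (x :: os), {subset x :: os <= S}, size (x :: os) = 3 * j.+1 &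
     gaps e x os <= j]) \/
  (exists2 D : {set T}, #|D| <= 3 * j &
     forall x y z, x \in S :\: D -> y \in S :\: D -> z \in S :\: D ->
       e x y -> e x z -> y = z).
Proof.
move=> e_irr e_sym; elim: j S => [|j IH] S.
all: have [/existsP[x /existsP[y /existsP[z /and5P[/and3P[xS yS zS] exy exz yz _]]]]|none] :=
  boolP [exists x, exists y, exists z,
    [&& [&& x \in S, y \in S & z \in S], e x y, e x z, y != z & true]].
all: try (have xy : x != y by apply: contraTneq exy => ->; rewrite e_irr).
all: try (have xz : x != z by apply: contraTneq exz => ->; rewrite e_irr).
- left; exists y, [:: x; z]; split=> //; first by uniq_tac.
    by sub_tac.
  by rewrite /= e_sym exy exz.
- right; exists set0; rewrite ?cards0 // => x y z; rewrite !setD0 => xS yS zS exy exz.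
  apply/eqP; apply: contraNT none => yz; apply/existsP; exists x.
  by apply/existsP; exists y; apply/existsP; exists z; rewrite xS yS zS exy exz yz.
- pose Q := [set x; y; z].
  have cQ : #|Q| <= 3.
    by rewrite /Q -setUA; apply: leq_trans (leq_card_setU _ _) _; rewrite cards1 ltnS cards2; case: (_ == _).
  case: (IH (S :\: Q)) => [[w [os [uos osS szos gos]]]|[D cD noD]].
    left; exists y, [:: x, z, w & os]; split.
    + have out v : v \in w :: os -> [/\ v != x, v != y & v != z].
        by move/osS; rewrite !inE !negb_or -!andbA => /and4P[-> -> -> _].
      have nin v : v \in Q -> v \notin w :: os.
        move=> vQ; apply/negP => /out[]; move: vQ; rewrite !inE.
        by move=> /orP[/orP[]|] /eqP->; rewrite eqxx.
      rewrite -[y :: _]/([:: y; x; z] ++ (w :: os)) cat_uniq uos andbT; apply/andP; split.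
        by uniq_tac.
      by apply/hasPn => v /out[? ? ?]; uniq_tac.
    + move=> v; rewrite -[y :: _]/([:: y; x; z] ++ (w :: os)) mem_cat => /orP[|/osS].
        by rewrite !inE => /or3P[] /eqP->.
      by rewrite inE => /andP[].
    + by move: szos => /=; clear; lia.
    + by move: gos; rewrite /= e_sym exy exz; case: (e z w) => /=; clear; lia.
  right; exists (Q :|: D).
    by apply: leq_trans (leq_card_setU _ _) _; rewrite mulnS leq_add.
  by move=> u v w; rewrite !setDDl in noD *; apply: noD.
- right; exists set0; rewrite ?cards0 // => x y z; rewrite !setD0 => xS yS zS exy exz.
  apply/eqP; apply: contraNT none => yz; apply/existsP; exists x.
  by apply/existsP; exists y; apply/existsP; exists z; rewrite xS yS zS exy exz yz.
Qed.

Section Bound.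

Variables (V C : finType) (c : V -> V -> C) (n : nat).
Hypothesis c_sym : forall x y, c x y = c y x.
Hypothesis n45 : n = 4 \/ n = 5.

Definition mono (i : C) : rel V := fun x y => (x != y) && (c x y == i).

Hypothesis no_mono : forall i s, uniq s -> size s = n.*2.+1 -> ~~ cycle (mono i) s.

Lemma mono_sym i : symmetric (mono i).
Proof. by move=> x y; rewrite /mono eq_sym c_sym. Qed.

Lemma mono_irr i : irreflexive (mono i).
Proof. by move=> x; rewrite /mono eqxx. Qed.

Definition joined i (S L : {set V}) := forall s l, s \in S -> l \in L -> mono i s l.

Lemma joined_sym i S L : joined i S L -> joined i L S.
Proof. by move=> j s l sL lS; rewrite mono_sym j. Qed.

Lemma no_join i (S L : {set V}) x os q : joined i S L -> uniq (x :: os) ->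
    {subset x :: os <= L} -> 0 < size os -> gaps (mono i) x os < q <= (size os).+1 ->
  q <= #|S| -> (size os).+1 + q = n.*2.+1 -> False.
Proof.
move=> SL uos osL os0 gq qS szq.
have [||||||z [uz cz szz _]] := @link_cycle _ (mono i) (mem S) #|S| x os q => //.
- by apply: linkable_complete (mono_sym i) _ => s a sS /osL; apply: SL.
- apply/allP => y /osL yL; apply/negP => yS.
  by have := SL y y yS yL; rewrite mono_irr.
by have := no_mono i uz; rewrite szz szq cz => /(_ erefl).
Qed.

(** An edge of color [i] leaves at most n - 1 gaps among n + 1 vertices of [L]; then [n] vertices of
    [S] fill them and close a cycle of length 2n + 1. *)
Lemma joined_absent i (S L : {set V}) : joined i S L -> n <= #|S| -> n < #|L| ->
  forall x y, x \in L -> y \in L -> ~~ mono i x y.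
Proof.
move=> SL nS nL x y xL yL; apply/negP => xy.
have n4 : 3 < n by case: n45 => ->.
have xNy : x != y by apply: contraTneq xy => ->; rewrite mono_irr.
have [|||p [up pL szp]] := @pad_seq _ L [:: x; y] n.+1.
- by uniq_tac.
- by sub_tac.
- by rewrite nL andbT /=; lia.
apply: (@no_join i S L x (y :: p) n) => //.
- by have := gaps_size (mono i) y p; rewrite /= xy add0n szp /=; lia.
- by rewrite /= szp /=; lia.
Qed.

Lemma dense_small i (S : {set V}) :
  (forall x, x \in S -> #|[set y in S | ~~ mono i x y]| <= n) -> #|S| <= n.*2.
Proof.
move=> dense; rewrite leqNgt; apply/negP => largeS.
have [z [uz sz _ cz]] := dirac_set (mono_sym i) (mono_irr i) largeS dense.
by have := no_mono i uz sz; rewrite cz.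
Qed.

Definition config (K : {set C}) (A : {set V}) (X : C -> {set V}) :=
  [/\ forall x y, x \in A -> y \in A -> x != y -> c x y \in K,
      forall i, i \in K -> joined i (X i) A
    & forall i, i \in K -> #|X i| <= n].

Definition bounded (K : {set C}) := forall A X, config K A X ->
  #|A| + \sum_(i in K) #|X i| <= n * 2 ^ #|K|.

Lemma bounded0 K (A : {set V}) : bounded K ->
  (forall x y, x \in A -> y \in A -> x != y -> c x y \in K) -> #|A| <= n * 2 ^ #|K|.
Proof.
move=> bK cK; apply: leq_trans (leq_addr _ _) (bK A (fun _ => set0) _).
by split=> // i _; [move=> s l; rewrite in_set0 | rewrite cards0].
Qed.

Lemma color_setD1 (K : {set C}) (A : {set V}) i :
    (forall x y, x \in A -> y \in A -> x != y -> c x y \in K) ->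
    (forall x y, x \in A -> y \in A -> ~~ mono i x y) ->
  forall x y, x \in A -> y \in A -> x != y -> c x y \in K :\ i.
Proof.
move=> cK noi x y xA yA xy; rewrite in_setD1 cK // andbT.
by have := noi x y xA yA; rewrite /mono xy.
Qed.

(** * Parts of a Gallai partition and their neighbourhoods *)

Section Partition.

Variables (K : {set C}) (A : {set V}) (X : C -> {set V}) (f : V -> V).
Hypothesis cfg : config K A X.
Hypothesis f_mod : forall x y z, x \in A -> y \in A -> z \in A ->
  f x = f y -> f x != f z -> c x z = c y z.

Let cK : forall x y, x \in A -> y \in A -> x != y -> c x y \in K.
Proof. by case: cfg. Qed.
Let XA : forall i, i \in K -> joined i (X i) A.
Proof. by case: cfg. Qed.
Let Xn : forall i, i \in K -> #|X i| <= n.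
Proof. by case: cfg. Qed.

Lemma X_disjoint i x : i \in K -> x \in X i -> x \notin A.
Proof. by move=> iK xX; apply/negP => xA; have := XA iK xX xA; rewrite mono_irr. Qed.

Definition part x := [set y in A | f y == f x].

Lemma part_sub x : part x \subset A.
Proof. by apply/subsetP => y; rewrite in_set => /andP[]. Qed.

Lemma part_color x x' y y' : x \in A -> x' \in A -> y \in A -> y' \in A ->
  f x = f x' -> f y = f y' -> f x != f y -> c x y = c x' y'.
Proof.
move=> xA x'A yA y'A fx fy fxy; rewrite (f_mod xA x'A yA fx fxy) c_sym.
by rewrite (f_mod yA y'A x'A fy) 1?c_sym // -fx eq_sym.
Qed.

Section Colors.

Variables (r b : C).
Hypotheses (rK : r \in K) (bK : b \in K) (rb : r != b).
Hypothesis f_rb : forall x y, x \in A -> y \in A -> f x != f y -> c x y = r \/ c x y = b.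

Let rest := \sum_(i in K :\ r :\ b) #|X i|.

Let sumX : \sum_(i in K) #|X i| = #|X r| + (#|X b| + rest).
Proof. by rewrite (big_setD1 r rK) (big_setD1 b) //= in_setD1 bK eq_sym rb. Qed.

Let card_K : #|K| = #|K :\ r :\ b|.+2.
Proof. by rewrite (cardsD1 r K) rK (cardsD1 b (K :\ r)) in_setD1 bK eq_sym rb. Qed.

Let card_Kr : #|K :\ r| = #|K :\ r :\ b|.+1.
Proof. by rewrite (cardsD1 b (K :\ r)) in_setD1 bK eq_sym rb. Qed.

Let card_Kb : #|K :\ b| = #|K :\ r :\ b|.+1.
Proof.
have -> : K :\ r :\ b = K :\ b :\ r by apply/setP => x; rewrite !in_setD1 andbCA.
by rewrite (cardsD1 r (K :\ b)) in_setD1 rK rb.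
Qed.

Lemma bound_drop_r (L B : {set V}) : bounded (K :\ r) -> L \subset A ->
    (forall x y, x \in L -> y \in L -> ~~ mono r x y) -> joined b B L -> #|B| <= n ->
  #|L| + #|B| + rest <= n * 2 ^ #|K :\ r|.
Proof.
move=> bounded_r /subsetP LA no_r BL Bn.
have bKr : b \in K :\ r by rewrite in_setD1 bK eq_sym rb.
have := bounded_r L (fun i => if i == b then B else X i).
rewrite (big_setD1 b bKr) /= eqxx addnA.
rewrite (eq_bigr (fun i => #|X i|)); last by move=> i /setD1P[/negbTE->].
apply; split.
- by apply: color_setD1 no_r => x y /LA xA /LA; apply: cK.
- move=> i /setD1P[_ iK]; have [->//|_] := eqVneq i b.
  by move=> s l sX /LA; apply: XA.
- by move=> i /setD1P[_ iK]; have [_//|_] := eqVneq i b; apply: Xn.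
Qed.

Lemma bound_drop_rb (L : {set V}) : bounded (K :\ r :\ b) -> L \subset A ->
    (forall x y, x \in L -> y \in L -> ~~ mono r x y) ->
    (forall x y, x \in L -> y \in L -> ~~ mono b x y) ->
  #|L| + rest <= n * 2 ^ #|K :\ r :\ b|.
Proof.
move=> bounded_rb /subsetP LA no_r no_b; apply: bounded_rb; split.
- by do 2!apply: color_setD1 => //; move=> x y /LA xA /LA; apply: cK.
- by move=> i /setD1P[_ /setD1P[_ iK]] s l sX /LA; apply: XA.
- by move=> i /setD1P[_ /setD1P[_ iK]]; apply: Xn.
Qed.

Definition side a i := [set y in A | (f y != f a) && (c y a == i)].

Lemma side_joined a i : a \in A -> joined i (side a i) (part a).
Proof.
move=> aA s l; rewrite !in_set => /and3P[sA fsa /eqP csa] /andP[lA /eqP fla].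
rewrite /mono (part_color sA sA lA aA) ?fla // csa eqxx andbT.
by apply: contraNneq fsa => ->; rewrite fla.
Qed.

Lemma sides_cover a : a \in A -> A \subset part a :|: (side a r :|: side a b).
Proof.
move=> aA; apply/subsetP => y yA; rewrite !in_setU !in_set yA /=.
have [//|fya /=] := eqVneq (f y) (f a).
by case: (f_rb yA aA fya) => ->; rewrite eqxx ?orbT.
Qed.

(** Color [i] joins [X i] to the side, so once it is absent from their union one of the two is
    empty. It cannot be the side, because [X i] alone has at most [n] vertices. *)
Lemma side_attached a i : i \in K -> a \in A ->
    n < #|side a i :|: X i| -> n <= #|part a| ->
  X i = set0 /\ (forall x y, x \in side a i -> y \in side a i -> ~~ mono i x y).
Proof.
move=> iK aA large_side large_part.
have Rj : joined i (part a) (side a i :|: X i).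
  apply: joined_sym => s l /setUP[sS|sX] lP; first exact: side_joined sS lP.
  by apply: XA sX _ => //; apply: (subsetP (part_sub a)).
have noi := joined_absent Rj large_part large_side.
split=> [|x y xS yS]; last by apply: noi; rewrite in_setU ?xS ?yS.
apply/eqP/set0Pn => -[x xX].
have S0 : side a i = set0.
  apply/eqP/set0Pn => -[y yS].
  have := noi x y; rewrite !in_setU xX yS orbT => /(_ isT isT)/negP; apply.
  by apply: XA => //; move: yS; rewrite in_set => /andP[].
by move: large_side; rewrite S0 set0U ltnNge Xn.
Qed.

Let N := n * 2 ^ #|K :\ r :\ b|.

Let pows : [/\ n * 2 ^ #|K| = 4 * N, n * 2 ^ #|K :\ r| = 2 * N & n * 2 ^ #|K :\ b| = 2 * N].
Proof. by rewrite card_K card_Kr card_Kb /N !expnS; split; rewrite !mulnA; lia. Qed.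

Lemma card_side_attached a i : i \in K -> #|side a i :|: X i| = #|side a i| + #|X i|.
Proof.
move=> iK; rewrite cardsU (_ : _ :&: _ = set0) ?cards0 ?subn0 //.
apply/setP => x; rewrite in_setI in_set0; apply/negP => /andP[xS xX].
by case/negP: (X_disjoint iK xX); move: xS; rewrite in_set => /andP[].
Qed.

Lemma card_sides a : a \in A -> #|A| <= #|part a| + (#|side a r| + #|side a b|).
Proof.
move=> aA; apply: leq_trans (subset_leq_card (sides_cover aA)) _.
apply: leq_trans (leq_card_setU _ _) _; rewrite leq_add2l; exact: leq_card_setU.
Qed.

Lemma attached_joined a i : i \in K -> a \in A -> joined i (side a i :|: X i) (part a).
Proof.
move=> iK aA s l /setUP[sS|sX] lP; first exact: side_joined sS lP.
by apply: XA sX _ => //; apply: (subsetP (part_sub a)).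
Qed.

Lemma part_absent a i : i \in K -> a \in A -> n < #|part a| -> n < #|side a i :|: X i| ->
  forall x y, x \in part a -> y \in part a -> ~~ mono i x y.
Proof. by move=> iK aA large_a large_s; apply: joined_absent (attached_joined iK aA) (ltnW large_s) large_a. Qed.

Lemma side_colors a i x y : x \in side a i -> y \in side a i -> x != y -> c x y \in K.
Proof. by rewrite !in_set => /andP[xA _] /andP[yA _]; apply: cK. Qed.

(** Both the part and its side in color [r] avoid [r], and each accounts for at most 2N: the part
    together with its small side in color [b] as attached set, the other side alone. *)
Lemma one_side a : bounded (K :\ r) -> a \in A -> n < #|part a| ->
    n < #|side a r :|: X r| -> #|side a b :|: X b| <= n ->
  #|A| + \sum_(i in K) #|X i| <= n * 2 ^ #|K|.
Proof.
move=> bounded_r aA large_a large_r small_b.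
have [Xr0 no_r] := side_attached rK aA large_r (ltnW large_a).
have := bound_drop_r bounded_r (part_sub a) (part_absent rK aA large_a large_r) (attached_joined bK aA) small_b.
have := bounded0 bounded_r (color_setD1 (@side_colors a r) no_r).
have := card_sides aA; rewrite sumX Xr0 cards0 card_side_attached //.
by case: pows => -> -> _; clear; lia.
Qed.

(** Without color [i], different parts inside the side are joined in color [j], so a vertex misses
    only its own part and Dirac's condition holds. *)
Lemma side_small a i j : a \in A -> (forall x, x \in A -> f x != f a -> #|part x| <= n) ->
    (forall x y, x \in A -> y \in A -> f x != f y -> mono i x y \/ mono j x y) ->
    (forall x y, x \in side a i -> y \in side a i -> ~~ mono i x y) ->
  #|side a i| <= n.*2.
Proof.
move=> aA small fij no_i; apply: (@dense_small j) => x xS.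
have /and3P[xA fxa _] : [&& x \in A, f x != f a & c x a == i] by move: xS; rewrite in_set.
apply: leq_trans (small x xA fxa); apply: subset_leq_card; apply/subsetP => y.
rewrite in_set => /andP[yS nxy].
have yA : y \in A by move: yS; rewrite in_set => /andP[].
rewrite in_set yA; apply: contraNT nxy; rewrite eq_sym => fxy.
by case: (fij x y xA yA fxy) => //; rewrite (negbTE (no_i x y xS yS)).
Qed.

Lemma f_mono x y : x \in A -> y \in A -> f x != f y -> mono r x y \/ mono b x y.
Proof.
move=> xA yA fxy; have xy : x != y by apply: contraNneq fxy => ->.
by rewrite /mono xy; case: (f_rb xA yA fxy) => ->; rewrite eqxx; [left|right].
Qed.

(** The part now avoids both colors and counts at most N; each side has at most 2n <= N vertices,
    the last inequality because there is a third color. *)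
Lemma both_sides a : bounded (K :\ r :\ b) -> 2 < #|K| -> a \in A -> n < #|part a| ->
    (forall x, x \in A -> f x != f a -> #|part x| <= n) ->
    n < #|side a r :|: X r| -> n < #|side a b :|: X b| ->
  #|A| + \sum_(i in K) #|X i| <= n * 2 ^ #|K|.
Proof.
move=> bounded_rb K3 aA large_a small large_r large_b.
have [Xr0 no_r] := side_attached rK aA large_r (ltnW large_a).
have [Xb0 no_b] := side_attached bK aA large_b (ltnW large_a).
have := bound_drop_rb bounded_rb (part_sub a) (part_absent rK aA large_a large_r)
  (part_absent bK aA large_a large_b).
have := side_small aA small f_mono no_r.
have f_mono' x y : x \in A -> y \in A -> f x != f y -> mono b x y \/ mono r x y.
  by move=> xA yA /(f_mono xA yA)[]; [right|left].
have := side_small aA small f_mono' no_b.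
have := card_sides aA; rewrite sumX Xr0 Xb0 cards0.
have : 2 * n <= N.
  rewrite /N mulnC leq_mul2l -[X in X <= _]expn1 leq_exp2l // orbC.
  by rewrite -ltnS -ltnS -card_K K3.
by case: pows => -> _ _; clear; lia.
Qed.

(** * Two parts with more than n vertices, joined in color r *)

Section TwoLarge.

Variables a a' : V.
Hypotheses (aA : a \in A) (a'A : a' \in A) (faa' : f a != f a') (caa' : c a a' = r).
Hypotheses (large_a : n < #|part a|) (large_a' : n < #|part a'|).
Hypotheses (bounded_r : bounded (K :\ r)) (bounded_b : bounded (K :\ b)).
Hypothesis bounded_rb : bounded (K :\ r :\ b).

Let Q i j := [set y in side a i | (f y != f a') && (c y a' == j)].

Let QP i j y : y \in Q i j -> [/\ y \in A, y \in side a i & y \in side a' j].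
Proof. by rewrite !in_set => /andP[/and3P[-> -> ->] /andP[-> ->]]. Qed.

Let in_part x y : y \in part x -> y \in A /\ f y = f x.
Proof. by rewrite in_set => /andP[-> /eqP]. Qed.

Let parts_joined : joined r (part a) (part a').
Proof.
move=> s l /in_part[sA fs] /in_part[lA fl]; rewrite /mono.
rewrite (part_color sA aA lA a'A) ?fs ?fl // caa' eqxx andbT.
by apply: contraNneq faa' => sl; rewrite -fs -fl sl.
Qed.

(** Such an [x] could be added to [part a'], which stays joined to [part a] in color [r] but now
    contains an edge of that color. *)
Let not_red_both x : joined r [set x] (part a) -> joined r [set x] (part a') -> False.
Proof.
move=> xa xa'.
have j : joined r (part a) (part a' :|: [set x]).
  move=> s l sL /setUP[lL|/set1P->]; first exact: parts_joined.
  by rewrite mono_sym; apply: xa; rewrite ?set11.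
have := joined_absent j (ltnW large_a).
have large : n < #|part a' :|: [set x]| by apply: leq_trans large_a' (subset_leq_card (subsetUl _ _)).
move/(_ large x a'); rewrite !in_setU set11 orbT in_set a'A eqxx /= => /(_ isT isT)/negP; apply.
by apply: xa'; rewrite ?set11 // in_set a'A eqxx.
Qed.

Let joined1 i x S L : joined i S L -> x \in S -> joined i [set x] L.
Proof. by move=> SL xS s l /set1P-> lL; apply: SL. Qed.

Let Qrr0 : Q r r = set0.
Proof.
apply/eqP/set0Pn => -[x /QP[xA xa xa']].
exact: (not_red_both (joined1 (side_joined aA) xa) (joined1 (side_joined a'A) xa')).
Qed.

Let Xr0 : X r = set0.
Proof.
apply/eqP/set0Pn => -[x xX]; apply: (@not_red_both x) => s l /set1P-> /in_part[lA _];
exact: XA.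
Qed.

Let M := part a :|: Q b r.
Let M' := part a' :|: Q r b.

Let A_cover : A \subset M :|: (M' :|: Q b b).
Proof.
apply/subsetP => y yA; rewrite !in_setU ![y \in part _]in_set yA /=.
have [//|fya] := eqVneq (f y) (f a); have [|fya'] := eqVneq (f y) (f a'); first by rewrite orbT.
have Qin i j : c y a = i -> c y a' = j -> y \in Q i j.
  by move=> ci cj; rewrite !in_set yA fya fya' ci cj !eqxx.
by case: (f_rb yA aA fya) => ca; case: (f_rb yA a'A fya') => ca';
  have := Qin _ _ ca ca'; rewrite ?Qrr0 ?in_set0 // => ->; rewrite ?orbT.
Qed.

Let M_absent : forall x y, x \in M -> y \in M -> ~~ mono r x y.
Proof.
have j : joined r (part a') M.
  move=> s l sP /setUP[lP|/QP[_ _ l']]; first by rewrite mono_sym; apply: parts_joined.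
  by rewrite mono_sym; apply: (side_joined a'A l' sP).
by apply: joined_absent j (ltnW large_a') _; apply: leq_trans large_a (subset_leq_card (subsetUl _ _)).
Qed.

Let M'_absent : forall x y, x \in M' -> y \in M' -> ~~ mono r x y.
Proof.
have j : joined r (part a) M'.
  move=> s l sP /setUP[lP|/QP[_ l' _]]; first exact: parts_joined.
  by rewrite mono_sym; apply: (side_joined aA l' sP).
by apply: joined_absent j (ltnW large_a) _; apply: leq_trans large_a' (subset_leq_card (subsetUl _ _)).
Qed.

Let S := Q b r :|: Q b b :|: X b.
Let S' := Q r b :|: Q b b :|: X b.

Let Sj : joined b S (part a).
Proof.
move=> s l /setUP[/setUP[]/QP[_ sa _]|sX] lP; try exact: (side_joined aA sa lP).
by apply: XA sX _ => //; case: (in_part lP).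
Qed.

Let S'j : joined b S' (part a').
Proof.
move=> s l /setUP[/setUP[]/QP[_ _ sa]|sX] lP; try exact: (side_joined a'A sa lP).
by apply: XA sX _ => //; case: (in_part lP).
Qed.

Let card_A : #|A| <= #|M| + (#|M'| + #|Q b b|).
Proof.
apply: leq_trans (subset_leq_card A_cover) _; apply: leq_trans (leq_card_setU _ _) _.
by rewrite leq_add2l leq_card_setU.
Qed.

Let Q_sub i j : Q i j \subset A.
Proof. by apply/subsetP => x /QP[]. Qed.

Let Q_disj i j k l : (i, j) != (k, l) -> Q i j :&: Q k l = set0.
Proof.
move=> ne; apply/setP => x; rewrite in_setI in_set0; apply/negP => /andP[].
rewrite !in_set => /andP[/and3P[_ _ /eqP ci] /andP[_ /eqP cj]].
move=> /andP[/and3P[_ _ /eqP ck] /andP[_ /eqP cl]].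
by case/negP: ne; rewrite -ci -cj ck cl.
Qed.

Let X_disj : (forall i j, Q i j :&: X b = set0).
Proof.
move=> i j; apply/setP => x; rewrite in_setI in_set0; apply/negP => /andP[/QP[xA _ _]].
by move/(X_disjoint bK); rewrite xA.
Qed.

Let card_S : #|S| = #|Q b r| + #|Q b b| + #|X b|.
Proof.
rewrite /S cardsU setIUl !X_disj setU0 cards0 subn0 cardsU Q_disj ?cards0 ?subn0 //.
by rewrite xpair_eqE eqxx.
Qed.

Let card_S' : #|S'| = #|Q r b| + #|Q b b| + #|X b|.
Proof.
rewrite /S' cardsU setIUl !X_disj setU0 cards0 subn0 cardsU Q_disj ?cards0 ?subn0 //.
by rewrite xpair_eqE (negbTE rb).
Qed.

Let card_M : #|M| <= #|part a| + #|Q b r|.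
Proof. exact: leq_card_setU. Qed.

Let card_M' : #|M'| <= #|part a'| + #|Q r b|.
Proof. exact: leq_card_setU. Qed.

Let sub_colors (L : {set V}) : L \subset A ->
  forall x y, x \in L -> y \in L -> x != y -> c x y \in K.
Proof. by move=> /subsetP LA x y /LA xA /LA; apply: cK. Qed.

Let M_bound : #|M| <= n * 2 ^ #|K :\ r|.
Proof.
apply: bounded0 bounded_r _; apply: color_setD1 M_absent; apply: sub_colors.
by rewrite subUset part_sub Q_sub.
Qed.

Let M'_bound : #|M'| <= n * 2 ^ #|K :\ r|.
Proof.
apply: bounded0 bounded_r _; apply: color_setD1 M'_absent; apply: sub_colors.
by rewrite subUset part_sub Q_sub.
Qed.

Let absent_sub i (L L' : {set V}) : L' \subset L ->
  (forall x y, x \in L -> y \in L -> ~~ mono i x y) ->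
  forall x y, x \in L' -> y \in L' -> ~~ mono i x y.
Proof. by move=> /subsetP sub h x y /sub xL /sub; apply: h. Qed.

Let rest_rb (L : {set V}) : L \subset A ->
    (forall x y, x \in L -> y \in L -> ~~ mono r x y) ->
    (forall x y, x \in L -> y \in L -> ~~ mono b x y) ->
  #|L| <= N.
Proof.
move=> LA no_r no_b; apply: leq_trans (leq_addr rest _) _.
exact: bound_drop_rb bounded_rb LA no_r no_b.
Qed.

(** The pentagon s, u, [part a], [part a'], u' is inflated by alternating between the two parts:
    [s], [u], [a], [u'], then n - 1 vertices of [part a'] linked by n - 2 of [part a], make 2n +
    1. *)
Let no_red_pentagon s u u' : u \in side a r -> u' \in side a' r ->
  s \notin part a :|: part a' -> u \notin part a' -> u' \notin part a -> u != u' ->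
  mono r s u -> mono r s u' -> False.
Proof.
move=> ua u'a' sP uP' u'P uu' su su'.
have n4 : 3 < n by case: n45 => ->.
have aP : a \in part a by rewrite in_set aA eqxx.
have uNa x : x \in side a r -> x \notin part a.
  by rewrite !in_set => /and3P[_ /negbTE-> _]; rewrite andbF.
have u'Na' : u' \notin part a' by move: u'a'; rewrite !in_set => /and3P[_ /negbTE-> _]; rewrite andbF.
have [os [uos szos osP]] := sub_seq_card (leq_trans (leq_pred _) (ltnW large_a') : n.-1 <= #|part a'|).
case: os uos szos osP => [|x os] uos szos osP; first by move: szos n4; rewrite /=; clear; lia.
have lnk : linkable (mono r) (mem (part a :\ a)) #|part a :\ a| (mem (x :: os)).
  apply: linkable_complete; first exact: mono_sym.
  by move=> y z /setD1P[_ yP] /osP; apply: parts_joined.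
have [||z [ls [pz lz perm_z szl [uls lsP _]]]] := @link_path _ _ _ _ os x (size os) [::] lnk uos.
- by rewrite gaps_size leqnn.
- move: large_a szos; rewrite (cardsD1 a (part a)) aP /=; clear; lia.
have lsQ y : y \in ls -> y != a /\ y \in part a by move/(allP lsP) => /setD1P[].
pose w := [:: s, u, a, x & rcons z u'].
have perm_w : perm_eq w ([:: s; u; a; u'] ++ (x :: os) ++ ls).
  rewrite /w /= !perm_cons -rcons_cons perm_rcons perm_cons perm_cons.
  exact: perm_z.
have disj y : y \in part a -> y \notin part a'.
  rewrite !in_set => /andP[_ /eqP->]; by rewrite (negbTE faa') andbF.
have neP (D : {set V}) y y' : y \in D -> y' \notin D -> y != y'.
  by move=> yD; apply: contraNneq => <-.
have [sP1 sP2] : s \notin part a /\ s \notin part a'.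
  by move: sP; rewrite in_setU negb_or => /andP[].
have neqm y y' : mono r y y' -> y != y' by case/andP.
have uw : uniq w.
  rewrite (perm_uniq perm_w) cat_uniq; apply/and3P; split.
  - have [? ?] := (neqm _ _ su, neqm _ _ su').
    have [? [? ?]] := (neP _ _ _ aP sP1, (neP _ _ _ aP (uNa u ua), neP _ _ _ aP u'P)).
    by uniq_tac.
  - apply/hasPn => y; rewrite mem_cat => /orP[/osP yP|/lsQ[ya yP]].
      have [? [? ?]] := (neP _ _ _ yP sP2, (neP _ _ _ yP uP', neP _ _ _ yP u'Na')).
      have yNa : y != a by rewrite eq_sym; apply: (neP _ _ _ aP); apply: contraL yP; apply: disj.
      by uniq_tac.
    have [? [? ?]] := (neP _ _ _ yP sP1, (neP _ _ _ yP (uNa u ua), neP _ _ _ yP u'P)).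
    by uniq_tac.
  - rewrite cat_uniq uos uls andbT; apply/hasPn => y /lsQ[_ /disj yP].
    by apply: contra yP => /osP.
have szw : size w = n.*2.+1.
  rewrite /w /= size_rcons (perm_size perm_z) size_cat szl.
  by move: szos n4; rewrite /=; clear; lia.
have := no_mono r uw szw; apply/negP; rewrite negbK /w /= su.
rewrite (side_joined aA ua aP) (parts_joined aP (osP x (mem_head _ _))) /=.
rewrite !rcons_path pz last_rcons lz (mono_sym r u') su' andbT /=.
by rewrite mono_sym; apply: (side_joined a'A u'a'); apply: osP; apply: mem_last.
Qed.

Lemma two_large : #|A| + \sum_(i in K) #|X i| <= n * 2 ^ #|K|.
Proof.
have part_M : part a \subset M := subsetUl _ _.
have part_M' : part a' \subset M' := subsetUl _ _.
have no_ra := absent_sub part_M M_absent.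
have no_ra' := absent_sub part_M' M'_absent.
rewrite sumX Xr0 cards0 add0n; have [powK powr powb] := pows.
(* A small [S] is counted as the attached set of [part a] in color [b], for at most 2N; the rest of
   [A] lies in [M'], which avoids [r] and has at most 2N. *)
have [smallS|largeS] := leqP #|S| n.
  have := bound_drop_r bounded_r (part_sub a) no_ra Sj smallS.
  move: card_A card_M M'_bound; rewrite card_S powK powr; clear; lia.
have [smallS'|largeS'] := leqP #|S'| n.
  have := bound_drop_r bounded_r (part_sub a') no_ra' S'j smallS'.
  move: card_A card_M' M_bound; rewrite card_S' powK powr; clear; lia.
have no_ba := joined_absent Sj (ltnW largeS) large_a.
have no_ba' := joined_absent S'j (ltnW largeS') large_a'.
have no_bS := joined_absent (joined_sym Sj) (ltnW large_a) largeS.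
have no_bS' := joined_absent (joined_sym S'j) (ltnW large_a') largeS'.
have bound_a := bound_drop_rb bounded_rb (part_sub a) no_ra no_ba.
have bound_a' := rest_rb (part_sub a') no_ra' no_ba'.
rewrite -/N in bound_a.
have Xb0 : X b = set0.
  apply/eqP/set0Pn => -[x xX].
  have empty : Q b r :|: Q b b = set0.
    apply/eqP/set0Pn => -[y yQ].
    have yA : y \in A by case/setUP: yQ => /QP[].
    have := no_bS x y; rewrite !(in_setU x) xX orbT !(in_setU y) -in_setU yQ => /(_ isT isT).
    by rewrite XA.
  by move: largeS; rewrite /S empty set0U ltnNge Xn.
have [cS cS'] := (card_S, card_S'); rewrite Xb0 cards0 addn0 in cS cS'.
rewrite Xb0 cards0 add0n.
have S_bound (L : {set V}) : L \subset A -> (forall x y, x \in L -> y \in L -> ~~ mono b x y) ->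
    #|L| <= 2 * N.
  by move=> LA no_b; rewrite -powb; apply: bounded0 bounded_b _; apply: color_setD1 no_b; apply: sub_colors.
have SA : S \subset A by rewrite /S Xb0 setU0 subUset !Q_sub.
have S'A : S' \subset A by rewrite /S' Xb0 setU0 subUset !Q_sub.
have := S_bound S SA no_bS; have := S_bound S' S'A no_bS'; rewrite cS cS' => bS' bS.
have sub1 : Q b r \subset S by rewrite /S -setUA subsetUl.
have sub2 : Q r b \subset S' by rewrite /S' -setUA subsetUl.
have sub3 : Q b r \subset M := subsetUr _ _.
have sub4 : Q r b \subset M' := subsetUr _ _.
have bQ := rest_rb (Q_sub b r) (absent_sub sub3 M_absent) (absent_sub sub1 no_bS).
have bQ' := rest_rb (Q_sub r b) (absent_sub sub4 M'_absent) (absent_sub sub2 no_bS').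
(* If one of the three sets [Q] is empty, the bounds N and 2N for the remaining pieces add up to 4N.
   Otherwise pick a vertex in each: [b] is absent from [S] and [S'], so [s] is joined to [u] and
   [u'] in color [r] and the pentagon appears. *)
have [Qbb0|[s sQ]] := set_0Vmem (Q b b).
  by move: card_A card_M card_M' bound_a bound_a' bQ bQ'; rewrite Qbb0 cards0 powK; clear; lia.
have [Qrb0|[u uQ]] := set_0Vmem (Q r b).
  by move: card_A card_M card_M' bound_a bound_a' bS; rewrite Qrb0 cards0 powK; clear; lia.
have [Qbr0|[u' u'Q]] := set_0Vmem (Q b r).
  by move: card_A card_M card_M' bound_a bound_a' bS'; rewrite Qbr0 cards0 powK; clear; lia.
have ne x y k l x' : c x x' = k -> c y x' = l -> k != l -> x' \in A -> x \in A -> y \in A -> f x != f x' -> f x != f y.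
  move=> ck cl kl x'A xA yA fxx'; apply: contra_neq kl => fxy.
  by rewrite -ck -cl; apply: f_mod.
have QP' i j y : y \in Q i j -> [/\ f y != f a, f y != f a', c y a = i & c y a' = j].
  by rewrite !in_set => /andP[/and3P[_ -> /eqP->] /andP[-> /eqP->]].
have [[sA sa sa'] [uA ua ua'] [u'A u'a u'a']] := And3 (QP sQ) (QP uQ) (QP u'Q).
have [[fsa fsa' csa csa'] [fua fua' cua cua'] [fu'a fu'a' cu'a cu'a']] :=
  And3 (QP' _ _ _ sQ) (QP' _ _ _ uQ) (QP' _ _ _ u'Q).
have br : b != r by rewrite eq_sym.
have fsu : f s != f u by apply: (ne s u b r a).
have fsu' : f s != f u' by apply: (ne s u' b r a').
have su : mono r s u.
  have [//|h] := f_mono sA uA fsu.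
  have [sS uS] : s \in S' /\ u \in S' by rewrite /S' !in_setU sQ uQ orbT.
  by have := no_bS' s u sS uS; rewrite h.
have su' : mono r s u'.
  have [//|h] := f_mono sA u'A fsu'.
  have [sS uS] : s \in S /\ u' \in S by rewrite /S !in_setU sQ u'Q orbT.
  by have := no_bS s u' sS uS; rewrite h.
have nin x y : f x != f y -> x \notin part y by rewrite in_set => /negbTE->; rewrite andbF.
exfalso; apply: (no_red_pentagon ua u'a' _ _ _ _ su su'); rewrite ?nin //.
  by rewrite in_setU negb_or !nin.
by apply: contraNneq rb => uu'; rewrite -cua uu' cu'a.
Qed.

End TwoLarge.

(** The set [W] is at most [d] short of the [n] vertices needed to exclude [i]. A packing of d + 1
    three-vertex paths compensates for this: n + d + 1 vertices of the side then need only n - d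
    links. Without a packing, deleting 3d vertices leaves degree at most one in color [i], so in
    color [j] a vertex misses at most |part a| + 1 <= n vertices. *)
Lemma side_packed a i j : i \in K -> a \in A -> 2 < #|part a| <= n ->
    (forall x, x \in A -> #|part x| <= #|part a|) ->
    (forall x y, x \in A -> y \in A -> f x != f y -> mono i x y \/ mono j x y) ->
  #|side a i| <= n.*2 + 3 * (n - #|part a| - #|X i|).
Proof.
move=> iK aA /andP[t3 tn] part_max fij.
set d := n - #|part a| - #|X i|.
have [|largeS] := leqP #|side a i| n.*2; first by move/leq_trans; apply; apply: leq_addr.
pose W := part a :|: X i.
have Wj : joined i W (side a i).
  move=> s l /setUP[sP|sX] lS; first by rewrite mono_sym; apply: side_joined lS sP.
  by apply: XA sX _ => //; move: lS; rewrite in_set => /andP[].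
have cW : #|W| = #|part a| + #|X i|.
  rewrite cardsU (_ : _ :&: _ = set0) ?cards0 ?subn0 //.
  apply/setP => x; rewrite in_setI in_set0; apply/negP => /andP[xS xX].
  by case/negP: (X_disjoint iK xX); apply: (subsetP (part_sub a)).
have part_n x : x \in A -> #|part x| <= n by move=> xA; apply: leq_trans (part_max x xA) tn.
have [d0|d0] := posnP d.
  have Wn : n <= #|W| by rewrite cW; move: d0; rewrite /d; clear; lia.
  have no_i := joined_absent Wj Wn (leq_trans _ largeS).
  rewrite d0 addn0; apply: (side_small aA _ fij).
    by move=> x xA _; apply: part_n.
  by apply: no_i; rewrite ltnS -addnn leq_addr.
have [n4 n5] : 3 < n /\ n <= 5 by case: n45 => ->.
have [[x [os [uos osS szos gos]]]|[D cD noD]] :=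
    cherry_pack d (side a i) (mono_irr i) (mono_sym i).
  exfalso; have qW : n - d <= #|W| by rewrite cW /d; clear; lia.
  have [small|large] := leqP (3 * d.+1) (n + d.+1).
    have [|p [up pS szp]] := @pad_seq _ (side a i) (x :: os) (n + d.+1) uos osS.
      by rewrite szos small /=; move: largeS; rewrite /d; move: t3 n4; clear; lia.
    rewrite szos in szp; rewrite [size _]/= in szos.
    have szop : (size (os ++ p)).+1 = n + d.+1 by rewrite size_cat szp -addSn szos subnKC.
    apply: (@no_join i W (side a i) x (os ++ p) (n - d) Wj) => //.
    - by move: szop n4; clear; lia.
    - rewrite gaps_cat szop; have := gaps_size (mono i) (last x os) p.
      rewrite szp; move: gos d0 t3 n4 small; rewrite /d; clear; lia.
    - by rewrite szop; move: d0; rewrite /d; clear; lia.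
  (* The packing is too long only for n = 5 and d = 2; cutting its nine vertices to eight keeps at
     most two gaps, below the three links available. *)
  have sz_take : size (take (n + d) os) = n + d.
    by apply: size_takel; move: szos large => /=; clear; lia.
  apply: (@no_join i W (side a i) x (take (n + d) os) (n - d) Wj) => //.
  - by move: uos => /= /andP[xos uos]; rewrite take_uniq // andbT; apply: contra xos; apply: mem_take.
  - by move=> y; rewrite in_cons => /predU1P[->|/mem_take yos]; apply: osS; rewrite ?mem_head // in_cons yos orbT.
  - by rewrite sz_take; move: n4; clear; lia.
  - rewrite sz_take; apply/andP; split; last by clear; lia.
    apply: leq_ltn_trans (gaps_take _ _ _ _) _; apply: leq_ltn_trans gos _.
    by rewrite /d; move: t3 n4 n5 d0; rewrite /d; clear; lia.
  - by rewrite sz_take; move: d0; rewrite /d; clear; lia.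
have : #|side a i :\: D| <= n.*2.
  apply: (@dense_small j) => x xS.
  have xA : x \in A by move: xS; rewrite in_setD in_set => /andP[_ /andP[]].
  have sub : [set y in side a i :\: D | ~~ mono j x y] \subset
      part x :|: [set y in side a i :\: D | mono i x y].
    apply/subsetP => y; rewrite [y \in _]in_set => /andP[yS nxy].
    have yA : y \in A by move: yS; rewrite in_setD in_set => /andP[_ /andP[]].
    apply/setUP; have [fyx|fyx] := eqVneq (f y) (f x); first by left; rewrite in_set yA fyx eqxx.
    right; rewrite in_set yS /=.
    rewrite eq_sym in fyx; have [//|h] := fij x y xA yA fyx.
    by rewrite h in nxy.
  apply: leq_trans (subset_leq_card sub) _; apply: leq_trans (leq_card_setU _ _) _.
  have : #|[set y in side a i :\: D | mono i x y]| <= 1.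
    apply/card_le1_eqP => y z; rewrite in_set => /andP[yS xy]; rewrite in_set => /andP[zS xz].
    exact: (noD x z y).
  move: (part_max x xA) d0; rewrite /d; clear; lia.
have := cardsD (side a i) D; have := subset_leq_card (subsetIr (side a i) D).
by move: cD; clear; lia.
Qed.

(** The sum of the bounds is convex in |X r| and in |X b|, so only the extreme sizes matter. The
    tightest case is n = 5 with a largest part of three vertices and both sets empty: 35 against
    36. *)
Lemma small_parts a : 2 < #|K| -> a \in A -> 2 < #|part a| <= n ->
    (forall x, x \in A -> #|part x| <= #|part a|) ->
    #|X r| < n -> #|X b| < n ->
  #|A| + (#|X r| + #|X b|) <= 7 * n + 1.
Proof.
move=> K3 aA tn part_max xr xb.
have f_mono' x y : x \in A -> y \in A -> f x != f y -> mono b x y \/ mono r x y.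
  by move=> xA yA /(f_mono xA yA)[]; [right|left].
have := side_packed rK aA tn part_max f_mono.
have := side_packed bK aA tn part_max f_mono'.
have := card_sides aA; move: tn xr xb.
by case: n45 => ->; clear; lia.
Qed.

(* To obtain a complete 2-colored structure, the edges meeting [X r] are filled with color r
   and those inside [X b] with color b; [unfill_cycle] shows that this is harmless. *)
Section Filling.

Hypothesis largeA : n.*2.+1 <= #|A|.

Let T : eqType := (V * bool)%type.
(** The Boolean tag makes every vertex outside [A] a part of its own, distinct from the parts of
    [A]. *)
Let f' x : T := if x \in A then (f x, true) else (x, false).
Let g x y := if (x \in A) && (y \in A) then c x y == r else (x \in X r) || (y \in X r).
Let B := A :|: (X r :|: X b).

Let g_sym : symmetric g.
Proof. by move=> x y; rewrite /g andbC c_sym orbC. Qed.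

Let f'_A x : x \in A -> f' x = (f x, true).
Proof. by rewrite /f' => ->. Qed.

Let f'_X x : x \notin A -> f' x = (x, false).
Proof. by rewrite /f' => /negbTE->. Qed.

Let A0 : exists a, a \in A.
Proof. by apply/set0Pn; rewrite -card_gt0; apply: leq_trans largeA. Qed.

Let Xrb x : x \in X r -> x \in X b -> False.
Proof.
move=> xr xb; have [a aA] := A0; have := XA rK xr aA; have := XA bK xb aA.
by move=> /andP[_ /eqP cb] /andP[_]; rewrite cb eq_sym (negbTE rb).
Qed.

Let XrA x : x \in X r -> x \notin A.
Proof. exact: X_disjoint. Qed.

Let XbA x : x \in X b -> x \notin A.
Proof. exact: X_disjoint. Qed.

Let g_mod x y z : x \in B -> y \in B -> z \in B -> f' x = f' y -> f' x != f' z -> g x z = g y z.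
Proof.
move=> _ _ _; rewrite /f' /g.
have AXr v : v \in A -> v \in X r = false by move=> vA; apply/negP => /XrA; rewrite vA.
case: (boolP (x \in A)) => xA; case: (boolP (y \in A)) => yA; last 1 first.
- by case=> ->.
- case=> fxy; case: (boolP (z \in A)) => zA /=; last by rewrite (AXr x xA) (AXr y yA).
  by rewrite xpair_eqE eqxx andbT => fxz; rewrite (f_mod xA yA zA fxy fxz).
- by case.
- by case.
Qed.

Let cB : #|B| = #|A| + (#|X r| + #|X b|).
Proof.
rewrite /B !cardsU (_ : X r :&: X b = set0); last first.
  apply/setP => x; rewrite in_setI in_set0; apply/negP => /andP[]; exact: Xrb.
rewrite (_ : A :&: _ = set0) ?cards0 ?subn0 //.
apply/setP => x; rewrite in_setI in_set0 in_setU; apply/negP => /andP[xA].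
by case/orP=> [/XrA|/XbA]; rewrite xA.
Qed.

Let real_edge d x y : x \in A -> y \in A -> bicolor f' g d x y -> mono (if d then r else b) x y.
Proof.
move=> xA yA; rewrite /bicolor !f'_A // xpair_eqE eqxx andbT /g xA yA => /andP[fxy].
have xy : x != y by apply: contraNneq fxy => ->.
rewrite /mono xy /=; case: d => [/eqP-> //|/eqP/negbT ncr].
by case: (f_rb xA yA fxy) ncr => ->; rewrite eqxx.
Qed.

(** All filled edges at [X r] have color [r], so the cycle avoids [X r] and its only invented edges
    lie inside [X b], a minority of its vertices. *)
Let no_blue_filled z : uniq z -> size z = n.*2.+1 -> {subset z <= B} ->
  cycle (bicolor f' g false) z -> False.
Proof.
move=> uz szz zB cz.
have noXr x : x \in z -> x \notin X r.
  move=> xz; apply/negP => xr; have := next_cycle cz xz.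
  by rewrite /bicolor /g (negbTE (XrA xr)) xr andbF.
have zAX x : x \in z -> x \notin X b -> x \in A.
  by move=> xz xb; have := zB x xz; rewrite !in_setU (negbTE (noXr x xz)) (negbTE xb) !orbF.
have [|||z' [uz' cz' szz' _]] := @unfill_cycle _ (bicolor f' g false) (mono b) (X b) z (mono_sym b) uz cz.
- by move=> x y xz yz xb yb; apply: (real_edge (d := false)); apply: zAX.
- by move=> x y xz yz xb yb; apply: XA; rewrite ?zAX.
- rewrite szz; have : count (mem (X b)) z <= #|X b| by apply: count_le_card.
  by move: (Xn bK); clear; lia.
by have := no_mono b uz'; rewrite szz' cz' => /(_ szz).
Qed.

Let no_red_filled z : uniq z -> size z = n.*2.+1 -> {subset z <= B} ->
  cycle (bicolor f' g true) z -> False.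
Proof.
move=> uz szz zB cz.
pose zb := filter (mem (X b)) z.
have [fresh [ufr szfr frP]] : exists s, [/\ uniq s, size s = size zb & {subset s <= A :\: [set x in z]}].
  apply: sub_seq_card; rewrite cardsD.
  have sub : A :&: [set x in z] \subset [set x in filter (predC (mem (X b))) z].
    apply/subsetP => x; rewrite !in_set mem_filter => /andP[xA ->].
    by rewrite /= andbT; apply/negP => /XbA; rewrite xA.
  have cF : #|[set x in filter (predC (mem (X b))) z]| = size (filter (predC (mem (X b))) z).
    by rewrite cardsE; apply/card_uniqP/filter_uniq.
  have := subset_leq_card sub; rewrite cF size_filter.
  have := count_predC (mem (X b)) z; rewrite szz /zb size_filter; move: largeA.
  by clear; flia.
pose h x := if x \in X b then nth x fresh (index x zb) else x.
have hX x : x \in z -> x \in X b -> h x \in fresh /\ h x \in A.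
  move=> xz xb; rewrite /h xb; have xzb : x \in zb by rewrite mem_filter /= xb xz.
  have hfr : nth x fresh (index x zb) \in fresh by rewrite mem_nth // szfr index_mem.
  by split=> //; have := frP _ hfr; rewrite in_setD => /andP[].
have hid x : x \notin X b -> h x = x by rewrite /h => /negbTE->.
have h_inj : {in z &, injective h}.
  move=> x y xz yz; have [xb|xb] := boolP (x \in X b); have [yb|yb] := boolP (y \in X b).
  - have xzb : x \in zb by rewrite mem_filter /= xb xz.
    have yzb : y \in zb by rewrite mem_filter /= yb yz.
    rewrite /h xb yb (set_nth_default y) ?szfr ?index_mem // => /eqP.
    rewrite nth_uniq ?szfr ?index_mem // => /eqP ixy.
    by rewrite -(nth_index x xzb) ixy nth_index.
  - rewrite (hid y yb) => hxy; have [/frP] := hX x xz xb; rewrite hxy in_setD in_set yz.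
    by [].
  - rewrite (hid x xb) => hxy; have [/frP] := hX y yz yb; rewrite -hxy in_setD in_set xz.
    by [].
  - by rewrite (hid x xb) (hid y yb).
pose z1 := map h z.
have uz1 : uniq z1 by rewrite map_inj_in_uniq.
have z1P y : y \in z1 -> y \in A \/ y \in X r.
  case/mapP=> x xz ->; have [xb|xb] := boolP (x \in X b); first by left; case: (hX x xz xb).
  rewrite (hid x xb); have := zB x xz; rewrite !in_setU (negbTE xb) orbF.
  by move/orP.
have toXr x y : x \in X b -> bicolor f' g true x y -> y \in X r.
  move=> xb /andP[_]; rewrite /g (negbTE (XbA xb)) /=.
  have -> : x \in X r = false by apply/negP => xr; apply: Xrb xr xb.
  by move/eqP.
have Xr_edge x y : x \in A -> y \in X r -> bicolor f' g true x y.
  move=> xA yr; rewrite /bicolor f'_A // (f'_X (XrA yr)) xpair_eqE andbF /g.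
  by rewrite (negbTE (XrA yr)) andbF yr orbT.
have bsym : symmetric (bicolor f' g true) by apply: bicolor_sym.
have cz1 : cycle (bicolor f' g true) z1.
  rewrite /z1.
  have hom x y : x \in z -> y \in z -> bicolor f' g true x y -> bicolor f' g true (h x) (h y).
    move=> xz yz xy; have [xb|xb] := boolP (x \in X b).
      have yr := toXr x y xb xy; rewrite (hid y); last by apply/negP; apply: Xrb yr.
      by apply: Xr_edge yr; case: (hX x xz xb).
    rewrite (hid x xb); have [yb|yb] := boolP (y \in X b); last by rewrite hid.
    rewrite bsym in xy; have xr := toXr y x yb xy.
    by rewrite bsym; apply: Xr_edge xr; case: (hX y yz yb).
  have : cycle (relpre h (bicolor f' g true)) z.
    apply: (@sub_in_cycle _ [in z] (bicolor f' g true)) cz; last exact/allP.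
    by move=> x y; apply: hom.
  by case: (z) => //= x s; rewrite -map_rcons path_map.
have [|||z' [uz' cz' szz' _]] := @unfill_cycle _ (bicolor f' g true) (mono r) (X r) z1 (mono_sym r) uz1 cz1.
- move=> x y /z1P xP /z1P yP xr yr; apply: (real_edge (d := true)).
    by case: xP => // xr'; rewrite xr' in xr.
  by case: yP => // yr'; rewrite yr' in yr.
- move=> x y /z1P xP /z1P yP xr yr; apply: XA => //.
  by case: yP => // yr'; rewrite yr' in yr.
- rewrite size_map szz; have : count (mem (X r)) z1 <= #|X r| by apply: count_le_card.
  by move: (Xn rK); clear; lia.
by have := no_mono r uz'; rewrite szz' size_map cz' => /(_ szz).
Qed.

Lemma tiny_parts :
    {in A &, injective f} /\ 4 * n < #|A| + (#|X r| + #|X b|) \/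
    (forall x, x \in A -> #|part x| <= 2) /\ 7 * n + 2 <= #|A| + (#|X r| + #|X b|) -> False.
Proof.
move=> sizes.
have sizes' : {in B &, injective f'} /\ 4 * n < #|B| \/
    (forall x, x \in B -> #|[set y in B | f' y == f' x]| <= 2) /\ 7 * n + 2 <= #|B|.
  rewrite cB; case: sizes => [[f_inj large]|[part2 large]]; [left|right]; split=> // x.
    by move=> y _ _; rewrite /f'; case: ifP => xA; case: ifP => yA; case=> //; apply: f_inj.
  move=> _; have [xA|xA] := boolP (x \in A).
    apply: leq_trans (part2 x xA); apply: subset_leq_card; apply/subsetP => y.
    rewrite in_set (f'_A xA) => /andP[_]; rewrite in_set; case: (boolP (y \in A)) => yA.
      by rewrite (f'_A yA) xpair_eqE andbT.
    by rewrite (f'_X yA) xpair_eqE andbF.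
  rewrite -(cards1 x) ltnW // ltnS; apply: subset_leq_card; apply/subsetP => y.
  rewrite in_set (f'_X xA) => /andP[_]; rewrite in_set1; case: (boolP (y \in A)) => yA.
    by rewrite (f'_A yA) xpair_eqE andbF.
  by rewrite (f'_X yA) xpair_eqE andbT.
have [[] [z [uz szz zB cz]]] := two_colored_blowup g_sym n45 g_mod sizes'.
  exact: (no_red_filled uz szz zB cz).
exact: (no_blue_filled uz szz zB cz).
Qed.

End Filling.

End Colors.

End Partition.

End Bound.

(** * The Gallai-Ramsey bounds *)

Section Main.

Variables (V C : finType) (c : V -> V -> C) (n : nat).
Hypothesis c_sym : forall x y, c x y = c y x.
Hypothesis n45 : n = 4 \/ n = 5.
Hypothesis no_mono : forall i s, uniq s -> size s = n.*2.+1 -> ~~ cycle (mono c i) s.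
Hypothesis c_gallai : forall x y z, x != y -> y != z -> x != z ->
  [|| c x y == c y z, c y z == c x z | c x y == c x z].

(** Equality holds for k = 3, which is where the threshold 7n + 2 comes from. *)
Let pow_lower k : 2 < k -> 7 * n + 1 + (k - 2) * n.-1 <= n * 2 ^ k.
Proof.
case: k => [|[|[|k]]] // _; rewrite !expnS.
have : k < 2 ^ k by apply: ltn_expl.
by rewrite -[k.+3 - 2]/k.+1; case: n45 => ->; rewrite [_.-1]/=; clear; lia.
Qed.

Let bound_one_color i (K : {set C}) (A : {set V}) X : K = [set i] -> config c n K A X ->
  #|A| + #|X i| <= n.*2.
Proof.
move=> defK [cK XA Xn]; have iK : i \in K by rewrite defK set11.
have disj : A :&: X i = set0.
  apply/setP => x; rewrite in_setI in_set0; apply/negP => /andP[xA xX].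
  by have := XA i iK x x xX xA; rewrite mono_irr.
have := cardsU A (X i); rewrite disj cards0 subn0 => <-.
apply: (dense_small c_sym no_mono (i := i)) => x xAX.
have n1 : 0 < n by case: n45 => ->.
have edge y : x \in A -> y \in A :|: X i -> y != x -> mono c i x y.
  move=> xA /setUP[yA|yX] yx; last by rewrite (mono_sym c_sym) XA.
  by rewrite /mono eq_sym yx -in_set1 -defK cK // eq_sym.
case/setUP: (xAX) => [xA|xX].
  apply: leq_trans n1; rewrite -(cards1 x); apply: subset_leq_card; apply/subsetP => y.
  by rewrite in_set in_set1 => /andP[yAX]; apply: contraNT; apply: edge.
apply: leq_trans (Xn i iK); apply: subset_leq_card; apply/subsetP => y.
rewrite in_set => /andP[/setUP[yA|//]]; by rewrite XA.
Qed.

Lemma config_bound K : bounded c n K.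
Proof.
have [k] := ubnP #|K|; elim: k K => // k IHk K; rewrite ltnS => leKk A.
have [s] := ubnP #|A|; elim: s A => // s IHs A; rewrite ltnS => leAs X cfg.
have {}IHk (K' : {set C}) : #|K'| < #|K| -> bounded c n K' by move=> h; apply: IHk (leq_trans h leKk).
have {}IHs (A' : {set V}) X' : #|A'| < #|A| -> config c n K A' X' ->
    #|A'| + \sum_(i in K) #|X' i| <= n * 2 ^ #|K|.
  by move=> h; exact: (IHs A' (leq_trans h leAs) X').
have [cK XA Xn] := cfg.
have n4 : 3 < n by case: n45 => ->.
have subK i : i \in K -> #|K :\ i| < #|K| by move=> iK; rewrite (cardsD1 i K) iK.
have [smallA|largeA] := leqP #|A| n.
  have : \sum_(i in K) #|X i| <= \sum_(i in K) n by apply: leq_sum.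
  rewrite sum_nat_const => sumX.
  apply: leq_trans (leq_add smallA sumX) _; rewrite mulnC -mulnS leq_mul2l ltn_expl ?orbT //.
have [/exists_inP[i iK full]|] := boolP [exists i in K, n <= #|X i|].
  have no_i := joined_absent c_sym n45 no_mono (XA i iK) full largeA.
  have cfg' : config c n (K :\ i) A X.
    by split=> [|j /setD1P[_ /XA] //|j /setD1P[_ /Xn] //]; apply: color_setD1.
  have := IHk _ (subK i iK) A X cfg'.
  rewrite (big_setD1 i iK) /= (cardsD1 i K) iK expnS.
  have : 0 < 2 ^ #|K :\ i| by rewrite expn_gt0.
  move: (Xn i iK) => h1 h2 h3.
  have h4 : n <= n * 2 ^ #|K :\ i| by rewrite leq_pmulr.
  by rewrite mulnCA; move: h1 h3 h4; clear; lia.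
rewrite negb_exists_in => /forall_inP Xlt.
have {}Xlt i : i \in K -> #|X i| < n by move/Xlt; rewrite -ltnNge.
have [x0 [y0 [x0A y0A xy0]]] : exists x y, [/\ x \in A, y \in A & x != y].
  by apply/card_gt1P; apply: leq_ltn_trans largeA; apply: leq_trans n4.
have K0 : 0 < #|K| by apply/card_gt0P; exists (c x0 y0); apply: cK.
have [K1|K2] := leqP #|K| 1.
  have /cards1P[i defK] : #|K| == 1 by rewrite eqn_leq K1.
  have := bound_one_color defK cfg; rewrite defK big_set1 cards1; clear; lia.
have sumX2 r b : r \in K -> b \in K -> r != b ->
    \sum_(i in K) #|X i| = #|X r| + (#|X b| + \sum_(i in K :\ r :\ b) #|X i|).
  by move=> rK bK rb; rewrite (big_setD1 r rK) (big_setD1 b) //= in_setD1 bK eq_sym rb.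
have cardK2 r b : r \in K -> b \in K -> r != b -> #|K| = #|K :\ r :\ b|.+2.
  by move=> rK bK rb; rewrite (cardsD1 r K) rK (cardsD1 b (K :\ r)) in_setD1 bK eq_sym rb.
have [K3|K3] := leqP #|K| 2.
  have K2' : #|K| == 2 by rewrite eqn_leq K3.
  have /cards2P[r [b [rb defK]]] := K2'.
  have [rK bK] : r \in K /\ b \in K by rewrite defK !inE !eqxx orbT.
  rewrite (sumX2 r b) // big_pred0 => [|i]; last by rewrite defK !inE; case: (i == r); case: (i == b).
  rewrite (eqP K2') addn0 leqNgt; apply/negP => large.
  (* With two colors the singletons already form the partition, so [f] is the identity and the
     threshold 4n applies. *)
  apply: (@tiny_parts _ _ _ _ c_sym n45 no_mono K A X id cfg _ r b rK bK rb) => //.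
  - by move=> x y z _ _ _ ->.
  - by move=> x y xA yA xy; have := cK x y xA yA xy; rewrite defK => /set2P.
  - by move: (Xlt r rK) (Xlt b bK) large; clear; lia.
  - by left; split=> //; move: large; clear; lia.
have A1 : 1 < #|A| by apply: leq_ltn_trans largeA; apply: leq_trans n4.
have [r [b [f [rK bK rb [x1 [y1 [x1A y1A fxy1]]] [frb fmod]]]]] :=
  gallai_partition c_sym c_gallai A1 K2 cK.
have br : b != r by rewrite eq_sym.
have fbr x y : x \in A -> y \in A -> f x != f y -> c x y = b \/ c x y = r.
  by move=> xA yA /(frb x y xA yA)[]; [right|left].
have Krb : #|K :\ r :\ b| < #|K| by rewrite (cardK2 r b).
have Kbr : #|K :\ b :\ r| < #|K| by rewrite (cardK2 b r).
have [/exists_inP[a aA large_a]|no_large] := boolP [exists a in A, n < #|part A f a|].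
  have [/exists_inP[a' a'A /andP[faa' large_a']]|one] :=
      boolP [exists a' in A, (f a != f a') && (n < #|part A f a'|)].
    case: (frb a a' aA a'A faa') => caa'.
      exact: (two_large c_sym n45 no_mono cfg fmod rK bK rb frb aA a'A faa' caa'
                large_a large_a' (IHk _ (subK r rK)) (IHk _ (subK b bK)) (IHk _ Krb)).
    exact: (two_large c_sym n45 no_mono cfg fmod bK rK br fbr aA a'A faa' caa'
              large_a large_a' (IHk _ (subK b bK)) (IHk _ (subK r rK)) (IHk _ Kbr)).
  have small x : x \in A -> f x != f a -> #|part A f x| <= n.
    move=> xA fxa; rewrite leqNgt; apply: contra one => large_x.
    by apply/exists_inP; exists x; rewrite // eq_sym fxa.
  have [small_r|large_r] := leqP #|side c A f a r :|: X r| n; last first.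
    have [small_b|large_b] := leqP #|side c A f a b :|: X b| n.
      exact: (one_side c_sym n45 no_mono cfg fmod rK bK rb frb (IHk _ (subK r rK)) aA
                large_a large_r small_b).
    exact: (both_sides c_sym n45 no_mono cfg fmod rK bK rb frb (IHk _ Krb) K3 aA
              large_a small large_r large_b).
  have [small_b|large_b] := leqP #|side c A f a b :|: X b| n; last first.
    exact: (one_side c_sym n45 no_mono cfg fmod bK rK br fbr (IHk _ (subK b bK)) aA
              large_a large_b small_r).
  pose X' i := if i == r then side c A f a r :|: X r
               else if i == b then side c A f a b :|: X b else X i.
  have cfg' : config c n K (part A f a) X'.
    split=> [x y /(subsetP (part_sub A f a)) xA /(subsetP (part_sub A f a))|i iK|i iK].
    - exact: cK.
    - rewrite /X'; have [->|_] := eqVneq i r; first exact: attached_joined cfg fmod _ _ rK aA.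
      have [->|_] := eqVneq i b; first exact: attached_joined cfg fmod _ _ bK aA.
      by move=> x y xX /(subsetP (part_sub A f a)); apply: XA.
    - by rewrite /X'; case: (i == r) => //; case: (i == b) => //; apply: Xn.
  have lt_part : #|part A f a| < #|A|.
    apply: proper_card; apply/properP; split; first exact: part_sub.
    have [fx|fx] := eqVneq (f x1) (f a); last by exists x1; rewrite // in_set (negbTE fx) andbF.
    by exists y1; rewrite // in_set -fx eq_sym (negbTE fxy1) andbF.
  have := IHs _ X' lt_part cfg'; rewrite (sumX2 r b) //.
  rewrite (big_setD1 r rK) (big_setD1 b) /=; last by rewrite in_setD1 br.
  rewrite (eq_bigr (fun i => #|X i|)); last first.
    by move=> i /setD1P[ib /setD1P[ir _]]; rewrite /X' (negbTE ib) (negbTE ir).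
  rewrite /X' eqxx (negbTE br) eqxx (card_side_attached f cfg a rK) (card_side_attached f cfg a bK).
  by move: (card_sides frb aA); clear; lia.
rewrite negb_exists_in in no_large.
have small x : x \in A -> #|part A f x| <= n.
  by move=> xA; rewrite leqNgt; apply: (forall_inP no_large x xA).
rewrite (sumX2 r b) // leqNgt; apply/negP => large.
have restX : \sum_(i in K :\ r :\ b) #|X i| <= (#|K| - 2) * n.-1.
  rewrite (cardK2 r b) // subSS subSS subn0 -sum_nat_const.
  by apply: leq_sum => i /setD1P[_ /setD1P[_ iK]]; move: (Xlt i iK) n4; clear; lia.
have large' : 7 * n + 2 <= #|A| + (#|X r| + #|X b|).
  by move: large restX (pow_lower K3); clear; lia.
have [a aA a_max] : exists2 a, a \in A & forall x, x \in A -> #|part A f x| <= #|part A f a|.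
  case: (@arg_maxnP _ x0 (mem A) (fun x => #|part A f x|) x0A) => a aA h.
  by exists a.
have [tiny|t3] := leqP #|part A f a| 2.
  apply: (tiny_parts c_sym n45 no_mono cfg fmod rK bK rb frb).
    by move: (Xlt r rK) (Xlt b bK) large' n4; clear; lia.
  by right; split=> // x xA; apply: leq_trans (a_max x xA) tiny.
have t_bounds : 2 < #|part A f a| <= n by rewrite t3 small.
have := small_parts c_sym n45 no_mono cfg fmod rK bK frb K3 aA t_bounds a_max (Xlt r rK) (Xlt b bK).
by move: large'; clear; lia.
Qed.

Lemma gallai_bound : #|V| <= n * 2 ^ #|C|.
Proof.
have := @bounded0 _ _ c n [set: C] [set: V] (@config_bound _).
by rewrite !cardsT; apply=> x y _ _ _; rewrite in_setT.
Qed.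

End Main.

(** * The iterated doubling coloring *)

Section LowerBound.

Variables (n k : nat).
Hypotheses (n_gt0 : 0 < n) (k_gt0 : 0 < k).

Let block d x := x %/ (n * 2 ^ d.+1).

(* The ultrametric coloring of the iterated doubling of K_(2n): color 0 inside the blocks of
   size 2n, color d+1 between the two halves of a block of size n 2^(d+2). *)
Definition level x y := find (fun d => block d x == block d y) (iota 0 k).

Let blockS d x : block d.+1 x = block d x %/ 2.
Proof. by rewrite /block [2 ^ d.+2]expnSr mulnA divnMA. Qed.

Let block_mono d d' x y : d <= d' -> block d x = block d y -> block d' x = block d' y.
Proof. by move=> /subnKC<-; elim: (d' - d) => [|j IH] xy; rewrite ?addn0 // addnS !blockS IH. Qed.

Lemma level_sym x y : level x y = level y x.
Proof. by apply: eq_find => d; rewrite eq_sym. Qed.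

Lemma level_lt x y : x < n * 2 ^ k -> y < n * 2 ^ k -> level x y < k.
Proof.
move=> xN yN; rewrite -[X in _ < X](size_iota 0 k) -has_find; apply/hasP.
exists k.-1; first by rewrite mem_iota add0n; case: (k) k_gt0 => //= j _.
by rewrite /block prednK // !divn_small.
Qed.

Lemma level_block x y : level x y < k -> block (level x y) x = block (level x y) y.
Proof.
move=> lt; have := lt; rewrite -{1}(size_iota 0 k) -has_find => /(nth_find 0).
by rewrite nth_iota // => /eqP.
Qed.

Lemma level_before d x y : d < level x y -> block d x <> block d y.
Proof.
move=> h; have dk : d < k.
  by apply: leq_trans h _; rewrite -[X in _ <= X](size_iota 0 k) find_size.
by have /negbT/eqP := before_find 0 h; rewrite nth_iota.
Qed.

Lemma level_ultra x y z : level x z < k -> level x y < k -> level y z < k ->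
  level x z <= maxn (level x y) (level y z).
Proof.
move=> xz xy yz; rewrite leqNgt; apply/negP => /level_before; apply.
apply: (@etrans _ _ (block (maxn (level x y) (level y z)) y)).
  exact: block_mono (leq_maxl _ _) (level_block xy).
exact: block_mono (leq_maxr _ _) (level_block yz).
Qed.

(** Color 0 would confine 2n + 1 distinct vertices to one block of size 2n. In color d + 1 each step
    switches between the two halves of a block, so a closed walk has even length. *)
Lemma level_no_odd_cycle (h : nat -> nat) : (forall i, i <= n.*2 -> h i < n * 2 ^ k) ->
    {in gtn n.*2.+1 &, injective h} ->
  ~ exists d, level (h n.*2) (h 0) = d /\ forall i, i < n.*2 -> level (h i) (h i.+1) = d.
Proof.
move=> hN h_inj [d [hlast hstep]].
have dk : d < k by rewrite -hlast level_lt ?hN.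
case: d hlast hstep dk => [|d] hlast hstep dk.
  have same i : i <= n.*2 -> block 0 (h i) = block 0 (h 0).
    elim: i => // i IH ilt; rewrite -(IH (ltnW ilt)).
    by have := @level_block (h i) (h i.+1); rewrite hstep // => ->.
  have n2 : 0 < n * 2 by rewrite muln_gt0 n_gt0.
  have : uniq (map (fun i => h i %% (n * 2)) (iota 0 n.*2.+1)).
    rewrite map_inj_in_uniq ?iota_uniq // => i j; rewrite !mem_iota !add0n /= => iN jN hij.
    apply: h_inj => //; rewrite (divn_eq (h i) (n * 2)) (divn_eq (h j) (n * 2)) hij.
    by have := same i iN; rewrite -(same j jN) /block expn1 => ->.
  move/(@uniq_leq_size _ _ (iota 0 (n * 2))).
  rewrite size_map !size_iota => /(_ _); rewrite muln2 ltnn => le; apply: notF; apply: le.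
  by move=> y /mapP[i _ ->]; rewrite mem_iota add0n -muln2 ltn_mod.
have flip x y : level x y = d.+1 -> odd (block d y) = ~~ odd (block d x).
  move=> xy; have nb : block d x <> block d y by apply: level_before; rewrite xy.
  have := @level_block x y; rewrite xy !blockS => /(_ dk) b.
  have [oe|] := eqVneq (odd (block d y)) (odd (block d x)); last by case: (odd _); case: (odd _).
  by case: nb; rewrite (divn_eq (block d x) 2) (divn_eq (block d y) 2) b !modn2 oe.
have par i : i <= n.*2 -> odd (block d (h i)) = odd i (+) odd (block d (h 0)).
  elim: i => // i IH ilt; rewrite (flip _ _ (hstep i ilt)) IH ?(ltnW ilt) //=.
  by rewrite addNb.
have := flip _ _ hlast; rewrite (par n.*2) // odd_double /=.
by case: (odd _).
Qed.

End LowerBound.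

(** Every [M] up to n 2^k is covered, by restriction, because minimality of the Gallai-Ramsey number
    concerns all smaller orders. Rainbow triangles are excluded since in an ultrametric the two
    largest of three levels coincide. *)
Lemma level_coloring (n k M : nat) : 0 < n -> 0 < k -> M <= n * 2 ^ k ->
  exists c : 'I_M -> 'I_M -> 'I_k,
    gallai_coloring c /\ ~ monochromatic_copy (cycle_graph (2 * n + 1)) c.
Proof.
move=> n0; case: k => // k k0 MN.
have lt (x y : 'I_M) : level n k.+1 x y < k.+1.
  by apply: level_lt => //; apply: leq_trans MN; apply: ltn_ord.
exists (fun x y => Ordinal (lt x y)); split; first split.
- by move=> x y; apply: val_inj; rewrite /= level_sym.
- move=> [x [y [z [_ [cxy cyz cxz]]]]].
  have [ne1 ne2 ne3] : [/\ level n k.+1 x y <> level n k.+1 y z,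
      level n k.+1 y z <> level n k.+1 x z & level n k.+1 x y <> level n k.+1 x z].
    by split=> h; [apply: cxy | apply: cyz | apply: cxz]; apply: val_inj.
  have := level_ultra (lt x z) (lt x y) (lt y z).
  have := level_ultra (lt x y) (lt x z) (lt z y).
  have := level_ultra (lt y z) (lt y x) (lt x z).
  rewrite !(level_sym _ _ z y) !(level_sym _ _ y x).
  by move: ne1 ne2 ne3; clear; lia.
move=> [a [f [f_inj fa]]].
have m_eq : (2 * n + 1) = (n.*2).+1 by rewrite addn1 mul2n.
have m0 : 0 < 2 * n + 1 by rewrite addn1.
pose o i : 'I_(2 * n + 1) := insubd (Ordinal m0) i.
have oE i : i <= n.*2 -> o i = i :> nat by move=> iN; have iM : i < 2 * n + 1; [rewrite m_eq | rewrite val_insubd iM].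
apply: (@level_no_odd_cycle n k.+1 n0 k0 (fun i => f (o i))).
- by move=> i _; apply: leq_trans MN; apply: ltn_ord.
- move=> i j iN jN /val_inj/f_inj oij.
  by rewrite -(oE i) // oij oE.
have n2 : 0 < n.*2 by rewrite double_gt0.
exists (val a); split=> [|i iN].
  have -> // : level n k.+1 (f (o n.*2)) (f (o 0)) = Ordinal (lt (f (o n.*2)) (f (o 0))) by [].
  rewrite fa //= /cycle_adj -val_eqE /= !oE // m_eq modnn eqxx.
  by rewrite -lt0n n2.
have -> // : level n k.+1 (f (o i)) (f (o i.+1)) = Ordinal (lt (f (o i)) (f (o i.+1))) by [].
rewrite fa //= /cycle_adj -val_eqE /= !oE ?(ltnW iN) // m_eq modn_small //.
by rewrite eqxx neq_ltn ltnSn.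
Qed.

Lemma cycle_copy (n k N : nat) (c : 'I_N -> 'I_N -> 'I_k) i s : (forall x y, c x y = c y x) ->
    uniq s -> size s = n.*2.+1 -> cycle (mono c i) s ->
  monochromatic_copy (cycle_graph (2 * n + 1)) c.
Proof.
move=> c_sym us szs cs; exists i.
have m_eq : 2 * n + 1 = size s by rewrite szs addn1 mul2n.
have x0 : 'I_N by case: s szs {us cs m_eq}.
exists (fun j : 'I_(2 * n + 1) => nth x0 s j); split=> [j l /eqP|].
  by rewrite nth_uniq -?m_eq // => /eqP/val_inj.
have edge (j l : 'I_(2 * n + 1)) : l = j.+1 %% (2 * n + 1) :> nat ->
    c (nth x0 s j) (nth x0 s l) = i.
  move=> ->; have := cycle_nth x0 cs (i := j); rewrite -m_eq => /(_ (ltn_ord j)).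
  by case/andP=> _ /eqP.
move=> j l /andP[_ /orP[/eqP|/eqP]]; first exact: edge.
by move/edge; rewrite c_sym.
Qed.

Lemma gallai_forces_cycle (n k : nat) : n = 4 \/ n = 5 ->
  gallai_forces k (cycle_graph (2 * n + 1)) (n * 2 ^ k + 1).
Proof.
move=> n45 c [c_sym no_rainbow].
have [/existsP[i /existsP[s /andP[us cs]]]|none] :=
    boolP [exists i, exists s : n.*2.+1.-tuple 'I_(n * 2 ^ k + 1), uniq s && cycle (mono c i) s].
  by apply: (cycle_copy c_sym us _ cs); rewrite size_tuple.
have no_mono i s : uniq s -> size s = n.*2.+1 -> ~~ cycle (mono c i) s.
  move=> us /eqP szs; apply: contra none => cs; apply/existsP; exists i.
  by apply/existsP; exists (Tuple szs); rewrite us.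
have c_gallai x y z : x != y -> y != z -> x != z ->
    [|| c x y == c y z, c y z == c x z | c x y == c x z].
  move=> xy yz xz; apply/negPn; rewrite !negb_or; apply/negP => /and3P[/eqP cxy /eqP cyz /eqP cxz].
  by apply: no_rainbow; exists x, y, z; split; split=> //; apply/eqP.
by exfalso; have := gallai_bound c_sym n45 no_mono c_gallai; rewrite !card_ord addn1 ltnn.
Qed.

Unset Implicit Arguments.

Theorem theorem1p8 (n k : nat) (hn : n = 4 \/ n = 5) (hk : 1 <= k) :
  is_gallai_ramsey k (cycle_graph (2 * n + 1)) (n * 2 ^ k + 1) /\
  (forall c : 'I_(n * 2 ^ k + 1) -> 'I_(n * 2 ^ k + 1) -> 'I_k,
     gallai_coloring c -> monochromatic_copy (cycle_graph (2 * n + 1)) c) /\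
  (exists c : 'I_(n * 2 ^ k) -> 'I_(n * 2 ^ k) -> 'I_k,
     gallai_coloring c /\ ~ monochromatic_copy (cycle_graph (2 * n + 1)) c).
Proof.
have n0 : 0 < n by case: hn => ->.
have forces := @gallai_forces_cycle n k hn.
split; last by split; [exact: forces | exact: level_coloring].
split=> [||M M0 forcesM]; [by rewrite addn1 | exact: forces |].
rewrite addn1 ltnNge; apply/negP => MN.
by have [c [c_gallai no_copy]] := level_coloring n0 hk MN; apply/no_copy/forcesM.
Qed.
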